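(* Fix a positive integer $i$ (for instance $i=1$), let $B(z)$ be the generating function of strips with intrinsic thickness $i$ according to their semi-perimeter, and let $b_n:=[z^n]B(z)$ be its coefficients. Then, as $n\to\infty$, $$b_n=\frac{4^n}{2n}\left[1+O\left(\frac{1}{\log n}\right)\right].$$
   Context: **PPP's.** A parallelogram polyomino is a finite set of unit cells of $\mathbb Z\times\mathbb Z$, defined up to translation, consisting of all cells contained between two lattice paths with unit North ($N$) and East ($E$) steps that intersect only at their common starting and ending points (the upper path and the lower path). Columns are ordered from left (first) to right (last). A periodic parallelogram polyomino (PPP) is a parallelogram polyomino $P$ together with a positive integer $g$, the gluing size, which is at most the minimum of the heights of the first and last columns of $P$; one excludes the PPP's of rectangular shape whose gluing size equals the height of the columns. The PPP is viewed on a cylinder: if $P$ has $H$ rows numbered from bottom to top, the $g$ top cells of the last column are glued to the $g$ bottom cells of the first column, so that row $H-g+i$ is continued on its right by row $i$ for $1\le i\le g$. Rows glued together count as the same row. The width is the number of columns, the height is the number of rows after gluing, i.e. $H-g$, and the semi-perimeter is the sum of the height and the width. **Trunk and intrinsic thickness.** The vertices of a PPP $P$ are the top cells of its columns (column vertices) and the rightmost cells of its rows (row vertices; each glued row has one rightmost cell, found by following the row to the right through the gluing). The parent of a column vertex is the row vertex of the row containing it; the parent of a row vertex is the column vertex of the column containing it. Joining each vertex to its parent gives a graph each of whose connected components has exactly one cycle (possibly of length $2$). Its leaves correspond to the columns or rows of $P$ containing only one vertex. A trunk PPP is a PPP whose graph is a disjoint union of cycles; these are the PPP's with upper path $N^k(NE)^l$,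 lower path $(EN)^lN^k$ and gluing size $k$, with $k,l$ positive integers. Recursively removing from $P$ the rows and columns corresponding to leaves (on the cylinder, so that the gluing size after each removal is the number of rows of the remaining polyomino before gluing minus the number of remaining rows after gluing), one obtains a trunk PPP denoted $trunk(P)$. The intrinsic thickness of $P$ is the gluing size of $trunk(P)$. **Strips.** The rotation of a PPP of width at least $2$ moves the first column to the right of the last column, at the position prescribed by the gluing (its bottom cell being placed in row $H-g+1$), the new gluing size being the number of rows common to the first two columns of the original PPP; for width $1$ the rotation is the identity. A strip is an equivalence class (orbit) of PPP's under rotation. Rotation preserves semi-perimeter and intrinsic thickness, and those of a strip are those of any representative. *)

(* Defs.v *)
From mathcomp Require Import all_boot.
From mathcomp Require Import finmap.
From mathcomp Require Import boolp classical_sets functions cardinality.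

Set Implicit Arguments.
Unset Strict Implicit.
Unset Printing Implicit Defensive.

Local Open Scope nat_scope.

(* Lattice paths from (0,0): [true] is a North step, [false] an East step. *)
Definition lattice_path := seq bool.

Definition point (p : lattice_path) (k : nat) : nat * nat :=
  (count negb (take k p), count id (take k p)).

(* Ordinates of the successive East steps of a path. *)
Definition east_heights (p : lattice_path) : seq nat :=
  [seq count id (take k p) | k <- iota 0 (size p) & ~~ nth true p k].

(* A point reached after k steps lies on the line x + y = k, so two paths can
   only meet after the same number of steps. *)
Definition path_pair (up low : lattice_path) : Prop :=
  [/\ ohead up = Some true, ohead low = Some false,
      point up (size up) = point low (size low) &
      forall k, 0 < k < size up -> point up k != point low k].

(* A set of cells, up to translation, is given column by column: the pair
   (b, t) at position x stands for the cells (x, y) with b <= y < t. Rows and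
   columns are numbered from 0. *)
Definition parallelogram (cs : seq (nat * nat)) : Prop :=
  exists up low : lattice_path,
    path_pair up low /\ cs = zip (east_heights low) (east_heights up).

(* The data of a PPP; [is_ppp] below carves out the actual PPP's. *)
Record ppp_data := PPPData { columns : seq (nat * nat); gluing : nat }.

Section Invariants.
Variable P : ppp_data.

Definition column (x : nat) : nat * nat := nth (0, 0) (columns P) x.
Definition column_height (x : nat) : nat := (column x).2 - (column x).1.
Definition width : nat := size (columns P).

(* Number of rows before gluing. *)
Definition nrows : nat := (column width.-1).2 - (column 0).1.

(* Number of rows after gluing. *)
Definition height : nat := nrows - gluing P.
Definition semi_perimeter : nat := height + width.

Definition rectangular : bool := all (pred1 (0, nrows)) (columns P).

Definition is_ppp : Prop :=
  [/\ parallelogram (columns P),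
      0 < gluing P <= minn (column_height 0) (column_height width.-1) &
      ~ (rectangular /\ gluing P = nrows)].

Definition cell (v : nat * nat) : bool :=
  (v.1 < width) && ((column v.1).1 <= v.2 < (column v.1).2).

Definition cells : seq (nat * nat) :=
  [seq v <- [seq (x, y) | x <- iota 0 width, y <- iota 0 nrows] | cell v].

(* Right neighbour of a cell: the last column continues, through the gluing,
   with the first one. *)
Definition right_neighbour (v : nat * nat) : option (nat * nat) :=
  if cell (v.1.+1, v.2) then Some (v.1.+1, v.2)
  else if (v.1.+1 == width) && (height <= v.2) then Some (0, v.2 - height)
  else None.

Definition column_vertex (v : nat * nat) : bool := v.2.+1 == (column v.1).2.
Definition row_vertex (v : nat * nat) : bool := right_neighbour v == None.

(* The cells of the column vertices followed by those of the row vertices: a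
   cell playing both roles would count as two vertices. *)
Definition vertices : seq (nat * nat) :=
  filter column_vertex cells ++ filter row_vertex cells.

(* Row [height + y] is glued to row [y] for y < gluing, so that two rows become
   the same row exactly when they are congruent modulo [height]. *)
Definition glued_row (y : nat) : nat := y %% height.

Definition leaf_column (x : nat) : bool :=
  count (fun v => v.1 == x) vertices == 1.
Definition leaf_row (r : nat) : bool :=
  count (fun v => glued_row v.2 == r) vertices == 1.

End Invariants.

(* Translates columns so that the first one starts in row 0. *)
Definition normalize (cs : seq (nat * nat)) : seq (nat * nat) :=
  let b := (head (0, 0) cs).1 in [seq (c.1 - b, c.2 - b) | c <- cs].

(* Simultaneous removal of the columns and of the (glued) rows corresponding to
   the leaves; [rank y] is the number of rows kept below row [y]. *)
Definition prune (P : ppp_data) : ppp_data :=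
  let kept y := ~~ leaf_row P (glued_row P y) in
  let rank y := count kept (iota 0 y) in
  let xs := [seq x <- iota 0 (width P) | ~~ leaf_column P x] in
  let cs := normalize [seq (rank (column P x).1, rank (column P x).2) | x <- xs] in
  PPPData cs (nrows (PPPData cs 0) - rank (height P)).

(* A pruning that removes anything decreases the semi-perimeter, so this many
   prunings reach a PPP without leaves. *)
Definition trunk (P : ppp_data) : ppp_data := iter (semi_perimeter P) prune P.

Definition intrinsic_thickness (P : ppp_data) : nat := gluing (trunk P).

(* In a PPP the rows common to the first two columns c0 and c1 are those from
   c1.1 (included) to c0.2 (excluded). *)
Definition rotation (P : ppp_data) : ppp_data :=
  if columns P is c0 :: c1 :: cs then
    PPPData
      (normalize (rcons (c1 :: cs) (height P, height P + column_height P 0)))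
      (c0.2 - c1.1)
  else P.

Local Open Scope classical_set_scope.

(* A PPP of width w is fixed by the w-th iterate of the rotation, hence forward
   iterates give the whole orbit. *)
Definition strip_of (P : ppp_data) : set ppp_data :=
  [set Q | exists k, Q = iter k rotation P].

Definition strips (i n : nat) : set (set ppp_data) :=
  [set strip_of P | P in
    [set P | [/\ is_ppp P, semi_perimeter P = n & intrinsic_thickness P = i]]].

(* Coefficient of z^n in the generating function of the strips of intrinsic
   thickness i. *)
Definition strip_coef (i n : nat) : nat := #|` fset_set (strips i n)|%fset.

(* Main.v *)
From Stdlib Require Import ZArith Lia.
Require Import Defs.
From mathcomp Require Import all_boot all_order all_algebra.
From mathcomp Require Import finmap zify ssrZ ring lra.
From mathcomp Require Import all_classical all_reals all_analysis.
Import Order.TTheory GRing.Theory Num.Theory numFieldNormedType.Exports.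

(** Unrolled on the universal cover of the cylinder, a PPP with [w] columns and
    [h] glued rows becomes a pair of weakly increasing maps of the integers:
    [alpha] sends a column to the row of its top cell, [beta] sends a row to the
    column of its rightmost cell, and both commute with the deck translation by
    [(w, h)].  They are the two halves of the parent relation.  The trunk is the
    set of periodic points of [F = beta o alpha]: there are [l] of them per
    period, and [F] moves each of them [k] places further in the trunk.  Pruning
    restricts the maps to their images, which changes neither [l] nor [k], and a
    PPP without leaves has gluing size [k]; so [k] is the intrinsic thickness
    ([thickness_trunk]).

    Fix [k] and [l] and count the pairs of maps rooted at a trunk column, with
    [w + h = n].  A childless column can be inserted in exactly [w + h] ways; it
    raises the number of leaves by one, except when its parent was a leaf itself.
    Exchanging rows and columns gives the same for rows.  This is a recursion for
    the binomial moments of the number of leaves ([leaf_sum_step],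
    [binomial_moment]).  Since exactly one rooted pair has no leaf, and its size
    is [2l], the alternating sum of the moments is known, and the recursion is
    solved by a finite difference: the number of rooted pairs of size [n] is
    [2l/n] times [C(2n, n-2l)], whatever [k] is ([rooted_number_closed]).

    A strip with [l] trunk columns is obtained from exactly [l] rooted pairs,
    or from fewer when a proper translation preserves it ([strip_fiber]).  A
    strip with such a symmetry is determined by a period of size at most [n/2],
    so there are at most a polynomial times [2^n] of them ([symmetry_bound]).
    Up to this error the number of strips is the sum over [l] of [2/n] times
    [C(2n, n-2l)], that is [(4^n/2 - C(2n, n)) / n] ([every_other_central]), and
    [C(2n, n)] is smaller than [4^n] by a factor of order [sqrt n], which beats
    [ln n]. *)

Set Implicit Arguments.
Unset Strict Implicit.
Unset Printing Implicit Defensive.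

(** * Increasing maps of the integers and their trunks *)

Section IntegerMaps.
Local Open Scope Z_scope.
Implicit Types f g F gam : Z -> Z.

Definition nondec f := forall x y, x <= y -> f x <= f y.
Definition incr f := forall x y, x < y -> f x < f y.
Definition equivariant (p q : Z) f := forall x, f (x + p) = f x + q.

Lemma nondec_step f : (forall x, f x <= f (x + 1)) -> nondec f.
Proof.
move=> H x y xy.
have [n ->] : exists n : nat, y = x + Z.of_nat n by exists (Z.to_nat (y - x)); lia.
elim: n => [|n IH]; first by rewrite Z.add_0_r; lia.
by have := H (x + Z.of_nat n); rewrite (_ : x + Z.of_nat n.+1 = x + Z.of_nat n + 1); lia.
Qed.

Lemma incr_step f : (forall x, f x < f (x + 1)) -> incr f.
Proof.
move=> H x y xy.
have : nondec (fun x => f x - x) by apply: nondec_step => z; have := H z; lia.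
move=> /(_ x y); lia.
Qed.

Lemma incr_inj f x y : incr f -> f x = f y -> x = y.
Proof.
move=> H; case: (Z.lt_trichotomy x y) => [/H|[|/H]]; lia.
Qed.

Lemma incr_le f x y : incr f -> f x <= f y -> x <= y.
Proof. by move=> H; case: (Z.lt_trichotomy x y) => [|[|/H]]; lia. Qed.

Lemma incr_lt f x y : incr f -> f x < f y -> x < y.
Proof. by move=> H; case: (Z.lt_trichotomy x y) => [|[->|/H]]; lia. Qed.

Lemma incr_nondec f : incr f -> nondec f.
Proof. by move=> H x y; case: (Z.eq_dec x y) => [->|]; [lia | have := H x y; lia]. Qed.

Lemma equivariant_mul p q f : equivariant p q f ->
  forall m x, f (x + p * m) = f x + q * m.
Proof.
move=> H m.
have Hn (n : nat) x : f (x + p * Z.of_nat n) = f x + q * Z.of_nat n.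
  elim: n => [|n IH]; first by rewrite !Z.mul_0_r !Z.add_0_r.
  rewrite (_ : x + p * Z.of_nat n.+1 = x + p * Z.of_nat n + p); last lia.
  by rewrite H IH; lia.
move=> x; case: (Z.le_ge_cases 0 m) => Hm.
  by have := Hn (Z.to_nat m) x; rewrite Z2Nat.id.
have := Hn (Z.to_nat (- m)) (x + p * m); rewrite Z2Nat.id; last lia.
rewrite (_ : x + p * m + p * - m = x); lia.
Qed.

(** An image determines its increasing enumeration up to the choice of the origin:
    [f] and [g] take their successive values at the same time. *)
Lemma incr_same_image f g : incr f -> incr g ->
  (forall x, exists y, f x = g y) -> (forall y, exists x, g y = f x) ->
  exists c, forall x, f x = g (x + c).
Proof.
move=> fI gI fg gf.
have [c0 Hc0] := fg 0.
have next x y : f x = g y -> f (x + 1) = g (y + 1).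
  move=> E.
  have [y' E'] := fg (x + 1); have [x' E''] := gf (y + 1).
  have a : y < y' by apply: (incr_lt gI); rewrite -E -E'; apply: fI; lia.
  have b : x < x' by apply: (incr_lt fI); rewrite E -E''; apply: gI; lia.
  have : y' <= y + 1.
    by apply: (incr_le gI); rewrite -E' E''; apply: (incr_nondec fI); lia.
  by move=> ?; rewrite E'; congr g; lia.
have prev x y : f x = g y -> f (x - 1) = g (y - 1).
  move=> E.
  have [y' E'] := fg (x - 1); have [x' E''] := gf (y - 1).
  have a : y' < y by apply: (incr_lt gI); rewrite -E -E'; apply: fI; lia.
  have b : x' < x by apply: (incr_lt fI); rewrite E -E''; apply: gI; lia.
  have : y - 1 <= y'.
    by apply: (incr_le gI); rewrite -E' E''; apply: (incr_nondec fI); lia.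
  by move=> ?; rewrite E'; congr g; lia.
exists c0 => x.
have Hp (n : nat) : f (Z.of_nat n) = g (Z.of_nat n + c0).
  elim: n => [|n IH]; first by rewrite Z.add_0_l.
  have -> : Z.of_nat n.+1 = Z.of_nat n + 1 by lia.
  by rewrite (next _ _ IH); congr g; lia.
have Hm (n : nat) : f (- Z.of_nat n) = g (- Z.of_nat n + c0).
  elim: n => [|n IH]; first by rewrite Z.add_0_l.
  have -> : - Z.of_nat n.+1 = - Z.of_nat n - 1 by lia.
  by rewrite (prev _ _ IH); congr g; lia.
case: (Z.le_ge_cases 0 x) => Hx.
  by have := Hp (Z.to_nat x); rewrite Z2Nat.id.
have := Hm (Z.to_nat (- x)); rewrite Z2Nat.id; last lia.
by rewrite Z.opp_involutive.
Qed.

(** [gam] lists the periodic points of [F] in increasing order, [l] of them in a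
    period [w].  The last clause says that none is missing: a fixed iterate of [F]
    maps everything into the list, in particular every point that is periodic modulo
    [w]. *)
Definition trunk_along F (w l k : Z) gam :=
  [/\ incr gam, equivariant l w gam, forall j, F (gam j) = gam (j + k)
    & exists N : nat, forall x, exists j, iter N F x = gam j].

Lemma trunk_iter F w l k gam : trunk_along F w l k gam ->
  forall N j, iter N F (gam j) = gam (j + k * Z.of_nat N).
Proof.
case=> _ _ H _; elim=> [|N IH] j; first by rewrite Z.mul_0_r Z.add_0_r.
by rewrite iterS IH H; congr gam; lia.
Qed.

(** A trunk point is the [N]-th iterate of the trunk point [k * N] places before it,
    so it lies in any other set that absorbs the [N]-th iterates. *)
Lemma trunk_image F w l k gam l' k' gam' :
  trunk_along F w l k gam -> trunk_along F w l' k' gam' ->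
  forall j, exists j', gam j = gam' j'.
Proof.
move=> T [_ _ _ [N HN]] j; have [j' Hj'] := HN (gam (j - k * Z.of_nat N)).
by exists j'; rewrite -Hj' (trunk_iter T); congr gam; lia.
Qed.

Lemma trunk_unique F w l k gam l' k' gam' : 0 < w ->
  trunk_along F w l k gam -> trunk_along F w l' k' gam' -> l = l' /\ k = k'.
Proof.
move=> w0 T T'.
have [gI gE gF _] := T; have [gI' gE' gF' _] := T'.
have [c Hc] := incr_same_image gI gI' (trunk_image T T') (trunk_image T' T).
split.
  have : gam' (l + c) = gam' (l' + c).
    rewrite -Hc (_ : l = 0 + l) // gE (_ : l' + c = 0 + c + l'); last lia.
    by rewrite gE' Hc.
  by move/(incr_inj gI'); lia.
have : gam' (k + c) = gam' (k' + c).
  rewrite -Hc (_ : k = 0 + k) // -gF Hc gF'; congr gam'; lia.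
by move/(incr_inj gI'); lia.
Qed.

(** [F0] is [F] seen through the enumeration [e] of a set that contains the image of
    [F].  Periodic points lie in that image, so [F] and [F0] have the same trunk.
    Removing leaves, one at a time or all together, is of this form. *)
Section Transfer.
Variables (e F F0 : Z -> Z) (w w0 : Z).
Hypothesis eI : incr e.
Hypothesis eE : equivariant w0 w e.
Hypothesis eF : forall x, F (e x) = e (F0 x).
Hypothesis Fim : forall x, exists y, F x = e y.

Lemma transfer_iter N x : iter N F (e x) = e (iter N F0 x).
Proof. by elim: N => //= N ->; rewrite eF. Qed.

Lemma trunk_extend l k gam : trunk_along F0 w0 l k gam ->
  trunk_along F w l k (fun j => e (gam j)).
Proof.
case=> gI gE gF [N HN]; split.
- by move=> x y /gI /eI.
- by move=> x; rewrite gE eE.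
- by move=> j; rewrite eF gF.
- exists N.+1 => x; rewrite iterSr; have [y ->] := Fim x.
  by have [j Hj] := HN y; exists j; rewrite transfer_iter Hj.
Qed.

Lemma trunk_restrict l k gam : trunk_along F w l k gam ->
  exists2 gam0, trunk_along F0 w0 l k gam0 & forall j, gam j = e (gam0 j).
Proof.
case=> gI gE gF [N HN].
have /choice [gam0 H0] : forall j, exists y, gam j = e y.
  by move=> j; have := gF (j - k); rewrite Z.sub_add => <-.
exists gam0 => //; split.
- by move=> x y /gI; rewrite !H0 => /(incr_lt eI).
- by move=> x; apply: (incr_inj eI); rewrite eE -!H0.
- by move=> j; apply: (incr_inj eI); rewrite -eF -!H0.
- exists N => x; have [j Hj] := HN (e x); exists j.
  by apply: (incr_inj eI); rewrite -transfer_iter Hj.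
Qed.

End Transfer.
End IntegerMaps.

(** * Rooted pairs of parent maps and insertion of a leaf *)

Section Counting.
Local Open Scope Z_scope.
Implicit Types P Q : Z -> Prop.

Definition zcount P (a : Z) (n : nat) : nat :=
  (\sum_(i < n) `[< P (Z.add a (Z.of_nat i)) >])%N.

Lemma zcount_cat P a m n : zcount P a (m + n) =
  (zcount P a m + zcount P (Z.add a (Z.of_nat m)) n)%N.
Proof.
rewrite /zcount big_split_ord /=; congr (_ + _)%N; apply: eq_bigr => i _.
by congr (nat_of_bool `[< P _ >]); rewrite /=; lia.
Qed.

Lemma zcount1 P a : zcount P a 1 = `[< P a >].
Proof. by rewrite /zcount big_ord1 Z.add_0_r. Qed.

Lemma zcount_ext P Q a b n :
  (forall i, 0 <= i < Z.of_nat n -> P (a + i) <-> Q (b + i)) -> zcount P a n = zcount Q b n.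
Proof.
move=> H; rewrite /zcount; apply: eq_bigr => i _.
by congr nat_of_bool; apply/asbool_equiv_eq/H; have := ltn_ord i; lia.
Qed.

Lemma zcount_le P a n : (zcount P a n <= n)%N.
Proof.
rewrite /zcount -[leqRHS]card_ord -sum1_card; apply: leq_sum => i _.
by case: asbool.
Qed.

Lemma zcount_eq0 P a n : zcount P a n = 0%N ->
  forall i, 0 <= i < Z.of_nat n -> ~ P (a + i).
Proof.
move=> /eqP; rewrite /zcount sum_nat_eq0 => /forallP H i Hi.
have Hi' : (Z.to_nat i < n)%N by lia.
have := H (Ordinal Hi') => /=; rewrite Z2Nat.id; last lia.
by case: asboolP.
Qed.

(** Moving the window by one trades [P a] for [P (a + n)]. *)
Lemma zcount_shift P (n : nat) : (forall x, P (x + Z.of_nat n) <-> P x) ->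
  forall a b, zcount P a n = zcount P b n.
Proof.
move=> per.
have step a : zcount P (a + 1) n = zcount P a n.
  have : (zcount P a (n + 1) = zcount P a (1 + n))%N by rewrite addnC.
  rewrite !zcount_cat !zcount1 (_ : `[< P (a + Z.of_nat n) >] = `[< P a >]).
    by rewrite addnC => /addnI.
  by apply: asbool_equiv_eq.
have up (m : nat) a : zcount P (a + Z.of_nat m) n = zcount P a n.
  elim: m => [|m IH]; first by rewrite Z.add_0_r.
  by rewrite -IH -(step (a + Z.of_nat m)); congr zcount; lia.
move=> a b; case: (Z.le_ge_cases a b) => ab.
  by rewrite -(up (Z.to_nat (b - a)) a); congr zcount; lia.
by rewrite -(up (Z.to_nat (a - b)) b); congr zcount; lia.
Qed.

End Counting.

Section Skip.
Local Open Scope Z_scope.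
Variables w x : Z.
Hypothesis xw : 1 <= x <= w.

(** The increasing enumeration of the integers outside the class of [x] modulo
    [w + 1], with [skip x = x + 1]; [unskip] is its monotone left inverse. *)
Definition skip z := z + (z - x) / w + 1.
Definition unskip z := z - 1 - (z - x) / (w + 1).

Lemma div_dec (p z : Z) : 0 < p -> exists q s, z = x + p * q + s /\ 0 <= s < p.
Proof.
move=> p0; exists ((z - x) / p), ((z - x) mod p).
have := Z.div_mod (z - x) p; have := Z.mod_pos_bound (z - x) p; lia.
Qed.

Lemma skip_eval q t : 0 <= t < w -> skip (x + w * q + t) = x + (w + 1) * q + t + 1.
Proof.
move=> Ht; rewrite /skip.
have -> : (x + w * q + t - x) / w = q by symmetry; apply: (Z.div_unique _ _ _ t); lia.
lia.
Qed.

Lemma unskip_eval q s : 0 <= s < w + 1 ->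
  unskip (x + (w + 1) * q + s) = x + w * q + s - 1.
Proof.
move=> Hs; rewrite /unskip.
have -> : (x + (w + 1) * q + s - x) / (w + 1) = q.
  by symmetry; apply: (Z.div_unique _ _ _ s); lia.
lia.
Qed.

Lemma gap_eval q s : 0 <= s < w + 1 ->
  ((x + (w + 1) * q + s - x) mod (w + 1) = s) /\
  ((x + (w + 1) * q + s - x) / (w + 1) = q).
Proof.
move=> Hs; split; last by symmetry; apply: (Z.div_unique _ _ _ s); lia.
by symmetry; apply: (Z.mod_unique _ _ q s); lia.
Qed.

Lemma skip_incr : incr skip.
Proof.
apply: incr_step => z; rewrite /skip.
have := Z.div_le_mono (z - x) (z + 1 - x) w; lia.
Qed.

Lemma skip_equivariant : equivariant w (w + 1) skip.
Proof.
move=> z; rewrite /skip (_ : z + w - x = z - x + 1 * w); last lia.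
by rewrite Z.div_add; lia.
Qed.

Lemma skip_lt z : 0 <= z < x -> skip z = z.
Proof.
move=> Hz; rewrite /skip.
have -> : (z - x) / w = -1 by symmetry; apply: (Z.div_unique _ _ _ (w + z - x)); lia.
lia.
Qed.

Lemma skip_ge z : x <= z < x + w -> skip z = z + 1.
Proof.
move=> Hz; have := @skip_eval 0 (z - x); rewrite (_ : x + w * 0 + (z - x) = z); lia.
Qed.

Lemma skipK z : unskip (skip z) = z.
Proof.
have [|q [t [-> Ht]]] := @div_dec w z; first lia.
by rewrite skip_eval // -Z.add_assoc unskip_eval; lia.
Qed.

Lemma skip_gap z : (skip z - x) mod (w + 1) <> 0.
Proof.
have [|q [t [-> Ht]]] := @div_dec w z; first lia.
rewrite skip_eval // -Z.add_assoc; have [|-> _] := @gap_eval q (t + 1); lia.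
Qed.

Lemma unskipK z : (z - x) mod (w + 1) <> 0 -> skip (unskip z) = z.
Proof.
have [|q [s [-> Hs]]] := @div_dec (w + 1) z; first lia.
have [-> _] := @gap_eval q s Hs => s0.
rewrite unskip_eval // (_ : x + w * q + s - 1 = x + w * q + (s - 1)); last lia.
by rewrite skip_eval; lia.
Qed.

End Skip.

Section Rooted.
Local Open Scope Z_scope.

(** The first map sends columns to rows, the second one rows to columns. *)
Definition parent_maps := ((Z -> Z) * (Z -> Z))%type.
Implicit Types S : parent_maps.

Definition childless_column S (x : Z) := ~ exists y, S.2 y = x.
Definition childless_row S (y : Z) := ~ exists x, S.1 x = y.

Variables l k : Z.

(** Rows and columns are translated so that the root, column 0, and its parent,
    row 0, are vertices of the trunk. *)
Record rooted (w h : Z) S : Prop := Rooted {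
  rooted_w : 0 < w;
  rooted_h : 0 < h;
  rooted_ndC : nondec S.1;
  rooted_ndR : nondec S.2;
  rooted_eqC : equivariant w h S.1;
  rooted_eqR : equivariant h w S.2;
  rooted_0 : S.1 0 = 0;
  rooted_trunk : exists2 gam, trunk_along (fun x => S.2 (S.1 x)) w l k gam & gam 0 = 0 }.

Lemma childless_column_per w h S : rooted w h S -> forall x, childless_column S (x + w) <->
  childless_column S x.
Proof.
move=> R x; split=> H [y Hy]; apply: H.
  by exists (y + h); rewrite (rooted_eqR R) Hy.
by exists (y - h); have := rooted_eqR R (y - h); rewrite Z.sub_add Hy; lia.
Qed.

Lemma childless_row_per w h S : rooted w h S -> forall y, childless_row S (y + h) <->
  childless_row S y.
Proof.
move=> R x; split=> H [y Hy]; apply: H.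
  by exists (y + w); rewrite (rooted_eqC R) Hy.
by exists (y - w); have := rooted_eqC R (y - w); rewrite Z.sub_add Hy; lia.
Qed.

Lemma childless_column_mul w h S : rooted w h S -> forall q x, childless_column S (x + w * q) <->
  childless_column S x.
Proof.
move=> R q x; split=> H [y Hy]; apply: H.
  by exists (y + h * q); rewrite (equivariant_mul (rooted_eqR R)) Hy.
exists (y + h * - q); rewrite (equivariant_mul (rooted_eqR R)) Hy; lia.
Qed.

Lemma childless_row_mul w h S : rooted w h S -> forall q x, childless_row S (x + h * q) <->
  childless_row S x.
Proof.
move=> R q x; split=> H [y Hy]; apply: H.
  by exists (y + w * q); rewrite (equivariant_mul (rooted_eqC R)) Hy.
exists (y + w * - q); rewrite (equivariant_mul (rooted_eqC R)) Hy; lia.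
Qed.

(** The root is never removed with the leaves, so that leaf removal stays within
    rooted pairs. *)
Lemma root_not_childless w h S : rooted w h S -> ~ childless_column S 0.
Proof.
move=> [_ _ _ _ _ _ _ [g [_ _ gF _] g0]]; apply; exists (S.1 (g (- k))).
by rewrite gF Z.add_opp_diag_l.
Qed.

Definition leaf_number (w h : nat) S : nat :=
  (zcount (childless_column S) 0 w + zcount (childless_row S) 0 h)%N.

Section Insertion.
Variables w h x : Z.
Hypothesis xw : 1 <= x <= w.

(** The class of [x] modulo [w + 1] becomes a childless column with parent row [y];
    the old columns keep their order and are renumbered by [skip]. *)
Definition insert_column (y : Z) S : parent_maps :=
  (fun z => if (z - x) mod (w + 1) =? 0 then y + h * ((z - x) / (w + 1))
            else S.1 (unskip w x z),
   fun v => skip w x (S.2 v)).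

Definition delete_column S : parent_maps :=
  (fun z => S.1 (skip w x z), fun v => unskip w x (S.2 v)).

Lemma insert_column_old y S z : (insert_column y S).1 (skip w x z) = S.1 z.
Proof.
rewrite /insert_column /=; case: Z.eqb_spec => [/(skip_gap xw) []|_].
by rewrite (skipK xw).
Qed.

Lemma insert_column_new y S q : (insert_column y S).1 (x + (w + 1) * q) = y + h * q.
Proof.
have := @gap_eval w x q 0; rewrite Z.add_0_r /insert_column /= => -[|-> ->] //; lia.
Qed.

Lemma insert_columnK y S : delete_column (insert_column y S) = S.
Proof.
case: S => a b; congr pair; apply/funext => z; first exact: insert_column_old.
by rewrite /= (skipK xw).
Qed.

Lemma childless_column_avoided S v : rooted (w + 1) h S -> childless_column S x ->
  (S.2 v - x) mod (w + 1) <> 0.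
Proof.
move=> R L E; have [|q [s [E2 Hs]]] := @div_dec x (w + 1) (S.2 v); first lia.
have [E3 _] := @gap_eval w x q s Hs; rewrite E2 E3 in E; subst s.
have /(childless_column_mul R q) [] := L; exists v; lia.
Qed.

Lemma delete_columnK S : rooted (w + 1) h S -> childless_column S x ->
  insert_column (S.1 x) (delete_column S) = S.
Proof.
move=> R L; rewrite [RHS]surjective_pairing; congr pair; apply/funext => z /=; last first.
  by rewrite (unskipK xw) //; apply: childless_column_avoided.
have [|q [s [-> Hs]]] := @div_dec x (w + 1) z; first lia.
have [Es Eq] := @gap_eval w x q s Hs.
case: Z.eqb_spec => E; last by rewrite (unskipK xw).
by rewrite Eq -(equivariant_mul (rooted_eqC R)); congr (S.1 _); lia.
Qed.

Lemma insert_column_conj y S z :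
  (insert_column y S).2 ((insert_column y S).1 (skip w x z)) = skip w x (S.2 (S.1 z)).
Proof. by rewrite insert_column_old. Qed.

Lemma skip_root : skip w x 0 = 0.
Proof. by apply: (skip_lt xw); lia. Qed.

(** The bounds on [y] are what monotonicity requires at the new column; the trunk
    is carried along by [trunk_extend]. *)
Lemma rooted_insert y S : rooted w h S -> S.1 (x - 1) <= y <= S.1 x ->
  rooted (w + 1) h (insert_column y S).
Proof.
move=> R Hy; have [w0 h0 ndC ndR eqC eqR r0 [g T g0]] := R; split => //; first lia.
- apply: nondec_step => z.
  have [|q [s [-> Hs]]] := @div_dec x (w + 1) z; first lia.
  have EC := equivariant_mul eqC.
  case: (Z.eq_dec s 0) => [->|s0].
    rewrite Z.add_0_r insert_column_new.
    have := @skip_eval w x q 0; rewrite !Z.add_0_r => <-; last lia.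
    by rewrite insert_column_old EC; lia.
  have := @skip_eval w x q (s - 1).
  rewrite -(Z.add_assoc _ _ 1) Z.sub_add => <-; last lia.
  rewrite insert_column_old.
  case: (Z.eq_dec s w) => [->|sw].
    rewrite skip_eval; last lia.
    rewrite (_ : _ + 1 + 1 = x + (w + 1) * (q + 1)); last lia.
    rewrite insert_column_new (_ : x + w * q + (w - 1) = x - 1 + w * (q + 1)); last lia.
    by rewrite EC; lia.
  rewrite skip_eval; last lia.
  have := @skip_eval w x q s.
  rewrite (_ : x + (w + 1) * q + (s - 1) + 1 + 1 = x + (w + 1) * q + s + 1); last lia.
  by move=> <-; rewrite ?insert_column_old; [apply: ndC; lia | lia].
- by move=> u v uv; apply: (incr_nondec (skip_incr xw)); apply: ndR.
- move=> z; have [|q [s [-> Hs]]] := @div_dec x (w + 1) z; first lia.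
  case: (Z.eq_dec s 0) => [->|s0].
    rewrite Z.add_0_r (_ : _ + (w + 1) = x + (w + 1) * (q + 1)); last lia.
    by rewrite !insert_column_new; lia.
  have E q' : x + (w + 1) * q' + s = skip w x (x + w * q' + (s - 1)).
    by rewrite skip_eval; lia.
  rewrite (_ : _ + (w + 1) = x + (w + 1) * (q + 1) + s); last lia.
  rewrite !E !insert_column_old -eqC; congr (S.1 _); lia.
- by move=> v; rewrite /= eqR (skip_equivariant xw).
- by have := insert_column_old y S 0; rewrite skip_root r0.
- have := @trunk_extend (skip w x) (fun z =>
  (insert_column y S).2 ((insert_column y S).1 z)) _ (w + 1) w
    (skip_incr xw) (skip_equivariant xw) (insert_column_conj y S).
  move/(_ (fun z => ex_intro _ (S.2 ((insert_column y S).1 z)) erefl) _ _ _ T) => T'.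
  by exists (fun j => skip w x (g j)) => //; rewrite g0 skip_root.
Qed.

(** The image of the second map avoids the class of [x], so the trunk survives by
    [trunk_restrict]. *)
Lemma rooted_delete S : rooted (w + 1) h S -> childless_column S x -> rooted w h (delete_column S).
Proof.
move=> R L; have [w0 h0 ndC ndR eqC eqR r0 [g T g0]] := R.
have K v : skip w x (unskip w x (S.2 v)) = S.2 v.
  by apply: (unskipK xw); apply: childless_column_avoided.
split => //; first lia.
- by move=> u v uv; apply: ndC; apply: (incr_nondec (skip_incr xw)).
- by move=> u v uv; apply: (incr_le (skip_incr xw)); rewrite !K; apply: ndR.
- by move=> z; rewrite /= (skip_equivariant xw) eqC.
- by move=> v; apply: (incr_inj (skip_incr xw)); rewrite (skip_equivariant xw) !K eqR.
- by rewrite /= skip_root.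
- have [||g' T' Hg'] := trunk_restrict (skip_incr xw) (skip_equivariant xw)
     (F := fun z => S.2 (S.1 z)) (F0 := fun z => (delete_column S).2 ((delete_column S).1 z)) _ _ T.
  + by move=> z; rewrite /= K.
  + by move=> z; exists (unskip w x (S.2 (S.1 z))); rewrite K.
  by exists g' => //; apply: (incr_inj (skip_incr xw)); rewrite -Hg' skip_root.
Qed.

Lemma delete_column_bounds S : rooted (w + 1) h S ->
  (delete_column S).1 (x - 1) <= S.1 x <= (delete_column S).1 x.
Proof.
move=> R; rewrite /= (skip_lt xw); last lia.
rewrite skip_ge; last lia.
by split; apply: (rooted_ndC R); lia.
Qed.

Lemma childless_column_new y S : childless_column (insert_column y S) x.
Proof.
move=> [v /= Hv]; apply: (@skip_gap _ _ xw (S.2 v)).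
by rewrite Hv Z.sub_diag Zmod_0_l.
Qed.

Lemma childless_column_insert y S z : childless_column (insert_column y S) (skip w x z) <->
  childless_column S z.
Proof.
split=> H [v Hv]; apply: H; exists v; first by rewrite /= Hv.
by apply: (incr_inj (skip_incr xw)).
Qed.

(** The only row that gains a child is the parent of the new column. *)
Lemma childless_row_insert y S y' : childless_row (insert_column y S) y' <->
  childless_row S y' /\ ~ exists q, y' = y + h * q.
Proof.
split=> [H|[H1 H2] [z]].
  split=> [[z Hz]|[q Hq]]; apply: H; first by exists (skip w x z); rewrite insert_column_old.
  by exists (x + (w + 1) * q); rewrite insert_column_new.
have [|q [s [-> Hs]]] := @div_dec x (w + 1) z; first lia.
case: (Z.eq_dec s 0) => [->|s0].
  by rewrite Z.add_0_r insert_column_new => E; apply: H2; exists q.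
have := @skip_eval w x q (s - 1).
rewrite -(Z.add_assoc _ _ 1) Z.sub_add => <-; last lia.
by rewrite insert_column_old => E; apply: H1; eexists; exact: E.
Qed.

End Insertion.

(** The new column is a leaf, and its parent [y] is a leaf no longer. *)
Lemma leaf_number_insert (w h : nat) x y S : 1 <= x <= Z.of_nat w ->
  rooted (Z.of_nat w) (Z.of_nat h) S -> S.1 (x - 1) <= y <= S.1 x ->
  (leaf_number w.+1 h (insert_column (Z.of_nat w) (Z.of_nat h) x y S) + `[< childless_row S y >] =
   leaf_number w h S + 1)%N.
Proof.
move=> xw R Hy; set S' := insert_column _ _ _ _ _.
have R' := rooted_insert xw R Hy; rewrite -/S' in R'.
have HC : zcount (childless_column S') 0 w.+1 = (zcount (childless_column S) 0 w + 1)%N.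
  have -> : w.+1 = (Z.to_nat x + (1 + (w - Z.to_nat x)))%N by lia.
  rewrite !zcount_cat zcount1 {2}(_ : w = Z.to_nat x + (w - Z.to_nat x))%N; last lia.
  rewrite zcount_cat Z.add_0_l Z2Nat.id; last lia.
  have -> : `[< childless_column S' x >] = true by apply/asboolP/childless_column_new.
  have -> : zcount (childless_column S') 0 (Z.to_nat x) =
    zcount (childless_column S) 0 (Z.to_nat x).
    apply: zcount_ext => i Hi; rewrite !Z.add_0_l -(childless_column_insert (Z.of_nat h) xw y S).
    by rewrite (skip_lt xw); [exact: iff_refl | lia].
  suff -> : zcount (childless_column S') (x + Z.of_nat 1) (w - Z.to_nat x) =
     zcount (childless_column S) x (w - Z.to_nat x) by lia.
  apply: zcount_ext => i Hi; rewrite -(childless_column_insert (Z.of_nat h) xw y S).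
  rewrite skip_ge; last lia.
  by rewrite (_ : x + Z.of_nat 1 + i = x + i + 1); [exact: iff_refl | lia].
suff HR : (zcount (childless_row S') 0 h + `[< childless_row S y >] =
  zcount (childless_row S) 0 h)%N.
  by rewrite /leaf_number HC; lia.
have h0 := rooted_h R.
rewrite (zcount_shift (childless_row_per R) 0 y) (zcount_shift (childless_row_per R') 0 y).
have -> : h = (1 + h.-1)%N by lia.
rewrite !zcount_cat !zcount1.
have -> : `[< childless_row S' y >] = false.
  apply/asboolP => /(childless_row_insert _ xw) [_ []]; exists 0; lia.
suff -> : zcount (childless_row S') (y + Z.of_nat 1) h.-1 =
  zcount (childless_row S) (y + Z.of_nat 1) h.-1 by rewrite add0n addnC.
apply: zcount_ext => i Hi; rewrite (childless_row_insert _ xw); split=> [[] //|L].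
split=> // -[q Hq].
have {}Hq : 1 + i = Z.of_nat h * q by lia.
by case: (Z.le_gt_cases q 0) => q0; [have : Z.of_nat h * q <= 0 by nia | have : Z.of_nat h * q >=
  Z.of_nat h by nia]; lia.
Qed.

End Rooted.

(** * Change of root, exchange of rows and columns, finiteness *)

Section Reroot.
Local Open Scope Z_scope.
Variables l k : Z.
Implicit Types S : parent_maps.
Local Notation rooted := (rooted l k).

Definition reroot S (d : Z) : parent_maps :=
  (fun x => S.1 (x + d) - S.1 d, fun y => S.2 (y + S.1 d) - d).

Lemma reroot0 w h S : rooted w h S -> reroot S 0 = S.
Proof.
move=> R; rewrite [RHS]surjective_pairing; congr pair; apply/funext => z /=.
  by rewrite (rooted_0 R) Z.add_0_r Z.sub_0_r.
by rewrite (rooted_0 R) Z.add_0_r Z.sub_0_r.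
Qed.

Lemma reroot_add w h S d e : rooted w h S -> reroot (reroot S d) e = reroot S (d + e).
Proof.
move=> R; congr pair; apply/funext => z /=.
  rewrite (Z.add_comm e d) (_ : z + e + d = z + (d + e)); lia.
by rewrite (Z.add_comm e d) (_ : z + (S.1 (d + e) - S.1 d) + S.1 d = z + S.1 (d + e)); lia.
Qed.

Lemma reroot_conj S d x :
  (reroot S d).2 ((reroot S d).1 x) = S.2 (S.1 (x + d)) - d.
Proof. by rewrite /= Z.sub_add. Qed.

Lemma trunk_shift w F gam d : trunk_along F w l k gam ->
  trunk_along (fun x => F (x + d) - d) w l k (fun j => gam j - d).
Proof.
case=> gI gE gF [N HN]; split.
- by move=> x y /gI; lia.
- by move=> x; rewrite gE; lia.
- by move=> j; rewrite Z.sub_add gF.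
- exists N => x; have [j Hj] := HN (x + d); exists j; rewrite -Hj.
  by elim: (N) => [|m IH] /=; rewrite ?IH ?Z.sub_add; lia.
Qed.

Lemma trunk_reindex w F gam i : trunk_along F w l k gam ->
  trunk_along F w l k (fun j => gam (j + i)).
Proof.
case=> gI gE gF [N HN]; split.
- by move=> x y xy; apply: gI; lia.
- by move=> x; rewrite -gE; congr gam; lia.
- by move=> j; rewrite gF; congr gam; lia.
- exists N => x; have [j Hj] := HN x; exists (j - i); rewrite Hj; congr gam; lia.
Qed.

Lemma rooted_reroot w h S gam i : rooted w h S ->
  trunk_along (fun x => S.2 (S.1 x)) w l k gam -> rooted w h (reroot S (gam i)).
Proof.
move=> [w0 h0 ndC ndR eqC eqR r0 _] T; split => //.
- by move=> x y xy /=; have := ndC (x + gam i) (y + gam i); lia.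
- by move=> x y xy /=; have := ndR (x + S.1 (gam i)) (y + S.1 (gam i)); lia.
- by move=> x /=; rewrite (_ : x + w + gam i = x + gam i + w) ?eqC; lia.
- move=> x /=; rewrite (_ : x + h + S.1 (gam i) = x + S.1 (gam i) + h) ?eqR; lia.
- by rewrite /= Z.sub_diag.
- have T' := trunk_shift (gam i) (trunk_reindex i T).
  exists (fun j => gam (j + i) - gam i); last by rewrite Z.sub_diag.
  by under eq_fun do rewrite reroot_conj.
Qed.

(** Both roots are trunk vertices, and the trunk is unique. *)
Lemma reroot_trunk w h S gam d : rooted w h S ->
  trunk_along (fun x => S.2 (S.1 x)) w l k gam ->
  rooted w h (reroot S d) -> exists j, d = gam j.
Proof.
move=> R T [_ _ _ _ _ _ _ [g' T' g'0]].
have E : (fun x => S.2 (S.1 x)) =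
    (fun x => (fun x => (reroot S d).2 ((reroot S d).1 x)) (x + - d) - - d).
  by apply/funext => x; rewrite reroot_conj Z.add_opp_r Z.sub_add; lia.
have := trunk_shift (- d) T'; rewrite -E => T''.
by have [j Hj] := trunk_image T'' T 0; exists j; rewrite -Hj g'0; lia.
Qed.

Lemma reroot_period w h S d q : rooted w h S -> reroot S (d + w * q) = reroot S d.
Proof.
move=> R; congr pair; apply/funext => x /=.
  rewrite Z.add_assoc !(equivariant_mul (rooted_eqC R)); lia.
rewrite (equivariant_mul (rooted_eqC R)) Z.add_assoc (equivariant_mul (rooted_eqR R)); lia.
Qed.

Lemma reroot_fundamental w h S gam d : 0 < l -> rooted w h S ->
  trunk_along (fun x => S.2 (S.1 x)) w l k gam -> rooted w h (reroot S d) ->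
  exists2 i, 0 <= i < l & reroot S d = reroot S (gam i).
Proof.
move=> l0 R T R'; have [j ->] := reroot_trunk R T R'.
have E := Z.div_mod j l; have B := Z.mod_pos_bound j l l0.
exists (j mod l) => //; rewrite {1}(_ : j = j mod l + l * (j / l)); last by lia.
have [_ gE _ _] := T.
by rewrite (equivariant_mul gE) (reroot_period _ _ R).
Qed.

(** The old rows become the columns and keep row 0 as root; the old columns become
    the rows, translated so that the parent of the root is row 0 again. *)
Definition transpose S : parent_maps :=
  (fun y => S.2 y - S.2 0, fun x => S.1 (x + S.2 0)).

Lemma rooted_transpose w h S : rooted w h S -> rooted h w (transpose S).
Proof.
move=> [w0 h0 ndC ndR eqC eqR r0 [g [gI gE gF [N HN]] g0]]; split => //=.
- by move=> x y /ndR; lia.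
- by move=> x y xy; apply: ndC; lia.
- by move=> x; rewrite eqR; lia.
- by move=> x; rewrite -eqC; congr (S.1 _); lia.
- by rewrite Z.sub_diag.
- exists (fun j => S.1 (g j)); last by rewrite g0.
  under eq_fun do rewrite Z.sub_add.
  split.
  + move=> x y xy; have := ndC (g x) (g y).
    have : S.1 (g x) <> S.1 (g y).
      move=> E; have : g (x + k) = g (y + k) by rewrite -!gF E.
      by move/(incr_inj gI); lia.
    have := gI x y; lia.
  + by move=> x; rewrite gE eqC.
  + by move=> j; rewrite gF.
  + exists N.+1 => y; have [j Hj] := HN (S.2 y); exists j; rewrite -Hj.
    by elim: (N) => //= m ->.
Qed.

(** Two pairs with the same image differ by a change of root along columns that
    have the same parent row; the first map is injective on the trunk, so these
    columns coincide. *)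
Lemma transpose_inj w h S S' : rooted w h S -> rooted w h S' ->
  transpose S = transpose S' -> S = S'.
Proof.
move=> R R' E; set d := S.2 0 - S'.2 0.
have E1 x : S'.1 x = S.1 (x + d).
  have := congr1 (fun T => T.2 (x - S'.2 0)) E; rewrite /= Z.sub_add => <-.
  by congr (S.1 _); rewrite /d; lia.
have E2 y : S'.2 y = S.2 y - d.
  by have := congr1 (fun T => T.1 y) E; rewrite /= /d; lia.
have Sd : S.1 d = 0 by rewrite -(rooted_0 R') E1.
have ES' : S' = reroot S d.
  rewrite [LHS]surjective_pairing; congr pair; apply/funext => z /=.
    by rewrite E1 Sd Z.sub_0_r.
  by rewrite E2 Sd Z.add_0_r.
have [g T g0] := rooted_trunk R.
rewrite ES' in R'; have [j Hj] := reroot_trunk R T R'.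
have [gI _ gF _] := T.
have : g (j + k) = g (0 + k) by rewrite -!gF -Hj Sd g0 (rooted_0 R).
move/(incr_inj gI) => jk.
by rewrite ES' Hj (_ : j = 0) ?g0 ?(reroot0 R) //; lia.
Qed.

Lemma leaf_number_transpose (w h : nat) S : rooted (Z.of_nat w) (Z.of_nat h) S ->
  zcount (childless_column (transpose S)) 0 h = zcount (childless_row S) 0 h /\
  zcount (childless_row (transpose S)) 0 w = zcount (childless_column S) 0 w.
Proof.
move=> R; split.
  apply: zcount_ext => i _; rewrite /childless_column /childless_row /=; split=> H [x Hx]; apply: H.
    by exists (x - S.2 0); rewrite Z.sub_add.
  by exists (x + S.2 0).
rewrite (zcount_shift (childless_column_per R) 0 (S.2 0)).
apply: zcount_ext => i _; rewrite /childless_column /childless_row /=; split=> H [x Hx]; apply: H.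
  by exists x; lia.
by exists x; lia.
Qed.

Hypothesis l0 : 0 < l.
Hypothesis k0 : 0 <= k.

(** The value at row 0 is the trunk column [k] places after the root, hence at most
    [k] periods away. *)
Lemma root_value_bound w h S : rooted w h S -> 0 <= S.2 0 <= k * w.
Proof.
move=> R; have [g [gI gE gF _] g0] := rooted_trunk R.
have E : S.2 0 = g k by rewrite -[in LHS](rooted_0 R) -[in LHS]g0 gF.
have := incr_nondec gI k0; have : k <= l * k by nia.
move/(incr_nondec gI); have := equivariant_mul gE k 0; rewrite Z.add_0_l => ->.
rewrite E g0; have := rooted_w R; lia.
Qed.

Definition residue_marks (m : nat) (f : Z -> Z) : {set 'I_m} :=
  [set t : 'I_m | `[< exists x, f x = Z.of_nat t >]].

(** By equivariance the residues modulo [m] of the image determine the image, and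
    an increasing map is determined by its image and its value at 0. *)
Lemma residue_marks_inj a (m : nat) f g : 0 < Z.of_nat m ->
  incr f -> incr g -> equivariant a (Z.of_nat m) f -> equivariant a (Z.of_nat m) g ->
  f 0 = 0 -> g 0 = 0 -> residue_marks m f = residue_marks m g -> f = g.
Proof.
move=> m0 fI gI fE gE f0 g0 E.
have sub f' g' : equivariant a (Z.of_nat m) f' -> equivariant a (Z.of_nat m) g' ->
    residue_marks m f' = residue_marks m g' -> forall x, exists y, f' x = g' y.
  move=> fE' gE' E' x.
  have := Z.mod_pos_bound (f' x) (Z.of_nat m) m0.
  have := Z.div_mod (f' x) (Z.of_nat m).
  set q := f' x / _; set t := f' x mod _ => Et Ht.
  have tm : (Z.to_nat t < m)%N by lia.
  have : Ordinal tm \in residue_marks m f'.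
    rewrite inE; apply/asboolP; exists (x + a * - q).
    by rewrite (equivariant_mul fE') /= Z2Nat.id; lia.
  rewrite E' inE => /asboolP [y /=]; rewrite Z2Nat.id; last lia.
  move=> Hy; exists (y + a * q); rewrite (equivariant_mul gE'); lia.
have [c Hc] := incr_same_image fI gI (sub _ _ fE gE E) (sub _ _ gE fE (esym E)).
have c0 : c = 0.
  by apply: (incr_inj gI); rewrite g0 -f0 Hc.
by apply/funext => x; rewrite Hc c0 Z.add_0_r.
Qed.

(** A weakly increasing map becomes strictly increasing when the identity is added;
    its image is then recorded modulo one period. *)
Definition period_code (b m : nat) S : 'I_b.+1 * {set 'I_m} * {set 'I_m} :=
  (inord (Z.to_nat (S.2 0)), residue_marks m (fun x => x + S.1 x),
   residue_marks m (fun y => y + (S.2 y - S.2 0))).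

(** The period [(a, b)] need not be [(w, h)]: for a pair with a symmetry a shorter
    one gives a shorter code. *)
Lemma period_code_inj w h w' h' (B m : nat) a b S S' : Z.of_nat m = a + b -> 0 < a + b ->
  k * w <= Z.of_nat B -> k * w' <= Z.of_nat B ->
  rooted w h S -> rooted w' h' S' ->
  equivariant a b S.1 -> equivariant b a S.2 ->
  equivariant a b S'.1 -> equivariant b a S'.2 ->
  period_code B m S = period_code B m S' -> S = S'.
Proof.
move=> mab ab0 wB wB' R R' e1 e2 e1' e2' [E0 E1 E2].
have {}E0 : S.2 0 = S'.2 0.
  have := root_value_bound R; have := root_value_bound R' => b1 b2.
  by have := congr1 (@nat_of_ord _) E0; rewrite !inordK; lia.
have := residue_marks_inj _ _ _ _ _ _ _ E1 => /(_ a) {}E1.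
have := residue_marks_inj _ _ _ _ _ _ _ E2 => /(_ b) {}E2.
rewrite [LHS]surjective_pairing [RHS]surjective_pairing; congr pair; apply/funext => z.
  suff /(congr1 (fun f => f z)) : (fun x => x + S.1 x) = (fun x => x + S'.1 x) by lia.
  apply: E1; rewrite ?(rooted_0 R) ?(rooted_0 R') //; first lia.
  - by move=> x y xy; have := rooted_ndC R (Z.lt_le_incl _ _ xy); lia.
  - by move=> x y xy; have := rooted_ndC R' (Z.lt_le_incl _ _ xy); lia.
  - by move=> x; rewrite e1; lia.
  - by move=> x; rewrite e1'; lia.
suff /(congr1 (fun f => f z)) :
  (fun y => y + (S.2 y - S.2 0)) = (fun y => y + (S'.2 y - S'.2 0)) by lia.
apply: E2; rewrite ?Z.sub_diag //; first lia.
- by move=> x y xy; have := rooted_ndR R (Z.lt_le_incl _ _ xy); lia.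
- by move=> x y xy; have := rooted_ndR R' (Z.lt_le_incl _ _ xy); lia.
- by move=> x; rewrite e2; lia.
- by move=> x; rewrite e2'; lia.
Qed.

Definition rooted_set (w h : nat) : set parent_maps :=
  [set S | rooted (Z.of_nat w) (Z.of_nat h) S]%classic.

Lemma finite_by_code (T : choiceType) (C : finType) (A : set T) (c : T -> C) :
  (forall x y, A x -> A y -> c x = c y -> x = y) -> finite_set A.
Proof.
move=> inj.
case: (pselect (exists x, A x)) => [[x0 Ax0]|nA]; last first.
  rewrite (_ : A = set0)%classic //; apply/seteqP; split=> // x Ax.
  by case: nA; exists x.
have /choice [g Hg] : forall y, exists x, A x /\ forall z, A z -> c z = y -> z = x.
  move=> y; case: (pselect (exists z, A z /\ c z = y)) => [[z [Az cz]]|nz].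
    by exists z; split=> // z' Az' cz'; apply: inj; rewrite ?cz.
  by exists x0; split=> // z Az cz; case: nz; exists z.
apply: (@sub_finite_set _ _ (g @` setT)%classic).
  by move=> x Ax; exists (c x) => //; have [_ /(_ x Ax erefl)] := Hg (c x).
apply: finite_image; exact: finite_finset.
Qed.

Lemma finite_rooted_set w h : finite_set (rooted_set w h).
Proof.
apply: (@finite_by_code _ _ _ (period_code (Z.to_nat (k * Z.of_nat w)) (w + h))).
move=> S S' R R'; apply: (@period_code_inj (Z.of_nat w) (Z.of_nat h) (Z.of_nat w) (Z.of_nat h)
    _ _ (Z.of_nat w) (Z.of_nat h)) => //; try lia.
- have := rooted_w R; have := rooted_h R; lia.
- exact: rooted_eqC R.
- exact: rooted_eqR R.
- exact: rooted_eqC R'.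
- exact: rooted_eqR R'.
Qed.

Definition rooted_list (w h : nat) : seq parent_maps := enum_fset (fset_set (rooted_set w h)).

Lemma rooted_list_uniq w h : uniq (rooted_list w h).
Proof. exact: fset_uniq. Qed.

Lemma mem_rooted_list w h S : S \in rooted_list w h <-> rooted (Z.of_nat w) (Z.of_nat h) S.
Proof.
have := in_fset_set (finite_rooted_set w h) S.
rewrite /rooted_list => E; have -> : S \in enum_fset (fset_set (rooted_set w h)) =
  (S \in rooted_set w h) by [].
by split=> [/set_mem|/mem_set].
Qed.

(** Transposition maps each of two finite sets injectively into the other one. *)
Lemma transpose_perm w h : perm_eq (map transpose (rooted_list w h)) (rooted_list h w).
Proof.
have inj a b : uniq (map transpose (rooted_list a b)).
  rewrite map_inj_in_uniq ?rooted_list_uniq // => S S' /mem_rooted_list R /mem_rooted_list R'.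
  exact: transpose_inj R R'.
have sub a b : {subset map transpose (rooted_list a b) <= rooted_list b a}.
  by move=> S /mapP [S' /mem_rooted_list R ->]; apply/mem_rooted_list/rooted_transpose.
have [|||? E] := @uniq_min_size _ (map transpose (rooted_list w h)) (rooted_list h w);
  rewrite ?inj ?sub //.
  rewrite size_map -(size_map transpose (rooted_list h w)).
  by apply: uniq_leq_size => //; apply: sub.
by apply: uniq_perm => //; apply: rooted_list_uniq.
Qed.

End Reroot.

(** * The number of rooted pairs of parent maps *)

Section LeafSums.
Variables l k : Z.
Hypothesis l0 : Z.lt 0 l.
Hypothesis k0 : Z.le 0 k.
Local Notation rooted := (rooted l k).
Local Notation rooted_list := (rooted_list l k).
Implicit Types S : parent_maps.

Local Notation zn := Z.of_nat.

Definition run S (i : nat) : nat := Z.to_nat (Z.sub (S.1 (zn i)) (S.1 (Z.sub (zn i) 1))).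

(** A slot is a position [i] for a new column and an offset [j] for its parent row
    above that of the preceding column. *)
Definition slots (w : nat) S : seq (nat * nat) :=
  [seq (i, j) | i <- iota 1 w, j <- iota 0 (run S i).+1].

Definition graft (w h : nat) S (p : nat * nat) : parent_maps * nat :=
  (insert_column (zn w) (zn h) (zn p.1) (Z.add (S.1 (Z.sub (zn p.1) 1)) (zn p.2)) S, p.1).

Definition leaf_columns (w : nat) S : seq nat :=
  [seq x <- iota 0 w | `[< childless_column S (zn x) >]].

Lemma slotsP w h S p : rooted (zn w) (zn h) S -> p \in slots w S ->
  Z.le 1 (zn p.1) /\ Z.le (zn p.1) (zn w) /\
  Z.le (S.1 (Z.sub (zn p.1) 1)) (Z.add (S.1 (Z.sub (zn p.1) 1)) (zn p.2)) /\
  Z.le (Z.add (S.1 (Z.sub (zn p.1) 1)) (zn p.2)) (S.1 (zn p.1)).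
Proof.
move=> R /allpairsPdep [i [j [Hi Hj ->]]] /=.
move: Hi Hj; rewrite !mem_iota /run => Hi Hj.
have := rooted_ndC R (x := Z.sub (zn i) 1) (y := zn i); lia.
Qed.

(** Deleting a leaf column while recording its place and its parent row inverts the
    insertion. *)
Lemma graft_perm w h :
  perm_eq [seq graft w h T p | T <- rooted_list w h, p <- slots w T]
          [seq (T, x) | T <- rooted_list w.+1 h, x <- leaf_columns w.+1 T].
Proof.
have Zw : zn w.+1 = Z.add (zn w) 1 by lia.
apply: uniq_perm.
- apply: allpairs_uniq_dep; first exact: rooted_list_uniq.
    move=> S _; apply: allpairs_uniq_dep; rewrite ?iota_uniq //.
      by move=> *; apply: iota_uniq.
    by move=> [i j] [i' j'] _ _ /= [-> ->].
  move=> _ _ /allpairsPdep [S [p [HS Hp ->]]] /allpairsPdep [S' [p' [HS' Hp' ->]]] /=.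
  move/(mem_rooted_list l0 k0): HS => R; move/(mem_rooted_list l0 k0): HS' => R'.
  move: p p' Hp Hp' => [i j] [i' j'] Hp Hp' E.
  have Ei : i = i' by case: E.
  have [i1 [iw [b1 b2]]] := slotsP R Hp.
  have := congr1 fst E; rewrite /graft /= -Ei => {}E.
  have ES : S = S'.
    by have := congr1 (delete_column (zn w) (zn i)) E; rewrite !insert_columnK.
  suff -> : j = j' by rewrite Ei ES.
  subst S' i'.
  have := congr1 (fun T => T.1 (zn i)) E.
  have N y := @insert_column_new (zn w) (zn h) (zn i) (conj i1 iw) y S 0.
  by rewrite Z.mul_0_r Z.add_0_r in N; rewrite !N; lia.
- apply: allpairs_uniq_dep; first exact: rooted_list_uniq.
    by move=> S _; rewrite filter_uniq ?iota_uniq.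
  by move=> [S x] [S' x'] _ _ /= [-> ->].
- move=> T; apply/allpairsPdep/allpairsPdep.
    move=> [S [p [/(mem_rooted_list l0 k0) R Hp ->]]].
    have [i1 [iw b]] := slotsP R Hp.
    exists (graft w h S p).1, p.1; split=> //.
      apply/(mem_rooted_list l0 k0); rewrite Zw; apply: rooted_insert => //; lia.
    rewrite mem_filter mem_iota; apply/andP; split; last lia.
    by apply/asboolP; apply: childless_column_new.
  move=> [S [x [/(mem_rooted_list l0 k0) R]]].
  rewrite mem_filter mem_iota => /andP [/asboolP L Hx] ->.
  have x0 : x <> 0 by move=> Ex; apply: (root_not_childless R); rewrite Ex in L.
  have xw : Z.le 1 (zn x) /\ Z.le (zn x) (zn w) by lia.
  rewrite Zw in R.
  have b := delete_column_bounds xw R.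
  set S0 := delete_column (zn w) (zn x) S.
  exists S0, (x, Z.to_nat (Z.sub (S.1 (zn x)) (S0.1 (Z.sub (zn x) 1)))); split.
  + by apply/(mem_rooted_list l0 k0)/(rooted_delete xw R L).
  + apply/allpairsPdep; exists x, (Z.to_nat (Z.sub (S.1 (zn x)) (S0.1 (Z.sub (zn x) 1)))).
    have {}b : Z.le (S0.1 (Z.sub (zn x) 1)) (S.1 (zn x)) /\ Z.le (S.1 (zn x)) (S0.1 (zn x)) by [].
    split=> //; rewrite mem_iota; first lia.
    rewrite /run; move: b; move: (S0.1 _) (S.1 _) (S0.1 _) => A B C b; lia.
  + rewrite /graft; congr pair => /=.
    rewrite Z2Nat.id; last by apply: Zle_minus_le_0; case: b.
    by rewrite Zplus_minus (delete_columnK xw R L).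
Qed.

(** The slots of position [i] have their rows in the closed interval between two
    consecutive values of the first map.  Leaving out the upper ends, which are not
    childless and account for [w] slots, the intervals tile a period of [h] rows. *)
Lemma sum_slots (phi : bool -> nat) (w h : nat) S : rooted (zn w) (zn h) S ->
  \sum_(p <- slots w S) phi `[< childless_row S (Z.add (S.1 (Z.sub (zn p.1) 1)) (zn p.2)) >] =
  (w + h - zcount (childless_row S) 0 h) * phi false + zcount (childless_row S) 0 h * phi true.
Proof.
move=> R; rewrite /slots big_allpairs_dep.
have HB (P : Z -> Prop) a n :
    \sum_(0 <= i < n) phi `[< P (Z.add a (zn i)) >] =
    (n - zcount P a n) * phi false + zcount P a n * phi true.
  elim: n => [|n IH]; first by rewrite big_nil /zcount big_ord0.
  rewrite big_nat_recr //= IH -addn1 zcount_cat zcount1 addn1.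
  have := zcount_le P a n; case: asbool => /= ?; nia.
pose Si i := S.1 (zn i).
have Sm i j : i <= j -> Z.le (Si i) (Si j) by move=> ij; apply: (rooted_ndC R); lia.
have tel n : \sum_(i <- iota 1 n) \sum_(j <- iota 0 (run S i).+1)
     phi `[< childless_row S (Z.add (S.1 (Z.sub (zn i) 1)) (zn j)) >] =
   n * phi false + \sum_(0 <= j < Z.to_nat (Z.sub (Si n) (Si 0)))
      phi `[< childless_row S (Z.add (Si 0) (zn j)) >].
  elim: n => [|n IH].
    by rewrite big_nil Z.sub_diag big_geq.
  rewrite -[in iota 1 n.+1](addn1 n) iotaD big_cat big_seq1 {}IH addnC.
  have -> : iota 0 (run S (1 + n)).+1 = index_iota 0 (run S n.+1).+1.
    by rewrite /index_iota subn0.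
  rewrite big_nat_recr //.
  have E1 : Z.sub (zn (1 + n)) 1 = zn n by lia.
  have E2 : Z.sub (zn n.+1) 1 = zn n by lia.
  rewrite /run ?E1 ?E2 -/(Si n) -/(Si n.+1) [LHS]/=.
  have S01 := Sm 0 n (leq0n _); have Snn := Sm n n.+1 (leqnSn _).
  have -> : `[< childless_row S (Z.add (Si n) (zn (Z.to_nat (Z.sub (Si n.+1) (Si n))))) >] = false.
    by apply/asboolP; apply; exists (zn n.+1); rewrite -/(Si n.+1); lia.
  have -> : Z.to_nat (Z.sub (Si n.+1) (Si 0)) =
     Z.to_nat (Z.sub (Si n) (Si 0)) + Z.to_nat (Z.sub (Si n.+1) (Si n)).
    by lia.
  rewrite [in RHS](big_cat_nat (n := Z.to_nat (Z.sub (Si n) (Si 0)))) //; last lia.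
  rewrite [RHS]/=.
  have -> : \sum_(Z.to_nat (Z.sub (Si n) (Si 0)) <= i <
       Z.to_nat (Z.sub (Si n) (Si 0)) + Z.to_nat (Z.sub (Si n.+1) (Si n)))
       phi `[< childless_row S (Z.add (Si 0) (zn i)) >] =
    \sum_(0 <= i < Z.to_nat (Z.sub (Si n.+1) (Si n))) phi `[< childless_row S (Z.add (Si n) (zn
      i)) >].
    rewrite -{1}[Z.to_nat (Z.sub (Si n) (Si 0))]add0n big_addn addKn.
    apply: eq_bigr => i _; congr (phi `[< childless_row S _ >]); lia.
  nia.
etransitivity; first exact: (tel w).
rewrite /Si; have -> : Z.to_nat (Z.sub (S.1 (zn w)) (S.1 (zn 0))) = h.
  have := rooted_eqC R Z0; rewrite Z.add_0_l => ->; rewrite (_ : zn 0 = Z0) //; lia.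
rewrite HB (_ : S.1 (zn 0) = Z0) ?(rooted_0 R) //.
have := zcount_le (childless_row S) Z0 h; nia.
Qed.

End LeafSums.

Section RootedCount.
Variables l k : nat.
Hypothesis l0 : 0 < l.
Local Notation zn := Z.of_nat.
Local Notation rooted := (rooted (zn l) (zn k)).
Local Notation rooted_list := (rooted_list (zn l) (zn k)).
Implicit Types S : parent_maps.

Let lZ : Z.lt 0 (zn l). Proof. lia. Qed.
Let kZ : Z.le 0 (zn k). Proof. lia. Qed.
Let rooted_listP w h S : S \in rooted_list w h <-> rooted (zn w) (zn h) S.
Proof. exact: mem_rooted_list. Qed.

Lemma rooted_list0l h : rooted_list 0 h = [::].
Proof.
case E : (rooted_list 0 h) => [|T s] //.
have /rooted_listP R : T \in rooted_list 0 h by rewrite E mem_head.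
by have := rooted_w R.
Qed.

Lemma rooted_list0r w : rooted_list w 0 = [::].
Proof.
case E : (rooted_list w 0) => [|T s] //.
have /rooted_listP R : T \in rooted_list w 0 by rewrite E mem_head.
by have := rooted_h R.
Qed.

Lemma leaf_columns_size w S : size (leaf_columns w S) = zcount (childless_column S) 0 w.
Proof.
rewrite /leaf_columns size_filter /zcount -sum1_count big_mkcond /=.
have -> : iota 0 w = index_iota 0 w by rewrite /index_iota subn0.
rewrite big_mkord.
by apply: eq_bigr => i _; case: asbool.
Qed.

Lemma column_sum (f : nat -> nat) w h :
  \sum_(T <- rooted_list w.+1 h) zcount (childless_column T) 0 w.+1 * f (leaf_number w.+1 h T) =
  \sum_(T <- rooted_list w h) ((w + h - zcount (childless_row T) 0 h) * f (leaf_number w h T).+1 +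
                      zcount (childless_row T) 0 h * f (leaf_number w h T)).
Proof.
transitivity (\sum_(p <- [seq (T, x) | T <- rooted_list w.+1 h, x <- leaf_columns w.+1 T])
   f (leaf_number w.+1 h p.1)).
  rewrite big_allpairs_dep; apply: eq_bigr => T _.
  by rewrite /= big_const_seq count_predT leaf_columns_size iter_addn_0 mulnC.
rewrite -(perm_big _ (graft_perm lZ kZ w h)) big_allpairs_dep.
apply: eq_big_seq => T /rooted_listP R.
have := sum_slots (fun b : bool => f ((leaf_number w h T).+1 - b)) R.
rewrite subn0 subn1 => <-.
apply: eq_big_seq => p Hp; congr f.
have [i1 [iw b]] := slotsP R Hp.
have := leaf_number_insert (conj i1 iw) R b; rewrite -/(graft w h T p).1 /=.
case: asbool; lia.
Qed.

(** This is [column_sum] for the transposed pairs. *)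
Lemma row_sum (f : nat -> nat) w h :
  \sum_(T <- rooted_list w h.+1) zcount (childless_row T) 0 h.+1 * f (leaf_number w h.+1 T) =
  \sum_(T <- rooted_list w h) ((w + h - zcount (childless_column T) 0 w) * f (leaf_number w h
    T).+1 +
                      zcount (childless_column T) 0 w * f (leaf_number w h T)).
Proof.
have L a b T : T \in rooted_list a b -> leaf_number b a (transpose T) = leaf_number a b T.
  by move=> /rooted_listP R; have [E1 E2] := leaf_number_transpose R;
    rewrite /leaf_number E1 E2 addnC.
transitivity (\sum_(T <- map transpose (rooted_list w h.+1))
   zcount (childless_column T) 0 h.+1 * f (leaf_number h.+1 w T)).
  rewrite big_map; apply: eq_big_seq => T HT; rewrite L //.
  by have /rooted_listP R := HT; have [-> _] := leaf_number_transpose R.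
rewrite (perm_big _ (transpose_perm lZ kZ w h.+1)) column_sum.
rewrite -(perm_big _ (transpose_perm lZ kZ w h)) big_map.
apply: eq_big_seq => T HT; rewrite L // addnC (addnC h).
by have /rooted_listP R := HT; have [_ ->] := leaf_number_transpose R; rewrite addnC.
Qed.

Definition leaf_sum (n : nat) (g : nat -> nat) :=
  \sum_(w < n.+1) \sum_(T <- rooted_list w (n - w)) g (leaf_number w (n - w) T).

Lemma leaf_number_le w h S : leaf_number w h S <= w + h.
Proof. by apply: leq_add; apply: zcount_le. Qed.

(** Count each pair with its leaves: removing a leaf leaves a pair of size [n] with
    one of [2n] slots, and [r] of the slots hang below a leaf. *)
Lemma leaf_sum_step (f : nat -> nat) n :
  leaf_sum n.+1 (fun r => r * f r) =
  leaf_sum n (fun r => (2 * n - r) * f r.+1 + r * f r).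
Proof.
rewrite /leaf_sum.
under eq_bigr => w _ do under eq_bigr => T _ do rewrite {1}/leaf_number mulnDl.
under eq_bigr => w _ do rewrite big_split /=.
rewrite big_split /=.
rewrite [X in X + _]big_ord_recl rooted_list0l big_nil add0n.
rewrite [X in _ + X]big_ord_recr /= subnn rooted_list0r big_nil addn0.
under eq_bigr => w _ do rewrite /bump /= add1n subSS column_sum.
under [X in _ + X]eq_bigr => w _ do rewrite (subSn (leq_ord w)) row_sum.
rewrite -big_split /=; apply: eq_bigr => w _.
rewrite -big_split /=; apply: eq_bigr => T _.
have := zcount_le (childless_column T) Z0 w; have := zcount_le (childless_row T) Z0 (n - w).
have := ltn_ord w; rewrite /leaf_number; nia.
Qed.

Lemma leaf_sum_ext n g g' : (forall r, r <= n -> g r = g' r) -> leaf_sum n g = leaf_sum n g'.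
Proof.
move=> H; apply: eq_bigr => w _; apply: eq_bigr => T _; apply: H.
have := leaf_number_le w (n - w) T; have := ltn_ord w; lia.
Qed.

Lemma leaf_sum_mull n c g : leaf_sum n (fun r => c * g r) = c * leaf_sum n g.
Proof.
by rewrite /leaf_sum big_distrr /=; apply: eq_bigr => w _; rewrite big_distrr.
Qed.

Definition rooted_number n := leaf_sum n (fun=> 1).

(** The test function [C(r - 1, j)] turns the recursion for leaves into one between
    consecutive binomial moments. *)
Lemma binomial_moment_step j n :
  j.+1 * leaf_sum n.+1 (fun r => 'C(r, j.+1)) = (2 * n - j) * leaf_sum n (fun r => 'C(r, j)).
Proof.
rewrite -!leaf_sum_mull.
transitivity (leaf_sum n.+1 (fun r => r * 'C(r.-1, j))).
  by apply: leaf_sum_ext => -[|r] _ /=; rewrite ?bin0n ?muln0 // mul_bin_diag.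
rewrite (leaf_sum_step (fun r => 'C(r.-1, j))); apply: leaf_sum_ext => r rn /=.
case: (leqP j r) => jr; last first.
  by rewrite (bin_small jr) (@bin_small r.-1 j) ?muln0 //; lia.
case: r rn jr => [|r] rn jr; first by move: jr; rewrite leqn0 => /eqP ->;
  rewrite !subn0 mul0n addn0.
rewrite /=; case: j jr => [|j] jr; first by rewrite !bin0; lia.
have := mul_bin_diag r.+1 j; rewrite binS /=; nia.
Qed.

(** Equivalently: a pair with [j] distinguished leaves is a pair of size [m] with a
    multiset of [j] among its [2 m] slots. *)
Lemma binomial_moment j m :
  leaf_sum (m + j) (fun r => 'C(r, j)) = 'C((2 * m + j).-1, j) * rooted_number m.
Proof.
elim: j => [|j IH].
  by rewrite addn0 bin0 mul1n; apply: leaf_sum_ext => r _; rewrite bin0.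
apply/eqP; rewrite -(eqn_pmul2l (ltn0Sn j)) addnS binomial_moment_step IH.
rewrite !mulnA addnS /= -mul_bin_diag; apply/eqP; congr (_ * _ * _); lia.
Qed.

(** Without leaves both maps are onto, so every column is in the trunk and [F] is
    the translation by [k]; the first map is then injective as well, and the choice
    of the root makes it the identity. *)
Lemma leafless w h S : rooted (zn w) (zn h) S -> leaf_number w h S = 0 ->
  [/\ S = (id, fun y => Z.add y (zn k)), w = l & h = l].
Proof.
move=> R /eqP; rewrite /leaf_number addn_eq0 => /andP [/eqP /zcount_eq0 HC /eqP /zcount_eq0 HR].
have [w0 h0 ndC _ eqC _ r0 [g [gI gE gF [N HN]] g0]] := R.
have sR x : exists y, S.2 y = x.
  have := HC (Z.modulo x (zn w)) (Z.mod_pos_bound _ _ w0).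
  rewrite Z.add_0_l => H; apply: contrapT => L; apply: H.
  apply/(childless_column_mul R (Z.div x (zn w))).
  by rewrite Z.add_comm -Z.div_mod //; lia.
have sC x : exists y, S.1 y = x.
  have := HR (Z.modulo x (zn h)) (Z.mod_pos_bound _ _ h0).
  rewrite Z.add_0_l => H; apply: contrapT => L; apply: H.
  apply/(childless_row_mul R (Z.div x (zn h))).
  by rewrite Z.add_comm -Z.div_mod //; lia.
have sF m x : exists y, iter m (fun x => S.2 (S.1 x)) y = x.
  elim: m x => [|m IH] x; first by exists x.
  have [y1 E1] := sR x; have [y2 E2] := sC y1; have [y3 E3] := IH y2.
  by exists y3; rewrite /= E3 E2.
have idI : incr (fun x => x) by [].
have gid x : g x = x.
  have [c Hc] : exists c, forall x, g x = Z.add x c.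
    apply: (incr_same_image gI idI) => [y|y]; first by exists (g y).
    by have [y' <-] := sF N y; have [j ->] := HN y'; exists j.
  by have := Hc Z0; rewrite g0 Hc; lia.
have wl : w = l by have := gE Z0; rewrite !gid; lia.
have F x : S.2 (S.1 x) = Z.add x (zn k) by have := gF x; rewrite !gid.
have cI : incr S.1.
  move=> x y xy; have := ndC x y; have : S.1 x <> S.1 y; last lia.
  by move=> E; have := F x; rewrite E F; lia.
have cid x : S.1 x = x.
  have [c Hc] : exists c, forall x, S.1 x = Z.add x c.
    by apply: (incr_same_image cI idI) => [y|y]; [exists (S.1 y) | have [x' <-] := sC y; exists x'].
  by have := Hc Z0; rewrite r0 Hc; lia.
have hw : h = w by have := eqC Z0; rewrite !cid; lia.
split; [|exact: wl|by rewrite hw].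
rewrite [LHS]surjective_pairing; congr pair; apply/funext => x; first exact: cid.
by rewrite -F cid.
Qed.

Lemma rooted_cycles : rooted (zn l) (zn l) (id, fun y => Z.add y (zn k)).
Proof.
split=> //=; rewrite ?/nondec ?/equivariant; try lia.
by exists id => //; split=> //; exists 0%N => x; exists x.
Qed.

Lemma leaf_number_cycles : leaf_number l l (id, fun y => Z.add y (zn k)) = 0.
Proof.
rewrite /leaf_number /zcount !big1 // => i _.
  suff -> : `[< childless_row (id, fun y => Z.add y (zn k)) (Z.add Z0 (zn i)) >] = false by [].
  by apply/asboolP; apply; eexists; reflexivity.
suff -> : `[< childless_column (id, fun y => Z.add y (zn k)) (Z.add Z0 (zn i)) >] = false by [].
by apply/asboolP; apply; exists (Z.sub (zn i) (zn k)) => /=; lia.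
Qed.

Lemma leaf_sum_leafless n : leaf_sum n (fun r => r == 0) = (n == l + l).
Proof.
rewrite /leaf_sum; set T0 : parent_maps := (id, fun y => Z.add y (zn k)).
have inner w h : \sum_(T <- rooted_list w h) (leaf_number w h T == 0 : nat) =
  ((w == l) && (h == l)).
  rewrite (_ : \sum_(T <- _) _ = count (fun T => leaf_number w h T == 0) (rooted_list w h));
    last first.
    by rewrite -sum1_count [in RHS]big_mkcond /=; apply: eq_bigr => T _; case: eqP.
  case: (boolP ((w == l) && (h == l))) => [/andP [/eqP -> /eqP ->]|nwl].
    rewrite (@eq_in_count _ _ (pred1 T0)).
      rewrite count_uniq_mem ?(rooted_list_uniq (zn l) (zn k)) //.
      by rewrite (_ : T0 \in _) //; apply/rooted_listP/rooted_cycles.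
    move=> T /rooted_listP R /=; apply/eqP/eqP => [E|->]; last exact: leaf_number_cycles.
    by have [] := leafless R E.
  rewrite (@eq_in_count _ _ pred0) ?count_pred0 // => T /rooted_listP R /=.
  apply/negP => /eqP E; have [_ wl hl] := leafless R E.
  by move: nwl; rewrite wl hl !eqxx.
under eq_bigr => w _ do rewrite inner.
case: eqP => [->|nl]; last first.
  rewrite big1 // => w _; case: eqP => //= wl; case: eqP => // hl.
  by case: nl; have := ltn_ord w; lia.
have ll : l < (l + l).+1 by lia.
rewrite (bigD1 (Ordinal ll)) //= addnK !eqxx /= big1 // => w.
by rewrite -val_eqE /= => /negbTE ->.
Qed.

Local Open Scope ring_scope.

Lemma alternating_binomials (r n : nat) : (r <= n)%N ->
  \sum_(j < n.+1) (-1) ^+ j * ('C(r, j))%:R = (r == 0%N)%:R :> rat.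
Proof.
move=> rn; rewrite -[RHS](_ : (1 - 1) ^+ r = _); last by rewrite subrr expr0n.
rewrite exprBn (big_ord_widen n.+1 (fun j => (-1) ^+ j * 1 ^+ (r - j) * 1 ^+ j *+ 'C(r, j))) //.
rewrite [RHS]big_mkcond /=; apply: eq_bigr => j _.
rewrite !expr1n !mulr1 mulr_natr; case: ltnP => // jr.
by rewrite bin_small // mulr0n.
Qed.

(** Inclusion-exclusion over the sets of leaves retains the pairs without leaves. *)
Lemma alternating_moments n :
  \sum_(j < n.+1) (-1) ^+ j * (leaf_sum n (fun r => 'C(r, j)))%:R =
  (n == l + l)%N%:R :> rat.
Proof.
rewrite -leaf_sum_leafless /leaf_sum.
under eq_bigr => j _ do rewrite natr_sum mulr_sumr.
rewrite exchange_big /= natr_sum; apply: eq_bigr => w _.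
under eq_bigr => j _ do rewrite natr_sum mulr_sumr.
rewrite exchange_big /= natr_sum; apply: eq_bigr => T _.
by rewrite alternating_binomials //; have := leaf_number_le w (n - w) T; have := ltn_ord w; lia.
Qed.

(** The [N]-th difference of the polynomial [C(x, r)], of degree [r], vanishes. *)
Lemma finite_difference (N M r : nat) : (r < N)%N -> (N <= M)%N ->
  \sum_(j < N.+1) (-1) ^+ j * ('C(N, j) * 'C(M - j, r))%:R = 0 :> rat.
Proof.
have main : forall N M r, (N <= M)%N ->
    \sum_(j < N.+1) (-1) ^+ j * ('C(N, j) * 'C(M - j, r))%:R =
    (if (r < N)%N then 0 else 'C(M - N, r - N)%:R) :> rat.
  elim=> [|n IH] m s nm.
    by rewrite big_ord1 expr0 mul1r bin0 mul1n !subn0.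
  have {}IH' q s' : (n <= q)%N -> \sum_(j < n.+2) (-1) ^+ j * ('C(n, j) * 'C(q - j, s'))%:R =
    (if (s' < n)%N then 0 else 'C(q - n, s' - n)%:R) :> rat.
    by move=> nq; rewrite big_ord_recr /= IH // (bin_small (ltnSn n)) mul0n mulr0 addr0.
  have E : \sum_(j < n.+2) (-1) ^+ j * ('C(n.+1, j) * 'C(m - j, s))%:R =
     \sum_(j < n.+2) (-1) ^+ j * ('C(n, j) * 'C(m - j, s))%:R -
     \sum_(j < n.+1) (-1) ^+ j * ('C(n, j) * 'C(m.-1 - j, s))%:R :> rat.
    rewrite big_ord_recl [in RHS]big_ord_recl !bin0 -addrA; congr (_ + _).
    rewrite -sumrB; apply: eq_bigr => j _.
    rewrite /bump /= ?add1n exprS binS mulnDl natrD.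
    rewrite (_ : (m.-1 - j = m - j.+1)%N); last by lia.
    by rewrite mulrDr !mulN1r !mulNr.
  rewrite E IH' ?IH; try lia.
  rewrite ltnS; case: (ltngtP s n) => sn; first by rewrite subrr.
    have -> : (m - n = (m.-1 - n).+1)%N by lia.
    have -> : (s - n = (s - n.+1).+1)%N by lia.
    rewrite binS natrD addrC addKr; congr (_%:R); congr ('C(_, _)); lia.
  by rewrite sn subnn !bin0 subrr.
by move=> rN NM; rewrite main // rN.
Qed.

(** With [n = m + j] and [N = n - 2l], this puts the terms of the alternating sum,
    at the claimed values, into the form of [finite_difference] for [r = N - 1]. *)
Lemma removal_ratio m j : (l + l <= m)%N -> (l + l < m + j)%N ->
  ((m + j - (l + l)) * 'C((2 * m + j).-1, j) * 'C(2 * m, m - (l + l)) =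
   2 * m * 'C(m + j - (l + l), j) * 'C((2 * (m + j)).-1 - j, (m + j - (l + l)).-1))%N.
Proof.
move=> lm lmj; have m0 : (0 < m)%N by lia.
set q := (m - (l + l))%N; set p := (m + (l + l))%N.
have EN : (m + j - (l + l) = (q + j).-1.+1)%N by rewrite /q; lia.
have Ea : ((2 * m + j).-1 = (2 * m).-1 + j)%N by lia.
have Eb : (2 * m = q + p)%N by rewrite /q /p; lia.
have Ec : ((2 * (m + j)).-1 - j = (q + j).-1 + p)%N by rewrite /q /p; lia.
have Ed : (m + j - (l + l) = q + j)%N by rewrite /q; lia.
have F1 := bin_fact (leq_addl (2 * m).-1 j); rewrite addnK in F1.
have F2 := bin_fact (leq_addr p q); rewrite addKn in F2.
have F3 := bin_fact (leq_addl q j); rewrite addnK in F3.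
have F4 := bin_fact (leq_addr p (q + j).-1); rewrite addKn in F4.
have G1 : (q + p)`! = (2 * m * (2 * m).-1`!)%N.
  by rewrite -Eb -{1}(prednK (n := 2 * m)) ?factS; [rewrite prednK|]; lia.
have G2 : ((q + j)`! = (q + j) * (q + j).-1`!)%N.
  by rewrite -{1}(prednK (n := q + j)) ?factS; [rewrite prednK|]; lia.
have G3 : ((2 * m).-1 + j = (q + j).-1 + p)%N by lia.
rewrite Ea Ec Ed {2}Eb.
have P1 := fact_gt0 j; have P2 := fact_gt0 (2 * m).-1; have P3 := fact_gt0 q.
have P4 := fact_gt0 p; have P5 := fact_gt0 (q + j).-1.
rewrite G1 in F2; rewrite G2 in F3; rewrite -G3 in F4.
rewrite -G3.
set A := 'C(_, j) in F1 *; set B := 'C(_, q) in F2 *; set C := 'C(_, j) in F3 *.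
set D := 'C(_, _.-1) in F4 *.
have K : (0 < j`! * (2 * m).-1`! * (q`! * p`! * (q + j).-1`!))%N by rewrite !muln_gt0 P1 P2 P3 P4
  P5.
apply/eqP; rewrite -(eqn_pmul2r K); apply/eqP.
transitivity ((q + j) * (A * (j`! * (2 * m).-1`!)) * (B * (q`! * p`!)) * (q + j).-1`!)%N; first lia.
transitivity (2 * m * (C * (j`! * q`!)) * (D * ((q + j).-1`! * p`!)) * (2 * m).-1`!)%N; last lia.
by rewrite F1 F2 F3 F4; lia.
Qed.

Lemma rooted_number_small n : (n < l + l)%N -> rooted_number n = 0%N.
Proof.
elim/ltn_ind: n => n IH nl.
have := alternating_moments n; rewrite big_ord_recl expr0 mul1r.
rewrite big1 ?addr0; last first.
  move=> j _; rewrite -[in X in leaf_sum X _](subnK (ltn_ord j)) /= binomial_moment.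
  by rewrite IH ?muln0 ?mulr0 //; have := ltn_ord j; lia.
rewrite (_ : n == l + l = false)%N; last by apply/eqP; lia.
move/eqP; rewrite pnatr_eq0 => /eqP <-.
by apply: leaf_sum_ext => r _; rewrite bin0.
Qed.

(** For [n > 2l] the alternating sum of the moments and a finite difference both
    vanish.  By induction their terms agree, up to the factor [n - 2l], except for
    the first ones; hence these agree too. *)
Theorem rooted_number_closed n : (l + l <= n)%N ->
  (n * rooted_number n = (l + l) * 'C(2 * n, n - (l + l)))%N.
Proof.
elim/ltn_ind: n => n IH ln.
have n0 : leaf_sum n (fun r => 'C(r, 0)) = rooted_number n.
  by apply: leaf_sum_ext => r _; rewrite bin0.
have := alternating_moments n.
case: (ltngtP (l + l) n) ln => // [ln|En] _; last first.
  rewrite big_ord_recl expr0 mul1r big1 ?addr0; last first.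
    move=> j _; rewrite -[in X in leaf_sum X _](subnK (ltn_ord j)) /= binomial_moment.
    by rewrite rooted_number_small ?muln0 ?mulr0 //; have := ltn_ord j; lia.
  by move/eqP; rewrite /= n0 eqr_nat => /eqP ->; rewrite En subnn bin0.
set N := (n - (l + l))%N; set t := fun j => (4 * l * ('C(N, j) * 'C((2 * n).-1 - j, N.-1)))%N.
have term m j : (m + j = n)%N -> (0 < j)%N ->
    (N * ('C((2 * m + j).-1, j) * rooted_number m) = t j)%N.
  move=> mj j0; case: (leqP (l + l) m) => lm; last first.
    by rewrite rooted_number_small // !muln0 /t (@bin_small N j) ?mul0n ?muln0 // /N; lia.
  have m0 : (0 < m)%N by lia.
  have Hm := IH m ltac:(lia) lm.
  have := @removal_ratio m j lm; rewrite mj -/N => /(_ ln) E.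
  apply/eqP; rewrite -(eqn_pmul2l m0); apply/eqP; rewrite /t.
  transitivity (N * 'C((2 * m + j).-1, j) * (m * rooted_number m))%N; first lia.
  by rewrite Hm; move: E; rewrite -/N => E; nia.
rewrite big_ord_recl expr0 mul1r /= n0 => E.
have S0 : \sum_(j < n.+1) (-1) ^+ j * (t j)%:R = 0 :> rat.
  have := @finite_difference N (2 * n).-1 N.-1 ltac:(rewrite /N; lia) ltac:(rewrite /N; lia).
  rewrite (big_ord_widen n.+1 (fun j => (-1) ^+ j * ('C(N, j) * 'C((2 * n).-1 - j, N.-1))%:R));
    last by rewrite /N; lia.
  rewrite big_mkcond /= => D.
  transitivity ((4 * l)%:R * 0 : rat); last by rewrite mulr0.
  rewrite -[in RHS]D mulr_sumr; apply: eq_bigr => j _.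
  case: ltnP => jN; first by rewrite /t natrM mulrCA.
  by rewrite /t (bin_small jN) mul0n muln0 !mulr0.
have {}E : (N * rooted_number n)%:R = (t 0)%:R :> rat.
  move: S0; rewrite big_ord_recl expr0 mul1r => /eqP; rewrite addr_eq0 => /eqP ->.
  move/eqP: E; rewrite addr_eq0 natrM => /eqP ->.
  rewrite mulrN mulr_sumr; congr (- _); apply: eq_bigr => j _.
  rewrite -[in X in leaf_sum X _](subnK (ltn_ord j)) /= binomial_moment.
  by rewrite mulrCA -natrM term //; have := ltn_ord j; lia.
move/eqP: E; rewrite eqr_nat => /eqP E.
have N0 : (0 < N)%N by rewrite /N; lia.
apply/eqP; rewrite -(eqn_pmul2l N0) mulnCA E /t bin0 mul1n subn0.
have := mul_bin_diag (2 * n) N.-1; rewrite prednK // => D.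
by apply/eqP; nia.
Qed.

End RootedCount.

Arguments east_heights : simpl never.

(** * Parallelogram polyominoes as lists of columns *)

Section Paths.
Local Notation path_point := Defs.point.
Implicit Types p : lattice_path.

Lemma east_heightsN p : east_heights (true :: p) = map succn (east_heights p).
Proof.
rewrite /east_heights /= -{1}(addn0 1) iotaDl filter_map -!map_comp.
by apply: eq_map => k /=.
Qed.

Lemma east_heightsE p : east_heights (false :: p) = 0 :: east_heights p.
Proof.
rewrite /east_heights /= -{1}(addn0 1) iotaDl filter_map -!map_comp.
by congr (_ :: _); apply: eq_map => k /=.
Qed.

Lemma size_east_heights p : size (east_heights p) = count negb p.
Proof.
by elim: p => [|[] p IH] //; rewrite ?east_heightsN ?east_heightsE ?(size_map succn); rewrite /= IH.
Qed.

Lemma east_heights_sorted p : sorted leq (east_heights p).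
Proof.
elim: p => [|[] p IH] //; rewrite ?east_heightsN ?east_heightsE /=.
  by rewrite sorted_map; apply: sub_sorted IH => x y.
by case: (east_heights p) IH => //= a s ->.
Qed.

Lemma east_heights_mono p i j : i <= j -> j < size (east_heights p) ->
  nth 0 (east_heights p) i <= nth 0 (east_heights p) j.
Proof.
move=> ij jp; apply: (sorted_leq_nth leq_trans leqnn 0 (east_heights_sorted p)) => //.
by rewrite inE; apply: leq_ltn_trans jp.
Qed.

(** A path visits [(x, y)] when the first [x] East steps are at height at most [y]
    and the other ones at height at least [y]. *)
Definition passes p (x y : nat) :=
  [/\ forall i, i < x -> nth 0 (east_heights p) i <= y,
      forall i, x <= i -> i < size (east_heights p) -> y <= nth 0 (east_heights p) i,
      x <= count negb p & y <= count id p].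

Lemma point_passes p k : k <= size p -> passes p (path_point p k).1 (path_point p k).2.
Proof.
elim: p k => [|b p IH] [|k]; rewrite // ?take0.
rewrite ltnS => /IH; case: b => -[H1 H2 H3 H4];
  rewrite /passes ?east_heightsN ?east_heightsE ?(size_map succn).
- split=> /=; [| |by []|by []].
    move=> i Hi; rewrite (nth_map 0) ?ltnS ?H1 // size_east_heights.
    by apply: leq_trans Hi _.
  by move=> i Hi1 Hi2; rewrite (nth_map 0) // ltnS; apply: H2.
- split=> /=; [| |by []|by []].
    by case=> [|i] //= Hi; apply: H1.
  by case=> [|i] //= Hi1 Hi2; apply: H2.
Qed.

Lemma passes_point p x y : passes p x y -> path_point p (x + y) = (x, y).
Proof.
elim: p x y => [|b p IH] x y [].
  by move=> _ _ /= /[!leqn0] /eqP -> /eqP ->.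
case: b; rewrite ?east_heightsN ?east_heightsE ?(size_map succn) /=; move=> H1 H2 H3 H4.
  case: y H1 H2 H4 => [|y] H1 H2 H4.
    case: x H1 H2 H3 => [|x] // H1 _ H3.
    have := H1 0 (ltn0Sn x); rewrite (nth_map 0) // size_east_heights.
    by apply: leq_trans H3.
  rewrite addnS /Defs.point /=; have [] : path_point p (x + y) = (x, y).
    apply: IH; split => //.
      move=> i Hi; have := H1 i Hi; rewrite (nth_map 0) // size_east_heights.
      by apply: leq_trans Hi _; rewrite add0n in H3.
    by move=> i Hi1 Hi2; have := H2 i Hi1 Hi2; rewrite (nth_map 0).
  by rewrite /Defs.point => -> ->.
case: x H1 H2 H3 => [|x] H1 H2 H3.
  have := H2 0 (leqnn _) (ltn0Sn _) => /=.
  by rewrite leqn0 => /eqP ->.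
rewrite addSn /Defs.point /=; have [] : path_point p (x + y) = (x, y).
  apply: IH; split => //.
    by move=> i Hi; apply: (H1 i.+1).
  by move=> i Hi1 Hi2; apply: (H2 i.+1).
by rewrite /Defs.point => -> ->.
Qed.

Lemma size_counts p : size p = count negb p + count id p.
Proof. by elim: p => //= -[] p ->; lia. Qed.

(** The column lists of parallelogram polyominoes, by [parallelogram_staircase] and
    [staircase_parallelogram]. *)
Definition staircase_columns (cs : seq (nat * nat)) : Prop :=
  [/\ 0 < size cs, (nth (0, 0) cs 0).1 = 0, 0 < (nth (0, 0) cs 0).2 &
   forall i, i.+1 < size cs ->
   let c := nth (0, 0) cs i in let c' := nth (0, 0) cs i.+1 in
   [/\ c.1 <= c'.1, c.2 <= c'.2 & c'.1 < c.2]].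

(** If the bottom of column [i + 1] reached the top of column [i], both paths would
    pass through the point where the upper path leaves column [i]. *)
Lemma parallelogram_staircase cs : parallelogram cs -> staircase_columns cs.
Proof.
move=> [up [low [[hu hl pt nt] ->]]].
have [ptE ptN] : count negb up = count negb low /\ count id up = count id low.
  by move: pt; rewrite /Defs.point !take_size => -[].
have su := size_counts up; have sl := size_counts low.
have seu := size_east_heights up; have sel := size_east_heights low.
have sz : size (east_heights low) = size (east_heights up) by lia.
set U := east_heights up in seu sz *; set L := east_heights low in sel sz *.
have L0 : nth 0 L 0 = 0.
  by rewrite /L; case: (low) hl => //= b s [->]; rewrite east_heightsE.
have U0 : 0 < nth 0 U 0.
  have : 0 < size U.
    by rewrite -sz sel; case: (low) hl => //= b s [->].
  rewrite /U; case: (up) hu => //= b s [->]; rewrite east_heightsN (size_map succn) => H.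
  by rewrite (nth_map 0).
have Uall i j : i <= j -> j < size U -> nth 0 U i <= nth 0 U j.
  exact: east_heights_mono.
have Lall i j : i <= j -> j < size L -> nth 0 L i <= nth 0 L j.
  exact: east_heights_mono.
have Ubound i : i < size U -> nth 0 U i <= count id up.
  move=> Hi; have [H _ _ _] := point_passes (leqnn (size up)).
  have := H i; rewrite /Defs.point take_size /= -/U; apply; lia.
have key i : i.+1 < size U -> nth 0 L i <= nth 0 U i -> nth 0 L i.+1 < nth 0 U i.
  move=> Hi LU; rewrite ltnNge; apply/negP => UL.
  have pu : path_point up (i.+1 + nth 0 U i) = (i.+1, nth 0 U i).
    apply: passes_point; split.
    - by move=> j Hj; apply: Uall; lia.
    - by move=> j Hj1; rewrite -/U => Hj2; apply: Uall; lia.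
    - by lia.
    - by apply: Ubound; lia.
  have pl : path_point low (i.+1 + nth 0 U i) = (i.+1, nth 0 U i).
    apply: passes_point; split.
    - by move=> j Hj; apply: leq_trans LU; apply: Lall; lia.
    - by move=> j Hj1; rewrite -/L => Hj2; apply: leq_trans UL _; apply: Lall; lia.
    - by lia.
    - by rewrite -ptN; apply: Ubound; lia.
  have := nt (i.+1 + nth 0 U i); rewrite pu pl eqxx => /(_ _)/negP; apply=> //.
  by have := Ubound i; lia.
have LU i : i < size U -> nth 0 L i <= nth 0 U i.
  elim: i => [|i IH] Hi; first by rewrite L0.
  apply: leq_trans (Uall i i.+1 (leqnSn _) Hi); apply: ltnW; apply: key => //; apply: IH; lia.
split.
- by rewrite size_zip sz minnn; case: (U) U0.
- by rewrite nth_zip.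
- by rewrite nth_zip.
- move=> i; rewrite size_zip sz minnn => Hi; rewrite !nth_zip //=; split.
  + by apply: Lall; lia.
  + by apply: Uall.
  + by apply: key => //; apply: LU; lia.
Qed.

Fixpoint path_with_heights (c : nat) (hs : seq nat) (last : nat) : lattice_path :=
  if hs is h :: hs' then nseq (h - c) true ++ false :: path_with_heights h hs' last
  else nseq (last - c) true.

Lemma east_heights_nseqN m p :
  east_heights (nseq m true ++ p) = map (addn m) (east_heights p).
Proof.
elim: m => [|m IH] /=; first by rewrite map_id.
by rewrite east_heightsN IH -map_comp.
Qed.

Lemma east_heights_path_with_heights c hs last : path leq c hs ->
  east_heights (path_with_heights c hs last) = map (subn^~ c) hs.
Proof.
elim: hs c => [|h hs IH] c /=.
  by rewrite -[nseq _ _]cats0 east_heights_nseqN.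
move=> /andP [ch Hp]; rewrite east_heights_nseqN east_heightsE /= addn0 IH //.
congr (_ :: _); rewrite -map_comp; apply/eq_in_map => x Hx /=.
have : h <= x by apply: (allP (order_path_min leq_trans Hp)).
lia.
Qed.

Lemma counts_path_with_heights c hs last : path leq c hs -> seq.last c hs <= last ->
  count negb (path_with_heights c hs last) = size hs /\ count id (path_with_heights c hs last) =
    last - c.
Proof.
elim: hs c => [|h hs IH] c /=.
  by move=> _ _; rewrite !count_nseq /= mul0n mul1n.
move=> /andP [ch Hp] Hl; have [E1 E2] := IH _ Hp Hl.
rewrite !count_cat !count_nseq /= E1 E2.
have : h <= last.
  apply: leq_trans Hl; case: (hs) Hp => //= a s Hp.
  by apply: (allP (order_path_min leq_trans (s := a :: s) Hp)); apply: mem_last.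
lia.
Qed.

(** A common point of the two paths would separate a column from the next one at the
    height where they share a row. *)
Lemma staircase_parallelogram cs : staircase_columns cs -> parallelogram cs.
Proof.
case: cs => [|[b0 t0] cs] [//= _ b0E t0P H]; subst b0.
set H0 := last t0 (map snd cs).
pose up := path_with_heights 0 (map snd ((0, t0) :: cs)) H0.
pose low := path_with_heights 0 (map fst ((0, t0) :: cs)) H0.
have Sb : sorted leq (map fst ((0, t0) :: cs)).
  apply/(sortedP 0) => i; rewrite size_map => Hi.
  by have [] := H i Hi; rewrite !(nth_map (0, 0)) //; apply: leq_trans Hi.
have St : sorted leq (map snd ((0, t0) :: cs)).
  apply/(sortedP 0) => i; rewrite size_map => Hi.
  by have [] := H i Hi; rewrite !(nth_map (0, 0)) //; apply: leq_trans Hi.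
have Pb : path leq 0 (map fst ((0, t0) :: cs)) by [].
have Pt : path leq 0 (map snd ((0, t0) :: cs)) by [].
have lb : seq.last 0 (map fst ((0, t0) :: cs)) <= H0.
  rewrite /= /H0 (last_map fst cs (0, t0)) (last_map snd cs (0, t0)) (last_nth (0, 0)).
  case E : (size cs) => [|m] //=.
  have [_ H2 H3] := H m (eq_leq (congr1 succn (esym E))).
  by apply: leq_trans (ltnW H3) H2.
have [cuE cuN] := counts_path_with_heights Pt (leqnn _).
have [clE clN] := counts_path_with_heights Pb lb.
have eu : east_heights up = map snd ((0, t0) :: cs).
  rewrite east_heights_path_with_heights // -[RHS]map_id; apply: eq_map => x; exact: subn0.
have el : east_heights low = map fst ((0, t0) :: cs).
  rewrite east_heights_path_with_heights // -[RHS]map_id; apply: eq_map => x; exact: subn0.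
exists up, low; split; last by rewrite eu el; elim: (_ :: cs) => [|[a b] s IH] //=; rewrite -IH.
have size_ul : size up = size low.
  by rewrite !size_counts cuE clE cuN clN !size_map.
split.
- by rewrite /up /= subn0; case: (t0) t0P.
- by [].
- by rewrite /Defs.point !take_size cuE clE cuN clN !size_map.
- move=> k /andP [k0 ku]; apply/negP => /eqP E.
  have szb : size (map fst ((0, t0) :: cs)) = (size cs).+1 by rewrite size_map.
  have szt : size (map snd ((0, t0) :: cs)) = (size cs).+1 by rewrite size_map.
  have kE : k = count negb (take k up) + count id (take k up).
    by rewrite -size_counts size_takel // ltnW.
  have [U1 _ U3 _] := point_passes (ltnW ku).
  have := point_passes (p := low) (k := k); rewrite -size_ul -E => /(_ (ltnW ku)) [_ L2 _ _].
  have x0 : 0 < (path_point up k).1 by rewrite E; case: (k) k0.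
  move: U1 U3 L2 kE x0; rewrite /Defs.point eu el cuE szt szb.
  rewrite ![fst _]/= ![snd _]/=.
  set x := count negb _; set y := count id _ => U1 xw L2 kE x0.
  have nb i : i < (size cs).+1 ->
      nth 0 (map fst ((0, t0) :: cs)) i = (nth (0, 0) ((0, t0) :: cs) i).1.
    by move=> Hi; rewrite (nth_map (0, 0)).
  have nt i : i < (size cs).+1 ->
      nth 0 (map snd ((0, t0) :: cs)) i = (nth (0, 0) ((0, t0) :: cs) i).2.
    by move=> Hi; rewrite (nth_map (0, 0)).
  have := U1 x.-1; rewrite nt; last by lia.
  rewrite prednK // => /(_ (leqnn _)) ty.
  move: xw; rewrite leq_eqVlt => /orP [/eqP xw|xw].
    have : H0 <= y.
      apply: leq_trans ty; rewrite /H0 (last_map snd cs (0, t0)) (last_nth (0, 0)) xw.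
      exact: leqnn.
    have := size_counts up; rewrite cuE cuN /= size_map; lia.
  have := L2 x (leqnn _) xw; rewrite nb // => yb.
  have := H x.-1; rewrite prednK // => /(_ xw) [_ _].
  rewrite ltnNge => /negP; apply; apply: leq_trans ty _.
  by apply: leq_trans yb _; rewrite -{1}(prednK x0).
Qed.

End Paths.

(** * PPP's unrolled on the universal cover of the cylinder *)

Section Unrolled.
Local Open Scope Z_scope.
Local Notation zn := Z.of_nat.
Local Arguments Z.of_nat : simpl never.
Local Arguments Z.to_nat : simpl never.
Local Arguments Z.sub : simpl never.
Local Arguments Z.add : simpl never.
Implicit Types bot top F : Z -> Z.

(** Bottoms and tops of the columns of an unrolled PPP.  Column [w] is column 0 moved
    up by the [h] glued rows, so the overlap condition also covers the gluing. *)
Record valid (w h : nat) bot top : Prop := Valid {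
  valid_w : 0 < zn w;
  valid_h : 0 < zn h;
  valid_bot : nondec bot;
  valid_top : nondec top;
  valid_overlap : forall x, bot (x + 1) < top x;
  valid_eqb : equivariant (zn w) (zn h) bot;
  valid_eqt : equivariant (zn w) (zn h) top }.

Definition unrolled_column bot top (i : nat) : nat * nat :=
  (Z.to_nat (bot (zn i) - bot 0), Z.to_nat (top (zn i) - bot 0)).

(** Columns 0 to [w - 1], with the bottom of the first one moved to row 0; the
    gluing size is the number of rows common to columns [w - 1] and [w]. *)
Definition ppp_of (w h : nat) bot top : ppp_data :=
  PPPData (mkseq (unrolled_column bot top) w) (Z.to_nat (top (zn w - 1) - zn h - bot 0)).

Lemma width_ppp_of w h bot top : width (ppp_of w h bot top) = w.
Proof. exact: size_mkseq. Qed.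

Lemma column_ppp_of w h bot top i : (i < w)%N ->
  column (ppp_of w h bot top) i = unrolled_column bot top i.
Proof. by move=> iw; rewrite /column nth_mkseq. Qed.

Section Valid.
Variables (w h : nat) (bot top : Z -> Z).
Hypothesis V : valid w h bot top.
Let P := ppp_of w h bot top.

Lemma valid_pos x : bot x < top x.
Proof.
have := valid_overlap V x; have := valid_bot V (x := x) (y := x + 1); lia.
Qed.

Lemma bot_w : bot (zn w) = bot 0 + zn h.
Proof. by rewrite -(valid_eqb V) Z.add_0_l. Qed.

Lemma glue_pos : 0 < top (zn w - 1) - zn h - bot 0.
Proof. by have := valid_overlap V (zn w - 1); rewrite Z.sub_add bot_w; lia. Qed.

Lemma nrows_ppp_of : nrows P = Z.to_nat (top (zn w - 1) - bot 0).
Proof.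
have w0 := valid_w V.
rewrite /nrows width_ppp_of !column_ppp_of; try lia.
by rewrite /unrolled_column /= Nat2Z.inj_0 (_ : zn w.-1 = zn w - 1); lia.
Qed.

Lemma height_ppp_of : height P = h.
Proof. rewrite /height nrows_ppp_of [gluing P]/=; have := glue_pos; lia. Qed.

Lemma semi_perimeter_ppp_of : semi_perimeter P = (w + h)%N.
Proof. by rewrite /semi_perimeter height_ppp_of width_ppp_of addnC. Qed.

Lemma column_height_ppp_of i : (i < w)%N ->
  column_height P i = Z.to_nat (top (zn i) - bot (zn i)).
Proof.
move=> iw; rewrite /column_height column_ppp_of // /unrolled_column /=.
have := valid_pos (zn i); have := valid_bot V (x := 0) (y := zn i); lia.
Qed.

Lemma ppp_of_is_ppp : is_ppp P.
Proof.
have w0 := valid_w V; have h0 := valid_h V.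
have g0 := glue_pos; have p0 := valid_pos 0.
split.
- apply: staircase_parallelogram; split.
  + by rewrite size_mkseq; lia.
  + by rewrite nth_mkseq /unrolled_column /= ?Nat2Z.inj_0; lia.
  + by rewrite nth_mkseq /unrolled_column /= ?Nat2Z.inj_0; lia.
  + move=> i; rewrite size_mkseq => Hi.
    rewrite !nth_mkseq; try lia.
    rewrite /unrolled_column /= (_ : zn i.+1 = zn i + 1); last lia.
    have := valid_bot V (x := zn i) (y := zn i + 1).
    have := valid_top V (x := zn i) (y := zn i + 1).
    have := valid_overlap V (zn i); have := valid_bot V (x := 0) (y := zn i).
    by move=> *; split; lia.
- rewrite width_ppp_of !column_height_ppp_of /=; try lia.
  have -> : zn w.-1 = zn w - 1 by lia.
  rewrite Nat2Z.inj_0; have e1 := valid_eqt V 0; have e2 := bot_w.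
  have := valid_top V (x := zn w - 1) (y := zn w).
  have := valid_bot V (x := zn w - 1) (y := zn w).
  by rewrite Z.add_0_l in e1; lia.
- move=> [_]; rewrite nrows_ppp_of /=; lia.
Qed.

Lemma valid_shift c : valid w h (fun x => bot (x + c)) (fun x => top (x + c)).
Proof.
case: V => w0 h0 b t o eb et; split => //.
- by move=> x y xy; apply: b; lia.
- by move=> x y xy; apply: t; lia.
- by move=> x; have := o (x + c); rewrite (_ : x + 1 + c = x + c + 1) //; lia.
- by move=> x; rewrite (_ : x + zn w + c = x + c + zn w) ?eb //; lia.
- by move=> x; rewrite (_ : x + zn w + c = x + c + zn w) ?et //; lia.
Qed.

(** In the unrolled picture rotation only shifts the window of [w] columns. *)
Lemma rotation_ppp_of : rotation P = ppp_of w h (fun x => bot (x + 1)) (fun x => top (x + 1)).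
Proof.
have w0 := valid_w V; have bw := bot_w.
have tw : top (zn w) = top 0 + zn h by rewrite -(valid_eqt V).
have b01 := valid_bot V (x := 0) (y := 1); have o : bot 1 < top 0 := valid_overlap V 0.
rewrite /P; case: (posnP w.-1) => w1.
  have E : w = 1%N by lia.
  have E1 : top 1 = top 0 + zn h by rewrite -tw E.
  have E2 : bot 1 = bot 0 + zn h by rewrite -bw E.
  rewrite /rotation /ppp_of E /= /mkseq /= /unrolled_column /= Nat2Z.inj_0 Z.sub_add (_ : zn 1 -
    1 = 0) //.
  rewrite (_ : zn 1 = 1) // Z.sub_diag E1 E2.
  by congr PPPData; [congr [:: (_, _)]|]; lia.
have z1 : zn 1 = 1 by [].
have [n En] : exists n, w = n.+2 by exists w.-2; lia.
have hw := height_ppp_of; have ch0 := @column_height_ppp_of 0 ltac:(lia).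
rewrite /rotation.
have -> : columns (ppp_of w h bot top) =
   [:: unrolled_column bot top 0, unrolled_column bot top 1 &
     map (unrolled_column bot top) (iota 2%N n)].
  by rewrite /= En.
rewrite Nat2Z.inj_0 in ch0; rewrite -/P hw ch0 /ppp_of; congr PPPData; last first.
  rewrite /unrolled_column /= Z.sub_add tw Nat2Z.inj_0 (_ : zn 1 = 1) // ?(Z.add_0_l 1) //;
    have := valid_pos 0; lia.
rewrite /normalize map_rcons [head _ _]/=.
have -> : unrolled_column bot top 1 :: map (unrolled_column bot top) (iota 2%N n) =
   map (fun i => unrolled_column bot top i.+1) (iota 0%N n.+1).
  by rewrite /= -[iota 2%N n]/(iota (1 + 1)%N n) iotaDl -map_comp.
rewrite En /mkseq -(addn1 n.+1) iotaD map_cat cats1; congr rcons.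
  rewrite -map_comp; apply/eq_in_map => i _ /=; rewrite /unrolled_column /=.
  have -> : zn i.+1 = zn i + 1 by lia.
  rewrite z1 ?Z.add_0_l; have := valid_bot V (x := 0) (y := 1); have := valid_bot V (x :=
    1) (y := zn i + 1).
  have := valid_pos (zn i + 1).
  by move=> *; congr pair; lia.
rewrite /unrolled_column /= (_ : zn (n.+1) + 1 = zn w) ?En; last lia.
rewrite -En bw tw z1 ?Z.add_0_l /=; have := valid_pos 0.
by move=> *; congr pair; rewrite /=; lia.
Qed.

End Valid.

Lemma iter_rotation w h bot top n : valid w h bot top ->
  iter n rotation (ppp_of w h bot top) =
  ppp_of w h (fun x => bot (x + zn n)) (fun x => top (x + zn n)).
Proof.
move=> V; elim: n => [|n IH].
  rewrite /= /ppp_of; congr PPPData; last by rewrite !Z.add_0_r.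
  by apply: eq_map => i; rewrite /unrolled_column !Z.add_0_r.
rewrite iterS IH (rotation_ppp_of (valid_shift V (zn n))).
by congr ppp_of; apply/funext => x; [congr bot | congr top]; lia.
Qed.

Lemma valid_ext (w h : nat) bot c bot' c' :
  equivariant (zn w) (zn h) bot -> equivariant (zn w) (zn h) bot' -> 0 < zn w ->
  (forall i, 0 <= i < zn w -> bot i - c = bot' i - c') ->
  forall x, bot x - c = bot' x - c'.
Proof.
move=> e e' w0 H x.
have E := Z.div_mod x (zn w).
have -> : x = x mod zn w + zn w * (x / zn w) by lia.
rewrite !(equivariant_mul e) !(equivariant_mul e').
have := H (x mod zn w) (Z.mod_pos_bound _ _ w0); lia.
Qed.

Lemma ppp_of_inj w h bot top w' h' bot' top' :
  valid w h bot top -> valid w' h' bot' top' ->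
  ppp_of w h bot top = ppp_of w' h' bot' top' ->
  [/\ w = w', h = h', forall x, bot x - bot 0 = bot' x - bot' 0
    & forall x, top x - bot 0 = top' x - bot' 0].
Proof.
move=> V V' E.
have ww : w = w' by rewrite -(width_ppp_of w h bot top) E width_ppp_of.
have hh : h = h' by rewrite -(height_ppp_of V) E (height_ppp_of V').
subst w' h'.
have Ei i : 0 <= i < zn w -> unrolled_column bot top (Z.to_nat i) =
  unrolled_column bot' top' (Z.to_nat i).
  by move=> Hi; rewrite -(column_ppp_of (w:=w) h bot top) ?E ?column_ppp_of //; lia.
split => //.
  apply: (valid_ext (valid_eqb V) (valid_eqb V') (valid_w V)) => i Hi.
  have [] := Ei i Hi; rewrite Z2Nat.id; last lia.
  have := valid_bot V (x := 0) (y := i); have := valid_bot V' (x := 0) (y := i); lia.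
apply: (valid_ext (valid_eqt V) (valid_eqt V') (valid_w V)) => i Hi.
have [] := Ei i Hi; rewrite Z2Nat.id; last lia.
have := valid_bot V (x := 0) (y := i); have := valid_bot V' (x := 0) (y := i).
have := valid_pos V i; have := valid_pos V' i; lia.
Qed.

(** A PPP satisfies [0 < h]: if the gluing size were the number of rows, the last
    column would start in row 0 and the first one reach the top row, which is the
    excluded rectangle. *)
Lemma is_ppp_unrolled P : is_ppp P ->
  exists w h bot top, valid w h bot top /\ P = ppp_of w h bot top.
Proof.
move=> [/parallelogram_staircase [s0 b00 t00 H] /andP [g0 gm] nr].
set w := width P; set h := height P.
have colE i : nth (0, 0)%N (columns P) i = column P i by [].
rewrite !colE in b00 t00.
have {}H i : (i.+1 < w)%N -> [/\ ((column P i).1 <= (column P i.+1).1)%N,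
   ((column P i).2 <= (column P i.+1).2)%N & ((column P i.+1).1 < (column P i).2)%N] by apply: H.
have w0 : (0 < w)%N by [].
have mb i j : (i <= j)%N -> (j < w)%N -> ((column P i).1 <= (column P j).1)%N.
  elim: j => [|j IH]; first by rewrite leqn0 => /eqP ->.
  rewrite leq_eqVlt => /orP [/eqP -> //|ij] jw; have [Hb _ _] := H j jw.
  by apply: leq_trans Hb; apply: IH => //; lia.
have mt i j : (i <= j)%N -> (j < w)%N -> ((column P i).2 <= (column P j).2)%N.
  elim: j => [|j IH]; first by rewrite leqn0 => /eqP ->.
  rewrite leq_eqVlt => /orP [/eqP -> //|ij] jw; have [_ Ht _] := H j jw.
  by apply: leq_trans Ht; apply: IH => //; lia.
rewrite leq_min in gm; move/andP: gm => [g1 g2].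
rewrite -/w in g2; rewrite /column_height b00 in g1 g2.
have nrE : nrows P = (column P w.-1).2 by rewrite /nrows b00 subn0.
have hE : h = (nrows P - gluing P)%N by [].
have h0 : (0 < h)%N.
  rewrite lt0n; apply/negP => /eqP hz; apply: nr.
  have bw : (column P w.-1).1 = 0%N by lia.
  split; last by lia.
  apply/(all_nthP (0, 0)%N) => i Hi /=; rewrite colE.
  have Hi' : (i <= w.-1)%N by rewrite /w /width; lia.
  have := mb i w.-1 Hi'; have := mt i w.-1 Hi'; have := mt 0%N i.
  case: (column P i) => b t /= *; apply/eqP; congr pair; rewrite ?nrE; lia.
pose bot x := zn (column P (Z.to_nat (x mod zn w))).1 + zn h * (x / zn w).
pose top x := zn (column P (Z.to_nat (x mod zn w))).2 + zn h * (x / zn w).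
have dm x : exists q r, [/\ x = zn r + zn w * q, (r < w)%N,
   x / zn w = q & x mod zn w = zn r].
  have := Z.div_mod x (zn w); have := Z.mod_pos_bound x (zn w).
  by move=> m1 m2; exists (x / zn w), (Z.to_nat (x mod zn w)); split; lia.
have ev q (r : nat) : (r < w)%N ->
   bot (zn r + zn w * q) = zn (column P r).1 + zn h * q /\
   top (zn r + zn w * q) = zn (column P r).2 + zn h * q.
  move=> rw; rewrite /bot /top.
  have -> : (zn r + zn w * q) / zn w = q by symmetry; apply: (Z.div_unique _ _ _ (zn r)); lia.
  have -> : (zn r + zn w * q) mod zn w = zn r by symmetry; apply: (Z.mod_unique _ _ q); lia.
  by rewrite Nat2Z.id.
have step x : bot x <= bot (x + 1) /\ top x <= top (x + 1) /\ bot (x + 1) < top x.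
  have [q [r [-> rw _ _]]] := dm x; have [Eb Et] := ev q r rw.
  case: (ltnP r.+1 w) => Hr.
    have [Eb' Et'] := ev q r.+1 Hr; have [i1 i2 i3] := H r Hr.
    by rewrite (_ : _ + 1 = zn r.+1 + zn w * q) ?Eb ?Et ?Eb' ?Et'; lia.
  have [Eb' Et'] := ev (q + 1) 0%N w0.
  rewrite (_ : _ + 1 = zn 0 + zn w * (q + 1)) ?Eb ?Et ?Eb' ?Et'; last lia.
  rewrite b00; have Er : r = w.-1 by lia.
  subst r; lia.
have per x : bot (x + zn w) = bot x + zn h /\ top (x + zn w) = top x + zn h.
  have [q [r [-> rw _ _]]] := dm x; have [Eb Et] := ev q r rw.
  have [Eb' Et'] := ev (q + 1) r rw.
  rewrite (_ : _ + zn w = zn r + zn w * (q + 1)) ?Eb ?Et ?Eb' ?Et'; lia.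
have V : valid w h bot top.
  split; try lia.
  - by apply: nondec_step => x; case: (step x).
  - by apply: nondec_step => x; case: (step x) => _ [].
  - by move=> x; case: (step x) => _ [].
  - by move=> x; case: (per x).
  - by move=> x; case: (per x).
have [bz _] := ev 0 0%N w0; rewrite Z.mul_0_r !Z.add_0_r b00 in bz.
exists w, h, bot, top; split=> //.
rewrite /ppp_of; case EP : P => [cs g]; congr PPPData.
  have -> : cs = columns P by rewrite EP.
  apply: (@eq_from_nth _ (0, 0)%N); first by rewrite size_mkseq.
  move=> i Hi; rewrite nth_mkseq // colE /unrolled_column bz.
  have [Eb Et] := ev 0 i Hi; rewrite Z.mul_0_r !Z.add_0_r in Eb Et.
  by rewrite Eb Et; case: (column P i) => b t; congr pair; rewrite /=; lia.
have -> : g = gluing P by rewrite EP.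
have w1 : (w.-1 < w)%N by lia.
have [_ Et] := ev 0 w.-1 w1; rewrite Z.mul_0_r !Z.add_0_r in Et.
rewrite (_ : zn w - 1 = zn w.-1) ?Et ?bz; lia.
Qed.

End Unrolled.

(** * Leaves of an unrolled PPP *)

Section Periodic.
Local Open Scope Z_scope.
Local Notation zn := Z.of_nat.
Local Arguments Z.of_nat : simpl never.
Local Arguments Z.to_nat : simpl never.
Local Arguments Z.sub : simpl never.
Local Arguments Z.add : simpl never.
Local Arguments Z.mul : simpl never.
Variable p : Z -> Prop.

(** The number of elements of [p] below [y], counted from 0 and with a sign. *)
Definition rank_of (y : Z) : Z :=
  if 0 <=? y then zn (zcount p 0 (Z.to_nat y)) else - zn (zcount p y (Z.to_nat (- y))).

Lemma rank_of_step y : rank_of (y + 1) = rank_of y + zn `[< p y >].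
Proof.
rewrite /rank_of; case: Z.leb_spec => y0; case: Z.leb_spec => y1; try lia.
- rewrite (_ : Z.to_nat (y + 1) = (Z.to_nat y + 1)%N); last lia.
  by rewrite zcount_cat zcount1 Z.add_0_l Z2Nat.id; lia.
- have -> : y = -1 by lia.
  rewrite (_ : Z.to_nat (-1 + 1) = 0%N) // (_ : Z.to_nat (- -1) = 1%N) // zcount1.
  by rewrite /zcount big_ord0; lia.
- rewrite (_ : Z.to_nat (- y) = (1 + Z.to_nat (- (y + 1)))%N); last lia.
  by rewrite zcount_cat zcount1 (_ : zn 1 = 1) //; lia.
Qed.

Lemma rank_of_count a n : rank_of (a + zn n) = rank_of a + zn (zcount p a n).
Proof.
elim: n => [|n IH]; first by rewrite /zcount big_ord0 Nat2Z.inj_0 !Z.add_0_r.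
rewrite (_ : a + zn n.+1 = a + zn n + 1); last lia.
by rewrite rank_of_step IH -[n.+1]addn1 zcount_cat zcount1; lia.
Qed.

Lemma rank_of_nondec : nondec rank_of.
Proof. by apply: nondec_step => y; rewrite rank_of_step; case: asbool; lia. Qed.

Lemma rank_of_lt x y : x < y -> p (y - 1) -> rank_of x < rank_of y.
Proof.
move=> xy py; have := rank_of_step (y - 1); rewrite Z.sub_add => ->.
have -> : `[< p (y - 1) >] = true by apply/asboolP.
have := rank_of_nondec (x := x) (y := y - 1); lia.
Qed.

Variable m : nat.
Hypothesis m0 : 0 < zn m.
Hypothesis per : forall x, p (x + zn m) <-> p x.

Lemma rank_of_equivariant : equivariant (zn m) (zn (zcount p 0 m)) rank_of.
Proof. by move=> y; rewrite rank_of_count (zcount_shift per y 0). Qed.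

Let xs : seq nat := [seq x <- iota 0 m | `[< p (zn x) >]].

Lemma periodic_enumeration : (0 < size xs)%N ->
  exists e : Z -> Z, [/\ incr e, equivariant (zn (size xs)) (zn m) e,
    forall x, p x <-> exists i, x = e i &
    forall i, (i < size xs)%N -> e (zn i) = zn (nth 0%N xs i)].
Proof.
set c := size xs => c0.
have xsP i : (i < c)%N -> p (zn (nth 0%N xs i)) /\ (nth 0%N xs i < m)%N.
  move=> ic; have := mem_nth 0%N ic; rewrite mem_filter mem_iota add0n.
  by move=> /andP [/asboolP ? /andP [_ ?]].
have xsS i j : (i < j)%N -> (j < c)%N -> (nth 0%N xs i < nth 0%N xs j)%N.
  move=> ij jc; have xsorted : sorted ltn xs.
    by apply: sorted_filter; [exact: ltn_trans | exact: iota_ltn_sorted].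
  have /sortedP := xsorted => H.
  by rewrite (sorted_ltn_nth ltn_trans 0%N xsorted) // inE ?(ltn_trans ij).
pose e i := zn (nth 0%N xs (Z.to_nat (i mod zn c))) + zn m * (i / zn c).
have ev q (r : nat) : (r < c)%N -> e (zn r + zn c * q) = zn (nth 0%N xs r) + zn m * q.
  move=> rc; rewrite /e.
  have -> : (zn r + zn c * q) / zn c = q by symmetry; apply: (Z.div_unique _ _ _ (zn r)); lia.
  have -> : (zn r + zn c * q) mod zn c = zn r by symmetry; apply: (Z.mod_unique _ _ q); lia.
  by rewrite Nat2Z.id.
have dm x : exists q r, x = zn r + zn c * q /\ (r < c)%N.
  have := Z.div_mod x (zn c); have := Z.mod_pos_bound x (zn c).
  by move=> m1 m2; exists (x / zn c), (Z.to_nat (x mod zn c)); split; lia.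
have perm q x : p (x + zn m * q) <-> p x.
  have up (n : nat) y : p (y + zn m * zn n) <-> p y.
    elim: n => [|n IH]; first by rewrite Z.mul_0_r Z.add_0_r.
    rewrite (_ : y + _ = y + zn m * zn n + zn m); last lia.
    by rewrite per.
  case: (Z.le_ge_cases 0 q) => q0; first by have := up (Z.to_nat q) x; rewrite Z2Nat.id.
  have := up (Z.to_nat (- q)) (x + zn m * q); rewrite Z2Nat.id; last lia.
  by rewrite (_ : x + _ + _ = x); [move=> ->|lia].
exists e; split.
- apply: incr_step => x; have [q [r [-> rc]]] := dm x.
  rewrite ev //; case: (ltnP r.+1 c) => rc'.
    rewrite (_ : _ + 1 = zn r.+1 + zn c * q) ?ev //; last lia.
    have := xsS r r.+1 (leqnn _) rc'; lia.
  rewrite (_ : _ + 1 = zn 0 + zn c * (q + 1)) ?ev //; last lia.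
  have [_ ?] := xsP r rc; lia.
- move=> x; have [q [r [-> rc]]] := dm x.
  rewrite (_ : _ + zn c = zn r + zn c * (q + 1)); last lia.
  by rewrite !ev //; lia.
- move=> x; split=> [px|[i ->]]; last first.
    by have [q [r [-> rc]]] := dm i; rewrite ev //; apply/perm; have [] := xsP r rc.
  have E := Z.div_mod x (zn m); have B := Z.mod_pos_bound x (zn m) m0.
  have Ex : x = x mod zn m + zn m * (x / zn m) by lia.
  have pr : p (x mod zn m) by apply/(perm (x / zn m)); rewrite -Ex.
  have Hin : Z.to_nat (x mod zn m) \in xs.
    by rewrite mem_filter mem_iota; apply/andP; split; [by apply/asboolP; rewrite Z2Nat.id //;
      lia | lia].
  exists (zn (index (Z.to_nat (x mod zn m)) xs) + zn c * (x / zn m)).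
  rewrite ev ?index_mem // nth_index // Z2Nat.id; lia.
- by move=> i ic; have := ev 0 i ic; rewrite !Z.mul_0_r !Z.add_0_r.
Qed.

End Periodic.

Section Leaves.
Local Open Scope Z_scope.
Local Notation zn := Z.of_nat.
Local Arguments Z.of_nat : simpl never.
Local Arguments Z.to_nat : simpl never.
Local Arguments Z.sub : simpl never.
Local Arguments Z.add : simpl never.
Local Arguments Z.mul : simpl never.
Local Arguments cells : simpl never.
Local Arguments cell : simpl never.
Local Arguments ppp_of : simpl never.
Local Arguments column_vertex : simpl never.
Local Arguments row_vertex : simpl never.
Variables (w h : nat) (bot top : Z -> Z).
Hypothesis V : valid w h bot top.
Let P := ppp_of w h bot top.

Definition kept_column x := bot x < bot (x + 1).
Definition kept_row y := exists x, top x = y + 1.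

Let bge i : bot 0 <= bot (zn i).
Proof. by apply: (valid_bot V); lia. Qed.

Lemma cell_ppp_of x y : cell P (x, y) =
  (x < w)%N && ((bot (zn x) <=? bot 0 + zn y) && (bot 0 + zn y <? top (zn x))).
Proof.
rewrite /cell /= width_ppp_of; case: ltnP => //= xw;
  rewrite /P column_ppp_of // /unrolled_column /=.
have := @bge x; have := valid_pos V (zn x).
case: Z.leb_spec => b; case: Z.ltb_spec => t /=; lia.
Qed.

Lemma row_vertex_ppp_of x y : cell P (x, y) ->
  row_vertex P (x, y) = (bot 0 + zn y <? bot (zn x + 1)).
Proof.
rewrite cell_ppp_of => /andP [xw /andP [/Z.leb_spec0 yb /Z.ltb_spec0 yt]].
rewrite /row_vertex /right_neighbour [(x, y).1]/= [(x, y).2]/= cell_ppp_of.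
rewrite /P width_ppp_of (height_ppp_of V).
have E : zn x.+1 = zn x + 1 by lia.
have T := valid_top V (x := zn x) (y := zn x + 1).
case: (ltnP x.+1 w) => xw1 /=.
  rewrite E; have -> : (x.+1 == w) = false by lia.
  have -> : (bot (zn x + 1) <=? bot 0 + zn y) && (bot 0 + zn y <? top (zn x + 1)) =
      ~~ (bot 0 + zn y <? bot (zn x + 1)).
    by case: Z.leb_spec => b1; case: Z.ltb_spec => t1; case: Z.ltb_spec => /=; lia.
  by case: Z.ltb.
have -> : (x.+1 == w) = true by lia.
have -> : zn x + 1 = zn w by lia.
rewrite (bot_w V) /=.
have -> : (bot 0 + zn y <? bot 0 + zn h) = ~~ (h <= y)%N.
  by case: Z.ltb_spec; lia.
by case: leqP.
Qed.

Lemma count_vertices (a : pred (nat * nat)) : count a (vertices P) =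
  (count (predI a (column_vertex P)) (cells P) +
   count (predI a (row_vertex P)) (cells P))%N.
Proof. by rewrite /vertices count_cat; congr addn; apply: count_filter. Qed.

Lemma cells_uniq : uniq (cells P).
Proof.
apply: filter_uniq; apply: allpairs_uniq; rewrite ?iota_uniq //.
by move=> [a b] [c d] _ _ [-> ->].
Qed.

Lemma mem_cells x y : ((x, y) \in cells P) = cell P (x, y).
Proof.
rewrite mem_filter; case C : (cell P (x, y)) => //=.
move: C; rewrite cell_ppp_of => /andP [xw /andP [/Z.leb_spec0 yb /Z.ltb_spec0 yt]].
apply/allpairsP; exists (x, y) => /=; rewrite !mem_iota /P width_ppp_of (nrows_ppp_of V).
have := valid_top V (x := zn x) (y := zn w - 1); split=> //; lia.
Qed.

(** A column contains one column vertex, its top cell, and the row vertices of the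
    rows below the bottom of the next column. *)
Lemma leaf_column_ppp_of x : (x < w)%N ->
  leaf_column P x = ~~ `[< kept_column (zn x) >].
Proof.
move=> xw; rewrite /leaf_column count_vertices.
pose y0 := Z.to_nat (top (zn x) - bot 0 - 1).
have pos := valid_pos V (zn x); have b0 := @bge x.
rewrite (@eq_in_count _ _ (pred1 (x, y0))); last first.
  move=> [x' y'] /=; rewrite mem_cells cell_ppp_of =>
    /andP [xw' /andP [/Z.leb_spec0 yb /Z.ltb_spec0 yt]].
  rewrite /column_vertex /= /P column_ppp_of // /unrolled_column /= xpair_eqE.
  by case: eqP => // ->; rewrite /= /y0; have := @bge x; lia.
rewrite count_uniq_mem ?cells_uniq // mem_cells cell_ppp_of xw /=.
have -> : (bot (zn x) <=? bot 0 + zn y0) = true by rewrite /y0; case: Z.leb_spec; lia.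
have -> : (bot 0 + zn y0 <? top (zn x)) = true by rewrite /y0; case: Z.ltb_spec; lia.
rewrite /= add1n eqSS -leqn0 leqNgt -has_count; congr (~~ _).
apply/hasP/asboolP.
  move=> [[x' y']]; rewrite mem_cells => C /= /andP [/eqP Ex]; subst x'.
  rewrite row_vertex_ppp_of // => /Z.ltb_spec0 r.
  move: C; rewrite cell_ppp_of => /andP [_ /andP [/Z.leb_spec0 yb _]].
  by rewrite /kept_column; lia.
rewrite /kept_column => k; exists (x, Z.to_nat (bot (zn x) - bot 0)).
  rewrite mem_cells cell_ppp_of xw /= Z2Nat.id; last lia.
  by apply/andP; split; [apply/Z.leb_spec0 | apply/Z.ltb_spec0]; lia.
have C : cell P (x, Z.to_nat (bot (zn x) - bot 0)).
  rewrite cell_ppp_of xw /= Z2Nat.id; last lia.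
  by apply/andP; split; [apply/Z.leb_spec0 | apply/Z.ltb_spec0]; lia.
by rewrite /= eqxx /= row_vertex_ppp_of //; apply/Z.ltb_spec0; rewrite Z2Nat.id; lia.
Qed.

Lemma crossing c : bot 0 <= c < bot (zn w) ->
  exists2 x, (x < w)%N & bot (zn x) <= c < bot (zn x + 1).
Proof.
suff H n : bot 0 <= c < bot (zn n) -> exists2 x, (x < n)%N & bot (zn x) <= c < bot (zn x + 1).
  exact: H.
elim: n => [|n IH] Hc; first by rewrite Nat2Z.inj_0 in Hc; lia.
case: (Z.le_gt_cases (bot (zn n)) c) => bc.
  by exists n => //; rewrite (_ : zn n + 1 = zn n.+1); lia.
by have [|x xn Hx] := IH; [lia | exists x => //; lia].
Qed.

Lemma kept_row_per y : kept_row (y + zn h) <-> kept_row y.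
Proof.
split=> -[x Hx].
  by exists (x - zn w); have := valid_eqt V (x - zn w); rewrite Z.sub_add; lia.
by exists (x + zn w); rewrite (valid_eqt V); lia.
Qed.

Lemma kept_row_mul q y : kept_row (y + zn h * q) <-> kept_row y.
Proof.
split=> -[x Hx].
  by exists (x + zn w * - q); rewrite (equivariant_mul (valid_eqt V)); lia.
by exists (x + zn w * q); rewrite (equivariant_mul (valid_eqt V)); lia.
Qed.

Lemma kept_column_per x : kept_column (x + zn w) <-> kept_column x.
Proof.
rewrite /kept_column (_ : x + zn w + 1 = x + 1 + zn w) ?(valid_eqb V); lia.
Qed.

(** A glued row contains one row vertex, in the unique column where the bottom passes
    above the row; the other vertices of the row are tops of columns. *)
Lemma leaf_row_ppp_of y : leaf_row P (glued_row P y) = ~~ `[< kept_row (bot 0 + zn y) >].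
Proof.
have h0 := valid_h V; have w0 := valid_w V; have bw := bot_w V.
rewrite /glued_row {2}/P (height_ppp_of V).
set r := (y %% h)%N; have rh : (r < h)%N by rewrite ltn_mod; lia.
have -> : `[< kept_row (bot 0 + zn y) >] = `[< kept_row (bot 0 + zn r) >].
  apply: asbool_equiv_eq; rewrite -(kept_row_mul (zn (y %/ h)) (bot 0 + zn r)).
  have := divn_eq y h; rewrite -/r => E.
  by rewrite (_ : bot 0 + zn y = bot 0 + zn r + zn h * zn (y %/ h)) //; lia.
rewrite /leaf_row count_vertices addnC.
have [|x0 x0w x0b] := @crossing (bot 0 + zn r); first by lia.
have C0 : cell P (x0, r).
  rewrite cell_ppp_of x0w /=; apply/andP; split; [apply/Z.leb_spec0 | apply/Z.ltb_spec0]; try lia.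
  have := valid_overlap V (zn x0); lia.
rewrite (@eq_in_count _ _ (pred1 (x0, r))); last first.
  move=> [x' y'] /=; rewrite mem_cells => C; rewrite row_vertex_ppp_of // /glued_row.
  rewrite /P (height_ppp_of V) xpair_eqE.
  move: C; rewrite cell_ppp_of => /andP [xw' /andP [/Z.leb_spec0 yb /Z.ltb_spec0 yt]].
  case: Z.ltb_spec => yr; last first.
    rewrite andbF; apply/esym/negbTE/negP => /andP [/eqP Ex /eqP Ey]; subst x' y'; lia.
  have yh : (y' < h)%N.
    by have := valid_bot V (x := zn x' + 1) (y := zn w); lia.
  rewrite modn_small // andbT; case: eqP => [Ey|]; rewrite ?andbF //; subst y'.
  rewrite andbT; apply/esym/eqP.
  have := valid_bot V (x := zn x' + 1) (y := zn x0).
  have := valid_bot V (x := zn x0 + 1) (y := zn x'); lia.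
rewrite count_uniq_mem ?cells_uniq // mem_cells C0 /= add1n eqSS -leqn0 leqNgt -has_count.
congr (~~ _); apply/hasP/asboolP.
  move=> [[x' y']]; rewrite mem_cells cell_ppp_of => /andP [xw' _] /=.
  rewrite /glued_row /P (height_ppp_of V) /column_vertex /= column_ppp_of // /unrolled_column /=.
  move=> /andP [/eqP Er /eqP Ey].
  have : kept_row (bot 0 + zn y').
    by exists (zn x'); have := @bge x'; have := valid_pos V (zn x'); lia.
  move=> K; apply/(kept_row_mul (zn (y' %/ h)) (bot 0 + zn r)).
  have := divn_eq y' h; rewrite Er => E.
  by rewrite (_ : bot 0 + zn r + _ = bot 0 + zn y') //; lia.
move=> [x Hx].
have E := Z.div_mod x (zn w); have B := Z.mod_pos_bound x (zn w) w0.
set x' := Z.to_nat (x mod zn w).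
have Ex : x = zn x' + zn w * (x / zn w) by rewrite /x' Z2Nat.id; lia.
rewrite Ex (equivariant_mul (valid_eqt V)) in Hx.
have x'w : (x' < w)%N by rewrite /x'; lia.
have pos := valid_pos V (zn x'); have b0 := @bge x'.
set y' := Z.to_nat (top (zn x') - bot 0 - 1).
exists (x', y').
  rewrite mem_cells cell_ppp_of x'w /=.
  by apply/andP; split; [apply/Z.leb_spec0 | apply/Z.ltb_spec0]; rewrite /y'; lia.
rewrite /= /glued_row /P (height_ppp_of V) /column_vertex /= column_ppp_of // /unrolled_column /=.
apply/andP; split; last by rewrite /y'; apply/eqP; lia.
have : zn y' = zn r + zn h * (- (x / zn w)) by rewrite /y'; lia.
move: (- (x / zn w)) => q Ey.
have q0 : 0 <= q by nia.
have -> : y' = (r + Z.to_nat q * h)%N by nia.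
by rewrite addnC modnMDl modn_small.
Qed.

End Leaves.

(** * Pruning and intrinsic thickness *)

Section Pruning.
Local Open Scope Z_scope.
Local Notation zn := Z.of_nat.
Local Arguments Z.of_nat : simpl never.
Local Arguments Z.to_nat : simpl never.
Local Arguments Z.sub : simpl never.
Local Arguments Z.add : simpl never.
Local Arguments Z.mul : simpl never.
Implicit Types bot top F : Z -> Z.

(** The column that contains the rightmost cell of the row of the top cell of [x]. *)
Definition parent_map bot top F := forall x, bot (F x) < top x <= bot (F x + 1).

Lemma parent_uniq bot top F x y : nondec bot -> parent_map bot top F ->
  bot y < top x <= bot (y + 1) -> F x = y.
Proof.
move=> nb pF Hy; have := pF x.
have := nb (F x + 1) y; have := nb (y + 1) (F x); lia.
Qed.

Variables (w h : nat) (bot top : Z -> Z).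
Hypothesis V : valid w h bot top.
Let P := ppp_of w h bot top.

Let kC := kept_column bot.
Let kR := kept_row top.
Let rho := rank_of kR.
Let xs : seq nat := [seq x <- iota 0 w | `[< kC (zn x) >]].
Let w1 := size xs.
Let h1 := zcount kR 0 h.

Lemma some_kept_column : (0 < w1)%N.
Proof.
rewrite lt0n; apply/negP => /eqP /size0nil E.
suff H (n : nat) : (n <= w)%N -> bot (zn n) = bot 0.
  have := H w (leqnn _); rewrite (bot_w V); have := valid_h V; lia.
elim: n => [|n IH] nw; first by rewrite Nat2Z.inj_0.
have nk : ~ kC (zn n).
  move=> k; suff : n \in xs by rewrite E.
  by rewrite mem_filter mem_iota; apply/andP; split; [apply/asboolP | lia].
have := valid_bot V (x := zn n) (y := zn n + 1).
rewrite (_ : zn n.+1 = zn n + 1); last lia.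
have := IH (ltnW nw); rewrite /kC /kept_column in nk; lia.
Qed.

Lemma some_kept_row : (0 < h1)%N.
Proof.
rewrite lt0n; apply/negP => /eqP E.
rewrite /h1 (zcount_shift (kept_row_per V) 0 (top 0 - 1)) in E.
apply: (zcount_eq0 E (i := 0)); first by have := valid_h V; lia.
by exists 0; lia.
Qed.

(** The row just below [top x] contains the top cell of [x], so it is kept. *)
Lemma rank_of_top x y : y < top x -> rho y < rho (top x).
Proof. by move=> yx; apply: rank_of_lt => //; exists x; lia. Qed.

(** In the unrolled picture pruning keeps the columns enumerated by [e] and
    renumbers the rows by their rank among those that are kept.  The columns dropped
    between two kept ones do not change the bottom. *)
Lemma prune_structure : exists e,
  [/\ incr e, equivariant (zn w1) (zn w) e,
      forall x, kC x <-> exists i, x = e i &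
      forall i, bot (e (i + 1)) = bot (e i + 1)] /\
  (valid w1 h1 (fun i => rho (bot (e i))) (fun i => rho (top (e i))) /\
  prune P = ppp_of w1 h1 (fun i => rho (bot (e i))) (fun i => rho (top (e i)))).
Proof.
have w0 := valid_w V; have h0 := valid_h V.
have [e [eI eE eim ev]] := periodic_enumeration w0 (kept_column_per V) some_kept_column.
rewrite -/xs -/w1 in eE ev.
have next i : bot (e (i + 1)) = bot (e i + 1).
  have e1 : e i < e (i + 1) by apply: eI; lia.
  suff H (n : nat) : e i + 1 + zn n <= e (i + 1) -> bot (e i + 1 + zn n) = bot (e i + 1).
    have := H (Z.to_nat (e (i + 1) - e i - 1)).
    rewrite Z2Nat.id; last lia.
    by rewrite (_ : _ + _ = e (i + 1)); [apply | ]; lia.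
  elim: n => [|n IH] Hn; first by rewrite Nat2Z.inj_0 Z.add_0_r.
  rewrite (_ : e i + 1 + zn n.+1 = e i + 1 + zn n + 1) in Hn *; last lia.
  rewrite -IH; last lia.
  have nk : ~ kC (e i + 1 + zn n).
    move=> /eim [j Ej].
    have : i < j by apply: (incr_lt eI); lia.
    have : j < i + 1 by apply: (incr_lt eI); lia.
    lia.
  have := valid_bot V (x := e i + 1 + zn n) (y := e i + 1 + zn n + 1).
  by rewrite /kC /kept_column in nk; lia.
have rE := rank_of_equivariant (kept_row_per V); rewrite -/h1 -/rho in rE.
have rN : nondec rho by apply: rank_of_nondec.
have w10 := some_kept_column; have h10 := some_kept_row.
have V1 : valid w1 h1 (fun i => rho (bot (e i))) (fun i => rho (top (e i))).
  split; try lia.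
  - by move=> x y xy; apply/rN/(valid_bot V)/(incr_nondec eI).
  - by move=> x y xy; apply/rN/(valid_top V)/(incr_nondec eI).
  - by move=> x; rewrite next; apply: rank_of_top; apply: (valid_overlap V).
  - by move=> x; rewrite eE (valid_eqb V) rE.
  - by move=> x; rewrite eE (valid_eqt V) rE.
exists e; split; first by split.
split=> //.
pose rk (y : nat) := count (fun y => ~~ leaf_row P (glued_row P y)) (iota 0 y).
have -> : prune P = (let cs := normalize [seq (rk (column P x).1, rk (column P x).2)
    | x <- [seq x <- iota 0 (width P) | ~~ leaf_column P x]] in
    PPPData cs (nrows (PPPData cs 0) - rk (Defs.height P))%N) by [].
have -> : [seq x <- iota 0 (width P) | ~~ leaf_column P x] = xs.
  rewrite /P width_ppp_of; apply: eq_in_filter => x; rewrite mem_iota => xw.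
  by rewrite (leaf_column_ppp_of V) ?negbK //; lia.
have rkE y : rk y = zcount kR (bot 0) y.
  rewrite /rk /zcount -sum1_count big_mkcond /=.
  have -> : iota 0 y = index_iota 0 y by rewrite /index_iota subn0.
  by rewrite big_mkord; apply: eq_bigr => i _; rewrite (leaf_row_ppp_of V) negbK; case: asbool.
have rkZ y : zn (rk y) = rho (bot 0 + zn y) - rho (bot 0).
  by rewrite rkE; have := rank_of_count kR (bot 0) y; rewrite -/rho => ->; lia.
have xsw i : (i < w1)%N -> (nth 0%N xs i < w)%N.
  by move=> iw; have := mem_nth 0%N iw; rewrite mem_filter mem_iota add0n => /andP [_ /andP [_]].
have colE i : (i < w1)%N ->
   zn (rk (column P (nth 0%N xs i)).1) = rho (bot (e (zn i))) - rho (bot 0) /\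
   zn (rk (column P (nth 0%N xs i)).2) = rho (top (e (zn i))) - rho (bot 0).
  move=> iw; rewrite /P column_ppp_of ?xsw // /unrolled_column /= !rkZ ev //.
  have := valid_bot V (x := 0) (y := zn (nth 0%N xs i)).
  have := valid_pos V (zn (nth 0%N xs i)) => b1 b2.
  by rewrite !Z2Nat.id; try lia; split; congr (rho _ - _); lia.
set cs := normalize _; rewrite /=.
have scs : size cs = w1 by rewrite !size_map.
have csE i : (i < w1)%N -> nth (0, 0)%N cs i =
    unrolled_column (fun i => rho (bot (e i))) (fun i => rho (top (e i))) i.
  move=> iw; rewrite /cs /normalize (nth_map (0, 0)%N) ?size_map //.
  rewrite (nth_map 0%N) // -nth0 (nth_map 0%N) // /unrolled_column /=.
  have [E1 E2] := colE i iw; have [E3 _] := colE 0%N w10; rewrite Nat2Z.inj_0 in E3.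
  have n1 := valid_bot V1 (x := 0) (y := zn i); have n2 := valid_pos V1 (zn i).
  by rewrite /= in n1 n2; congr pair; lia.
rewrite /ppp_of; congr PPPData.
  by apply: (@eq_from_nth _ (0, 0)%N); rewrite ?size_mkseq // scs => i iw; rewrite csE // nth_mkseq.
rewrite /nrows /width /column [columns _]/= scs !csE; try lia.
rewrite /P (height_ppp_of V) /unrolled_column /=.
have := rkZ h; rewrite -(bot_w V) => Eh.
have bw : rho (bot (zn w)) = rho (bot 0) + zn h1 by rewrite (bot_w V) rE.
have -> : zn w1.-1 = zn w1 - 1 by lia.
have := glue_pos V1; rewrite Nat2Z.inj_0 /=; lia.
Qed.

(** The pruned PPP is the unrolled one restricted to its kept columns and rows, so
    that trunks are transferred by [trunk_extend].  The clauses on the sizes make the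
    iteration of prunings terminate. *)
Lemma prune_step : exists w' h' bot' top',
  [/\ valid w' h' bot' top', prune P = ppp_of w' h' bot' top', (w' + h' <= w + h)%N,
      (w' + h' = w + h)%N -> (forall x, kC x) /\ (forall y, kR y) &
      forall F F', parent_map bot top F -> parent_map bot' top' F' ->
      forall l k gam', trunk_along F' (zn w') l k gam' ->
      exists gam, trunk_along F (zn w) l k gam].
Proof.
have [e [[eI eE eim next] [V1 PP]]] := prune_structure.
exists w1, h1, (fun i => rho (bot (e i))), (fun i => rho (top (e i))).
have w1w : (w1 <= w)%N.
  by rewrite /w1 size_filter -[leqRHS](size_iota 0) count_size.
have h1h : (h1 <= h)%N by apply: zcount_le.
have w0 := valid_w V; have h0 := valid_h V.
split=> //; first by rewrite leq_add.
- move=> Ewh; have Ew : w1 = w by lia.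
  have Eh : h1 = h by lia.
  split=> [x|y].
    have allC i : (i < w)%N -> kC (zn i).
      have /allP H : all (fun x => `[< kC (zn x) >]) (iota 0 w).
        by rewrite all_count size_iota -size_filter -/xs -/w1 Ew.
      by move=> iw; apply/asboolP; apply: H; rewrite mem_iota.
    have := Z.div_mod x (zn w); have := Z.mod_pos_bound x (zn w) w0 => B E.
    have := allC (Z.to_nat (x mod zn w)); rewrite Z2Nat.id; last lia.
    rewrite /kC /kept_column => H.
    have Ex : x = x mod zn w + zn w * (x / zn w) by lia.
    have Ex1 : x + 1 = x mod zn w + 1 + zn w * (x / zn w) by lia.
    rewrite Ex1 [X in bot X < _]Ex !(equivariant_mul (valid_eqb V)).
    suff : bot (x mod zn w) < bot (x mod zn w + 1) by lia.
    by apply: H; lia.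
  have : zcount (fun y => ~ kR y) y h = 0%N.
    have : (zcount kR y h + zcount (fun y => ~ kR y) y h = h)%N.
      elim: (h) => [|n IH]; first by rewrite /zcount !big_ord0.
      by rewrite -[n.+1]addn1 !zcount_cat !zcount1 asbool_neg; case: asbool => /=; lia.
    by rewrite (zcount_shift (kept_row_per V) y 0) -/h1 Eh; lia.
  move/zcount_eq0 => /(_ 0); rewrite Z.add_0_r => H; apply: contrapT; apply: H; lia.
- move=> F F' pF pF' l k gam' T'.
  exists (fun j => e (gam' j)).
  apply: (trunk_extend eI eE _ _ T').
    move=> x; have Fx := pF (e x).
    have /eim [j Ej] : kC (F (e x)) by rewrite /kC /kept_column; lia.
    rewrite Ej; congr e; symmetry; apply: (parent_uniq (valid_bot V1) pF').
    rewrite Ej in Fx; rewrite next; split; first by apply: rank_of_top; lia.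
    by apply: rank_of_nondec; lia.
  by move=> x; apply/eim; have := pF x; rewrite /kC /kept_column; lia.
Qed.

Lemma prune_leafless : (forall x, kC x) -> (forall y, kR y) -> prune P = P.
Proof.
move=> aC aR; have w0 := valid_w V.
pose rk (y : nat) := count (fun y => ~~ leaf_row P (glued_row P y)) (iota 0 y).
have rkE y : rk y = y.
  rewrite /rk (eq_count (a2 := predT)) ?count_predT ?size_iota // => i.
  by rewrite (leaf_row_ppp_of V) negbK /=; apply/asboolP; apply: aR.
have -> : prune P = (let cs := normalize [seq (rk (column P x).1, rk (column P x).2)
    | x <- [seq x <- iota 0 (width P) | ~~ leaf_column P x]] in
    PPPData cs (nrows (PPPData cs 0) - rk (Defs.height P))%N) by [].
have -> : [seq x <- iota 0 (width P) | ~~ leaf_column P x] = iota 0 w.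
  rewrite /P width_ppp_of; apply/all_filterP/allP => x; rewrite mem_iota => xw.
  by rewrite (leaf_column_ppp_of V) ?negbK; [apply/asboolP; apply: aC | lia].
have -> : normalize [seq (rk (column P x).1, rk (column P x).2) | x <- iota 0 w] =
    mkseq (unrolled_column bot top) w.
  have -> : [seq (rk (column P x).1, rk (column P x).2) | x <- iota 0 w] =
      mkseq (unrolled_column bot top) w.
    apply/eq_in_map => x; rewrite mem_iota => xw.
    by rewrite /P column_ppp_of ?rkE; [case: (unrolled_column _ _ _) | lia].
  rewrite /normalize -nth0 nth_mkseq; last by lia.
  rewrite /unrolled_column /= Nat2Z.inj_0 Z.sub_diag -[RHS]map_id; apply: eq_map => -[a b] /=.
  by rewrite (_ : Z.to_nat 0 = 0%N) // !subn0.
rewrite /= rkE -/P; congr PPPData.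
have -> : nrows (PPPData (mkseq (unrolled_column bot top) w) 0) = nrows P by [].
have := glue_pos V; rewrite (height_ppp_of V) (nrows_ppp_of V) /=; lia.
Qed.

End Pruning.

Section Thickness.
Local Open Scope Z_scope.
Local Notation zn := Z.of_nat.
Local Arguments Z.of_nat : simpl never.
Local Arguments Z.to_nat : simpl never.
Local Arguments Z.sub : simpl never.
Local Arguments Z.add : simpl never.
Local Arguments Z.mul : simpl never.
Implicit Types bot top F : Z -> Z.

(** Equivariance with positive periods makes [f] unbounded in both directions. *)
Lemma level_crossing w h f c : 0 < w -> 0 < h -> nondec f -> equivariant w h f ->
  exists y, f y < c <= f (y + 1).
Proof.
move=> w0 h0 fn fe.
have [y0 Hy0] : exists y, f y < c.
  exists (0 + w * - (Z.abs (f 0) + Z.abs c + 1)); rewrite (equivariant_mul fe); nia.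
have [y1 Hy1] : exists y, c <= f y.
  exists (0 + w * (Z.abs (f 0) + Z.abs c + 1)); rewrite (equivariant_mul fe); nia.
have [n Hn] : exists n : nat, c <= f (y0 + zn n).
  exists (Z.to_nat (Z.abs (y1 - y0))); have := fn y1 (y0 + zn (Z.to_nat (Z.abs (y1 - y0)))); lia.
elim: n Hn => [|n IH] Hn; first by rewrite Nat2Z.inj_0 Z.add_0_r in Hn; lia.
case: (Z.le_gt_cases c (f (y0 + zn n))) => [/IH //|lt].
by exists (y0 + zn n); rewrite (_ : y0 + zn n + 1 = y0 + zn n.+1); lia.
Qed.

Lemma parent_exists w h bot top : valid w h bot top -> exists F, parent_map bot top F.
Proof.
move=> V.
have /choice [F HF] : forall x, exists y, bot y < top x <= bot (y + 1).
  move=> x; apply: (level_crossing _ (valid_w V) (valid_h V) (valid_bot V) (valid_eqb V)).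
by exists F.
Qed.

Lemma nondec_periodic_const w f : 0 < w -> nondec f -> (forall x, f (x + w) = f x) ->
  forall x, f x = f 0.
Proof.
move=> w0 fn fp x.
have fe : equivariant w 0 f by move=> y; rewrite fp; lia.
have B := equivariant_mul fe.
have lo : x + w * - (Z.abs x) <= 0 by nia.
have hi : 0 <= x + w * Z.abs x by nia.
have := fn _ _ lo; have := fn _ _ hi; rewrite !B; lia.
Qed.

(** Without leaves bottoms increase by at least one and tops by at most one, while
    both increase by [h] in [w] columns; so [w = h] and both are translations. *)
Lemma trunk_leafless w h bot top F : valid w h bot top -> parent_map bot top F ->
  (forall x, kept_column bot x) -> (forall y, kept_row top y) ->
  trunk_along F (zn w) (zn w) (zn (gluing (ppp_of w h bot top))) id.
Proof.
move=> V pF aC aR.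
have w0 := valid_w V; have h0 := valid_h V.
have bn : nondec (fun x => bot x - x).
  by apply: nondec_step => x; have := aC x; rewrite /kept_column; lia.
have tn : nondec (fun x => x - top x).
  apply: nondec_step => x.
  have [z Hz] := aR (top x).
  have := valid_top V (x := z) (y := x); have := valid_top V (x := x + 1) (y := z).
  have := valid_top V (x := x) (y := x + 1); lia.
have wh : zn w <= zn h.
  by have := bn 0 (zn w); rewrite (bot_w V); lia.
have hw : zn h <= zn w.
  by have := tn 0 (zn w); have := valid_eqt V 0; rewrite Z.add_0_l; lia.
have bc x : bot x = x + bot 0.
  have /= := nondec_periodic_const w0 bn ltac:(move=> y /=; rewrite (valid_eqb V); lia) x; lia.
have tc x : top x = x + top 0.
  have /= := nondec_periodic_const w0 tn ltac:(move=> y /=; rewrite (valid_eqt V); lia) x; lia.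
have g0 := glue_pos V.
have gE : zn (gluing (ppp_of w h bot top)) = top 0 - 1 - bot 0.
  by rewrite /= Z2Nat.id; [rewrite (tc (zn w - 1)); lia | lia].
split=> //.
- move=> j; rewrite gE; apply: (parent_uniq (valid_bot V) pF).
  rewrite (tc j) (bc (j + _)) (bc (j + _ + 1)); lia.
- by exists 0%N => x; exists x.
Qed.

(** By induction on the number of prunings.  The bound given by the semi-perimeter
    suffices, because a pruning that removes nothing leaves the PPP unchanged. *)
Theorem thickness_trunk w h bot top F : valid w h bot top -> parent_map bot top F ->
  exists l gam, trunk_along F (zn w) l
    (zn (intrinsic_thickness (ppp_of w h bot top))) gam.
Proof.
move=> V; rewrite /intrinsic_thickness /trunk (semi_perimeter_ppp_of V).
have := leqnn (w + h); move: {-1}(w + h)%N => m.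
elim: m w h bot top F V => [|m IH] w h bot top F V whm pF.
  by have := valid_w V; lia.
have [w' [h' [bot' [top' [V' PP lewh eqwh tr]]]]] := prune_step V.
have fix_case : (forall x, kept_column bot x) -> (forall y, kept_row top y) ->
    exists l gam, trunk_along F (zn w) l
      (zn (gluing (iter m.+1 prune (ppp_of w h bot top)))) gam.
  move=> aC aR; have Ei n : iter n prune (ppp_of w h bot top) = ppp_of w h bot top.
    by elim: n => //= n ->; apply: prune_leafless.
  by rewrite Ei; exists (zn w), id; apply: trunk_leafless.
case: (eqVneq (w' + h')%N (w + h)%N) => [/eqwh [aC aR]|ne]; first exact: fix_case.
have [F' pF'] := parent_exists V'.
have [|l [g' T']] := IH w' h' bot' top' F' V' _ pF'; first by lia.
rewrite iterSr PP; exists l; exact: (tr F F' pF pF' _ _ _ T').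
Qed.

End Thickness.

(** * From rooted pairs to strips *)

Section StripsOfMaps.
Local Open Scope Z_scope.
Local Notation zn := Z.of_nat.
Local Arguments Z.of_nat : simpl never.
Local Arguments Z.to_nat : simpl never.
Local Arguments Z.sub : simpl never.
Local Arguments Z.add : simpl never.
Local Arguments Z.mul : simpl never.
Implicit Types (S : parent_maps) (bot top F : Z -> Z).

Lemma ppp_of_translate w h bot top d :
  ppp_of w h (fun x => bot x - d) (fun x => top x - d) = ppp_of w h bot top.
Proof.
rewrite /ppp_of; congr PPPData; last by congr Z.to_nat; lia.
by apply: eq_map => i; rewrite /unrolled_column; congr (Z.to_nat _, Z.to_nat _); lia.
Qed.

Lemma iter_rotation_width w h bot top : valid w h bot top ->
  iter w rotation (ppp_of w h bot top) = ppp_of w h bot top.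
Proof.
move=> V; rewrite (iter_rotation _ V) -(ppp_of_translate w h bot top (- zn h)).
congr ppp_of; apply/funext => x; rewrite ?(valid_eqb V) ?(valid_eqt V); lia.
Qed.

Lemma strip_of_iter w h bot top j : valid w h bot top ->
  strip_of (iter j rotation (ppp_of w h bot top)) = strip_of (ppp_of w h bot top).
Proof.
move=> V; apply/seteqP; split=> Q [m ->]; first by exists (m + j)%N; rewrite iterD.
have per q : iter (q * w) rotation (ppp_of w h bot top) = ppp_of w h bot top.
  by elim: q => // q IH; rewrite mulSn iterD IH iter_rotation_width.
have w0 := valid_w V.
(* With [j * w - j] more rotations, the first [j] are completed to [j] full turns. *)
exists (m + (j * w - j))%N; rewrite -iterD -addnA subnK; last by apply: leq_pmulr; lia.
by rewrite iterD per.
Qed.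

Lemma strip_of_eq P Q : strip_of P = strip_of Q -> exists j, Q = iter j rotation P.
Proof.
move=> E; have : strip_of Q Q by exists 0%N.
by rewrite -E => -[j ->]; exists j.
Qed.

(** The lower adjoint of the second map: [x] is at most [S.2 y] exactly when
    [bot_of S x] is at most [y]. *)
Definition bot_of S (x : Z) : Z := xget 0 [set b | S.2 (b - 1) < x /\ x <= S.2 b]%classic.
Definition top_of S (x : Z) : Z := S.1 x + 1.

Section LowerAdjoint.
Variables (l k w h : Z) (S : parent_maps).
Hypothesis R : rooted l k w h S.

Lemma bot_of_prop x : S.2 (bot_of S x - 1) < x /\ x <= S.2 (bot_of S x).
Proof.
have [y Hy] := level_crossing x (rooted_h R) (rooted_w R) (rooted_ndR R) (rooted_eqR R).
have : [set b | S.2 (b - 1) < x /\ x <= S.2 b]%classic (y + 1).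
  by rewrite /= (_ : y + 1 - 1 = y); lia.
by move=> H; exact: (xgetPex 0 (ex_intro _ _ H)).
Qed.

Lemma bot_of_le x y : bot_of S x <= y <-> x <= S.2 y.
Proof.
have [b1 b2] := bot_of_prop x; split=> H.
  by have := rooted_ndR R H; lia.
by have := rooted_ndR R (x := y) (y := bot_of S x - 1); lia.
Qed.

Lemma bot_of_uniq b : (forall x y, b x <= y <-> x <= S.2 y) -> bot_of S = b.
Proof.
move=> H; apply/funext => x.
have := H x (bot_of S x); have := bot_of_le x (bot_of S x).
have := H x (b x); have := bot_of_le x (b x); lia.
Qed.

End LowerAdjoint.

Variables l k : nat.
Hypothesis k0 : (0 < k)%N.
Local Notation rooted := (rooted (zn l) (zn k)).

Section OneRooted.
Variables (w h : nat) (S : parent_maps).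
Hypothesis R : rooted (zn w) (zn h) S.

(** If [F x] were at most [x], all the iterates of [x] would be; but they reach the
    trunk, where [F] increases without bound because [k] is positive. *)
Lemma rooted_advance x : x < S.2 (S.1 x).
Proof.
have [g T g0] := rooted_trunk R; have [gI _ _ [N HN]] := T.
case: (Z.lt_ge_cases x (S.2 (S.1 x))) => // Fx; exfalso.
have dec m : iter m (fun x => S.2 (S.1 x)) x <= x.
  elim: m => [|m IH]; first exact: Z.le_refl.
  by rewrite iterS /=; have := rooted_ndR R (rooted_ndC R IH); lia.
have [j Hj] := HN x.
have g_lin (m : nat) : g j + zn m <= g (j + zn m).
  elim: m => [|m IH]; first by rewrite Nat2Z.inj_0 !Z.add_0_r; lia.
  have := gI (j + zn m) (j + zn m.+1); lia.
have := dec (Z.to_nat (Z.abs x + Z.abs (g j) + 1) + N)%N.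
rewrite iterD Hj (trunk_iter T).
have := g_lin (Z.to_nat (Z.abs x + Z.abs (g j) + 1)); set m := Z.to_nat _ => H1.
have := incr_nondec gI (x := j + zn m) (y := j + zn k * zn m); nia.
Qed.

Lemma valid_of_rooted : valid w h (bot_of S) (top_of S).
Proof.
split; rewrite /top_of.
- exact: rooted_w R.
- exact: rooted_h R.
- by move=> x y xy; apply/(bot_of_le R); have /(bot_of_le R) := Z.le_refl (bot_of S y); lia.
- by move=> x y /(rooted_ndC R); lia.
- by move=> x; have := rooted_advance x; have := bot_of_le R (x + 1) (S.1 x); lia.
- have E x : S.2 (x + zn h) = S.2 x + zn w by apply: (rooted_eqR R).
  move=> x; have := E (bot_of S x); have := bot_of_le R (x + zn w) (bot_of S x + zn h).
  have := E (bot_of S (x + zn w) - zn h); rewrite Z.sub_add.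
  have := bot_of_le R x (bot_of S (x + zn w) - zn h).
  have := bot_of_le R x (bot_of S x).
  have := bot_of_le R (x + zn w) (bot_of S (x + zn w)); lia.
- by move=> x; rewrite (rooted_eqC R); lia.
Qed.

Lemma parent_of_rooted : parent_map (bot_of S) (top_of S) (fun x => S.2 (S.1 x)).
Proof.
move=> x; rewrite /top_of.
have := bot_of_le R (S.2 (S.1 x)) (S.1 x).
have := bot_of_le R (S.2 (S.1 x) + 1) (S.1 x); lia.
Qed.

Definition ppp_of_maps := ppp_of w h (bot_of S) (top_of S).

Lemma thickness_of_rooted : intrinsic_thickness ppp_of_maps = k.
Proof.
have [l' [g' T']] := thickness_trunk valid_of_rooted parent_of_rooted.
have [g T _] := rooted_trunk R.
by have [_ /Nat2Z.inj ->] := trunk_unique (rooted_w R) T T'.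
Qed.

End OneRooted.

Lemma strip_of_rooted w h S : rooted (zn w) (zn h) S ->
  strips k (w + h) (strip_of (ppp_of_maps w h S)).
Proof.
move=> R; have V := valid_of_rooted R.
exists (ppp_of_maps w h S) => //; split.
- exact: ppp_of_is_ppp V.
- exact: semi_perimeter_ppp_of V.
- exact: thickness_of_rooted R.
Qed.

Lemma bot_of_reroot w h S d : rooted (zn w) (zn h) S ->
  rooted (zn w) (zn h) (reroot S d) ->
  bot_of (reroot S d) = (fun x => bot_of S (x + d) - S.1 d).
Proof.
move=> R R'; apply: (bot_of_uniq R') => x y /=.
have := bot_of_le R (x + d) (y + S.1 d); lia.
Qed.

Lemma strip_of_reroot w h S (d : nat) : rooted (zn w) (zn h) S ->
  rooted (zn w) (zn h) (reroot S (zn d)) ->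
  strip_of (ppp_of_maps w h (reroot S (zn d))) = strip_of (ppp_of_maps w h S).
Proof.
move=> R R'; have V := valid_of_rooted R.
rewrite -(strip_of_iter d V) (iter_rotation _ V) /ppp_of_maps (bot_of_reroot R R').
congr strip_of; rewrite -[RHS](ppp_of_translate _ _ _ _ (S.1 (zn d))).
by congr ppp_of; apply/funext => x; rewrite /top_of /=; lia.
Qed.

End StripsOfMaps.

Section StripRoots.
Local Open Scope Z_scope.
Local Notation zn := Z.of_nat.
Local Arguments Z.of_nat : simpl never.
Local Arguments Z.sub : simpl never.
Local Arguments Z.add : simpl never.
Local Arguments Z.mul : simpl never.

(** Two PPP's of the same strip differ by a shift of columns; the shift carries one
    root to the other, so the pairs differ by a change of root, and uniqueness of the
    trunk gives the same [l]. *)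
Lemma strip_of_rooted_eq l l' k w h w' h' S S' : (0 < k)%N ->
  rooted (zn l) (zn k) (zn w) (zn h) S -> rooted (zn l') (zn k) (zn w') (zn h') S' ->
  strip_of (ppp_of_maps w h S) = strip_of (ppp_of_maps w' h' S') ->
  [/\ l = l', w = w', h = h' & exists j, S' = reroot S j].
Proof.
move=> k0 R R' /strip_of_eq [j].
have V := valid_of_rooted k0 R; have V' := valid_of_rooted k0 R'.
rewrite (iter_rotation _ V) => E.
have [ww hh Eb Et] := ppp_of_inj V' (valid_shift V (zn j)) E.
rewrite Z.add_0_l in Eb Et; rewrite /top_of in Et.
have E0 := Et 0; rewrite (rooted_0 R') !Z.add_0_l in E0.
subst w' h'.
suff ES : S' = reroot S (zn j).
  split=> //; last by exists (zn j).
  have [g T _] := rooted_trunk R; have [g' T' _] := rooted_trunk R'.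
  have := trunk_shift (zn j) T; rewrite (_ : (fun x => _) = (fun x => S'.2 (S'.1 x))).
    by move=> T2; have [/Nat2Z.inj] := trunk_unique (rooted_w R) T2 T'.
  by apply/funext => x; rewrite ES reroot_conj.
rewrite [LHS]surjective_pairing; congr pair; apply/funext => x /=.
  have := Et x; lia.
have bb z : bot_of S' z = bot_of S (z + zn j) - S.1 (zn j) by have := Eb z; lia.
have eqv z : z <= S'.2 x <-> z <= S.2 (x + S.1 (zn j)) - zn j.
  by rewrite -(bot_of_le R') bb; have := bot_of_le R (z + zn j) (x + S.1 (zn j)); lia.
have := eqv (S'.2 x); have := eqv (S.2 (x + S.1 (zn j)) - zn j); lia.
Qed.

(** Shift the unrolled PPP to put a trunk column in position 0 and its top cell in
    row 0. *)
Lemma strip_has_root k n c : (0 < k)%N -> strips k n c ->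
  exists l w h S, [/\ (0 < l)%N, (w + h = n)%N, rooted (zn l) (zn k) (zn w) (zn h) S &
    c = strip_of (ppp_of_maps w h S)].
Proof.
move=> k0 [P [/is_ppp_unrolled [w [h [bot [top [V ->]]]]] sp it] <-].
rewrite (semi_perimeter_ppp_of V) in sp.
have [F pF] := parent_exists V.
have [lz [g T]] := thickness_trunk V pF; rewrite it in T.
have [gI gE gF [N HN]] := T.
have w0 := valid_w V; have h0 := valid_h V.
have l0 : 0 < lz.
  by apply: (incr_lt gI); have := gE 0; rewrite Z.add_0_l; lia.
have [l El] : exists l, lz = zn l by exists (Z.to_nat lz); lia.
subst lz.
(* That many places further in the trunk the column is nonnegative, hence within
   reach of forward rotations. *)
pose j0 := zn l * Z.abs (g 0).
have c0 : 0 <= g j0.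
  by have := equivariant_mul gE (Z.abs (g 0)) 0; rewrite Z.add_0_l -/j0; nia.
have [d Ed] : exists d, g j0 = zn d by exists (Z.to_nat (g j0)); lia.
have /choice [beta Hb] : forall y, exists x, bot x < y + 1 <= bot (x + 1).
  by move=> y; apply: (level_crossing _ w0 h0 (valid_bot V) (valid_eqb V)).
have adj x y : bot x <= y <-> x <= beta y.
  have := Hb y; have := valid_bot V (x := x) (y := beta y).
  have := valid_bot V (x := beta y + 1) (y := x); lia.
have Fb x : beta (top x - 1) = F x.
  by symmetry; apply: (parent_uniq (valid_bot V) pF); have := Hb (top x - 1); rewrite Z.sub_add.
pose S : parent_maps := (fun x => top (x + zn d) - top (zn d),
                  fun y => beta (y + (top (zn d) - 1)) - zn d).
have conj x : S.2 (S.1 x) = F (x + zn d) - zn d.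
  rewrite /= -Fb; congr (beta _ - _); lia.
have R : rooted (zn l) (zn k) (zn w) (zn h) S.
  split=> //=.
  - by move=> x y xy; have := valid_top V (x := x + zn d) (y := y + zn d); lia.
  - move=> x y xy; set tx := x + _; set ty := y + _.
    by have /adj := Z.le_refl (beta tx); have := adj (beta tx) ty; have := adj (beta tx) tx; lia.
  - by move=> x; rewrite (_ : x + zn w + zn d = x + zn d + zn w) ?(valid_eqt V); lia.
  - move=> y; rewrite (_ : y + zn h + _ = y + (top (zn d) - 1) + zn h); last lia.
    set z := y + _; have E x : bot (x + zn w) = bot x + zn h := valid_eqb V x.
    have := adj (beta (z + zn h) - zn w) z; have := E (beta (z + zn h) - zn w).
    rewrite Z.sub_add; have := adj (beta (z + zn h)) (z + zn h).
    have := adj (beta z + zn w) (z + zn h); have := E (beta z); have := adj (beta z) z; lia.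
  - by rewrite Z.add_0_l Z.sub_diag.
  - exists (fun j => g (j + j0) - zn d); last by rewrite Z.add_0_l Ed Z.sub_diag.
    have cF : (fun x => S.2 (S.1 x)) = (fun x => F (x + zn d) - zn d) by apply/funext.
    by have := trunk_shift (zn d) (trunk_reindex j0 T); rewrite -cF.
exists l, w, h, S; split=> //; first by lia.
rewrite -(strip_of_iter d V) (iter_rotation _ V) /ppp_of_maps.
have -> : bot_of S = (fun x => bot (x + zn d) - (top (zn d) - 1)).
  apply: (bot_of_uniq R) => x y /=.
  have := adj (x + zn d) (y + (top (zn d) - 1)); lia.
congr strip_of; rewrite -[LHS](ppp_of_translate _ _ _ _ (top (zn d) - 1)).
by congr ppp_of; apply/funext => x; rewrite /top_of /S /=; lia.
Qed.

End StripRoots.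

(** * The number of strips *)

Section Fibers.
Variables (T U : eqType) (f : T -> U) (L : seq T).

Let C := undup (map f L).

Lemma sum_fibers (a : pred T) :
  \sum_(c <- C) count (fun q => a q && (f q == c)) L = count a L.
Proof.
under eq_bigr => c _ do rewrite -sum1_count big_mkcond /=.
rewrite exchange_big -sum1_count [in RHS]big_mkcond /=.
apply: eq_big_seq => q qL; case: (a q) => /=; last by rewrite big1.
rewrite -big_mkcond /= sum1_count (eq_count (a2 := pred1 (f q))).
  by rewrite count_uniq_mem ?undup_uniq // mem_undup map_f.
by move=> c /=; rewrite eq_sym.
Qed.

Lemma size_le_fibers m : (forall p, p \in L -> count (fun q => f q == f p) L <= m) ->
  size L <= m * size C.
Proof.
move=> H; rewrite -(count_predT L) -sum_fibers -[size C]sum1_size.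
rewrite big_distrr /= big_seq [leqRHS]big_seq; apply: leq_sum => c.
by rewrite mem_undup => /mapP [p pL ->]; rewrite muln1; apply: H.
Qed.

(** A fiber with fewer than [m] elements consists of exceptional points; it is paid
    for by one of them. *)
Lemma fibers_le_size m (a : pred T) :
  (forall p, p \in L -> ~~ a p -> m <= count (fun q => f q == f p) L) ->
  m * size C <= size L + m * count a L.
Proof.
move=> H; rewrite -(count_predT L) -!sum_fibers -[size C]sum1_size !big_distrr /= -big_split /=.
rewrite big_seq [leqRHS]big_seq; apply: leq_sum => c; rewrite muln1 mem_undup => /mapP [p pL ->].
case: (boolP (a p)) => [ap|nap].
  apply: leq_trans (leq_addl _ _); apply: leq_pmulr.
  by rewrite -has_count; apply/hasP; exists p => //; rewrite ap eqxx.
by apply: leq_trans (leq_addr _ _); apply: H.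
Qed.

End Fibers.

Lemma count_union (T : eqType) (m : nat) (a : pred T) (b : 'I_m -> 'I_m -> pred T) (s : seq T) :
  (forall x, x \in s -> a x -> exists i j, b i j x) ->
  count a s <= \sum_(i < m) \sum_(j < m) count (b i j) s.
Proof.
elim: s => [|x s IH] H //=.
under eq_bigr do rewrite big_split /=.
rewrite big_split /=; apply: leq_add; last first.
  by apply: IH => y ys; apply: H; rewrite inE ys orbT.
case ax : (a x) => //; have [i [j bij]] := H x (mem_head _ _) ax.
by rewrite (bigD1 i) //= (bigD1 j) //= bij.
Qed.

Section StripCount.
Local Notation zn := Z.of_nat.
Local Arguments Z.of_nat : simpl never.
Variables k n : nat.
Hypothesis k0 : 0 < k.

Definition rooted_pairs (l : nat) : seq (nat * parent_maps) :=
  [seq (w, T) | w <- iota 0 n.+1, T <- rooted_list (zn l) (zn k) w (n - w)].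

Definition strip_of_pair (p : nat * parent_maps) : set ppp_data :=
  strip_of (ppp_of_maps p.1 (n - p.1) p.2).

Lemma rooted_pairsP l (p : nat * parent_maps) : 0 < l -> p \in rooted_pairs l <->
  rooted (zn l) (zn k) (zn p.1) (zn (n - p.1)) p.2.
Proof.
move=> l0; have lz : Z.lt 0 (zn l) by lia.
have kz : Z.le 0 (zn k) by lia.
split=> [/allpairsPdep [w [T [_ HT ->]]]|R]; first by apply/(mem_rooted_list lz kz).
apply/allpairsPdep; exists p.1, p.2; split; last by case: (p).
  by rewrite mem_iota; have := rooted_h R; lia.
by apply/(mem_rooted_list lz kz).
Qed.

Lemma rooted_pairs_uniq l : uniq (rooted_pairs l).
Proof.
apply: allpairs_uniq_dep; rewrite ?iota_uniq //; first by move=> *; apply: rooted_list_uniq.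
by move=> [a b] [c d] _ _ [-> ->].
Qed.

Lemma size_rooted_pairs l : size (rooted_pairs l) = rooted_number l k n.
Proof.
rewrite size_allpairs_dep sumnE big_map /rooted_number /leaf_sum.
have -> : iota 0 n.+1 = index_iota 0 n.+1 by rewrite /index_iota subn0.
by rewrite big_mkord; apply: eq_bigr => w _; rewrite sum1_size.
Qed.

Definition has_symmetry (p : nat * parent_maps) : bool :=
  `[< exists2 d, Z.lt 0 d /\ Z.lt d (zn p.1) & reroot p.2 d = p.2 >].

(** The other rooted pairs of a strip are obtained by moving the root to one of the
    [l] trunk columns of a period; two of these coincide only under a symmetry. *)
Lemma strip_fiber l (p : nat * parent_maps) : 0 < l -> p \in rooted_pairs l ->
  count (fun q => strip_of_pair q == strip_of_pair p) (rooted_pairs l) <= l /\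
  (~~ has_symmetry p ->
   l <= count (fun q => strip_of_pair q == strip_of_pair p) (rooted_pairs l)).
Proof.
move=> l0 /(rooted_pairsP _ l0) R; have [g T g0] := rooted_trunk R.
have [gI gE _ _] := T.
rewrite -size_filter; split.
  rewrite -[leqRHS](size_iota 0) -(size_map (fun i => (p.1, reroot p.2 (g (zn i))))).
  apply: uniq_leq_size; first by rewrite filter_uniq ?rooted_pairs_uniq.
  move=> q; rewrite mem_filter => /andP [/eqP E /(rooted_pairsP _ l0) R'].
  have [_ ww hh [j Ej]] := strip_of_rooted_eq k0 R R' (esym E).
  rewrite -ww in R'; rewrite Ej in R'.
  have [i il Hi] := reroot_fundamental (ltac:(lia) : Z.lt 0 (zn l)) R T R'.
  apply/mapP; exists (Z.to_nat i); first by rewrite mem_iota; lia.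
  rewrite Z2Nat.id; last by case: il.
  by rewrite -Hi -Ej ww; case: (q).
move=> ns; rewrite -[leqLHS](size_iota 0) -(size_map (fun i => (p.1, reroot p.2 (g (zn i))))).
apply: uniq_leq_size.
  rewrite map_inj_in_uniq ?iota_uniq //.
  suff key i i' : i < i' -> i' < l -> reroot p.2 (g (zn i)) <> reroot p.2 (g (zn i')).
    move=> i i'; rewrite !mem_iota => Hi Hi' /(congr1 snd) /= E.
    by case: (ltngtP i i') => // ii; [case: (key _ _ ii _ E) | case: (key _ _ ii _ (esym E))]; lia.
  move=> ii i'l E; case/negP: ns; apply/asboolP.
  exists (Z.sub (g (zn i')) (g (zn i))).
    have H1 := gI (zn i) (zn i'); have H2 := gI (zn i') (Z.add (zn i) (zn l)).
    by rewrite gE in H2; lia.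
  have := congr1 (fun S => reroot S (Z.opp (g (zn i)))) E.
  by rewrite !(reroot_add _ _ R) Z.add_opp_diag_r (reroot0 R) => {2}->.
move=> q /mapP [i _ ->]; rewrite mem_filter.
have R' := rooted_reroot (zn i) R T.
apply/andP; split; last by apply/(rooted_pairsP _ l0).
have gi : exists d, g (zn i) = zn d.
  exists (Z.to_nat (g (zn i))); have := incr_nondec gI (x := Z0) (y := zn i); lia.
have [d Hd] := gi; rewrite Hd in R' *.
by apply/eqP; apply: (strip_of_reroot k0 R R').
Qed.

Definition strip_list : seq (set ppp_data) :=
  [seq c | l <- iota 1 n, c <- undup (map strip_of_pair (rooted_pairs l))].

Lemma strip_list_uniq : uniq strip_list.
Proof.
apply: allpairs_uniq_dep; rewrite ?iota_uniq //; first by move=> *; apply: undup_uniq.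
move=> [l c] [l' c'] /allpairsPdep [l1 [c1 [Hl Hc E1]]] /allpairsPdep [l2 [c2 [Hl' Hc' E2]]] /=.
case: E1 => ? ?; case: E2 => ? ?; subst l1 c1 l2 c2.
move: Hc Hc'; rewrite !mem_undup => /mapP [p Hp Ec] /mapP [p' Hp' Ec'] E.
rewrite !mem_iota in Hl Hl'.
have l0 : 0 < l by lia.
have l0' : 0 < l' by lia.
have R := (rooted_pairsP p l0).1 Hp; have R' := (rooted_pairsP p' l0').1 Hp'.
have [ll _ _ _] := strip_of_rooted_eq k0 R R' (etrans (esym Ec) (etrans E Ec')).
by rewrite E ll.
Qed.

Lemma mem_strip_list c : c \in strip_list <-> strips k n c.
Proof.
split=> [/allpairsPdep [l [c' [Hl Hc ->]]]|/(strip_has_root k0)].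
  rewrite mem_iota in Hl; have l0 : 0 < l by lia.
  move: Hc; rewrite mem_undup => /mapP [p /(rooted_pairsP _ l0) R ->].
  have := strip_of_rooted k0 R; rewrite subnKC //; have := rooted_h R; lia.
move=> [l [w [h [S [l0 wh R ->]]]]].
have Eh : h = n - w by lia.
rewrite Eh in R *.
apply/allpairsPdep; exists l, (strip_of_pair (w, S)); split=> //.
  rewrite mem_iota; have [g [gI gE _ _] g0] := rooted_trunk R.
  suff : Z.le (zn l) (zn w) by have := rooted_h R; lia.
  have := gE Z0; rewrite g0 => gw.
  suff H m : Z.le (zn m) (g (zn m)) by have := H l; rewrite -[zn l]Z.add_0_l gw; lia.
  elim: m => [|m IH]; first by rewrite g0; lia.
  have := gI (zn m) (zn m.+1); lia.
by rewrite mem_undup; apply: map_f; apply/(rooted_pairsP _ l0).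
Qed.

Lemma strip_coefE :
  strip_coef k n = \sum_(1 <= l < n.+1) size (undup (map strip_of_pair (rooted_pairs l))).
Proof.
have fin : finite_set (strips k n).
  apply: (@sub_finite_set _ _ [set` strip_list]); last exact: finite_seq.
  by move=> c /mem_strip_list.
rewrite /strip_coef.
have -> : #|` fset_set (strips k n)|%fset = size strip_list.
  apply: perm_size; apply: uniq_perm; rewrite ?fset_uniq ?strip_list_uniq // => c.
  have := in_fset_set fin c => E.
  rewrite [LHS]E; apply/idP/idP; first by move/set_mem/mem_strip_list.
  by move/mem_strip_list/mem_set.
rewrite size_allpairs_dep sumnE big_map; congr bigop.
by rewrite /index_iota subSS subn0.
Qed.

(** A symmetry by [(d, b)] has the same slope as [(w, h)].  Either it or its
    complement [(w - d, h - b)] is at most half of [(w, h)]. *)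
Lemma symmetry_period l w h S d : rooted l (zn k) (zn w) (zn h) S ->
  Z.lt 0 d -> Z.lt d (zn w) -> reroot S d = S ->
  exists a b : nat, [/\ 0 < a, 0 < b, 2 * (a + b) <= w + h,
    equivariant (zn a) (zn b) S.1 & equivariant (zn b) (zn a) S.2].
Proof.
move=> R d0 dw E; have w0 := rooted_w R; have h0 := rooted_h R.
pose b := S.1 d.
have e1 : equivariant d b S.1.
  move=> x; have := congr1 (fun T : parent_maps => T.1 x) E; rewrite /= /b; lia.
have e2 : equivariant b d S.2.
  move=> y; have := congr1 (fun T : parent_maps => T.2 y) E; rewrite /= /b; lia.
have slope : Z.mul b (zn w) = Z.mul (zn h) d.
  have := equivariant_mul e1 (zn w) Z0; have := equivariant_mul (rooted_eqC R) d Z0.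
  by rewrite Z.mul_comm => ->; lia.
have b0 : Z.lt 0 b by nia.
have bh : Z.lt b (zn h) by nia.
have N p q f : equivariant p q f -> equivariant (Z.sub 0 p) (Z.sub 0 q) f.
  by move=> e x; have := e (Z.add x (Z.sub 0 p)); rewrite (_ : Z.add (Z.add _ _) p = x); lia.
have D p q p' q' f : equivariant p q f -> equivariant p' q' f ->
    equivariant (Z.add p p') (Z.add q q') f.
  by move=> e e' x; rewrite Z.add_assoc e' e; lia.
case: (Z.le_gt_cases (Z.add d d) (zn w)) => dd.
  exists (Z.to_nat d), (Z.to_nat b); rewrite !Z2Nat.id; try lia.
  have : Z.le (Z.add b b) (zn h) by nia.
  by move=> bb; split=> //; lia.
exists (Z.to_nat (Z.sub (zn w) d)), (Z.to_nat (Z.sub (zn h) b)); rewrite !Z2Nat.id; try lia.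
have : Z.le (zn h) (Z.add b b) by nia.
move=> bb; split; try lia.
  exact: D (rooted_eqC R) (N _ _ _ e1).
exact: D (rooted_eqR R) (N _ _ _ e2).
Qed.

Lemma periodic_count l w (a b : nat) : 0 < l -> w <= n -> 0 < a -> 2 * (a + b) <= n ->
  count (fun S : parent_maps => `[< equivariant (zn a) (zn b) S.1 /\ equivariant (zn b) (zn a)
    S.2 >])
    (rooted_list (zn l) (zn k) w (n - w)) <= (k * n).+1 * 2 ^ n.
Proof.
move=> l0 wn a0 abn; have lz : Z.lt 0 (zn l) by lia.
have kz : Z.le 0 (zn k) by lia.
set s := rooted_list _ _ _ _; set q := (fun _ => _).
have -> : count q s = size (map (period_code (k * n) (a + b)) [seq T <- s | q T]).
  by rewrite size_map size_filter.
have U : uniq (map (period_code (k * n) (a + b)) [seq T <- s | q T]).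
  rewrite map_inj_in_uniq ?filter_uniq ?rooted_list_uniq // => S S'.
  rewrite !mem_filter => /andP [/asboolP [e1 e2] /(mem_rooted_list lz kz) R].
  move=> /andP [/asboolP [e1' e2'] /(mem_rooted_list lz kz) R'].
  have B : Z.le (Z.mul (zn k) (zn w)) (zn (k * n)) by nia.
  by apply: (period_code_inj lz kz _ _ B B R R' e1 e2 e1' e2'); lia.
apply: leq_trans (_ : _ <= #|{: 'I_(k * n).+1 * {set 'I_(a + b)} * {set 'I_(a + b)}}|) _.
  by rewrite -(card_uniqP U) max_card.
have cs : #|{: {set 'I_(a + b)}}| = 2 ^ (a + b).
  by rewrite -cardsT -powersetT card_powerset cardsT card_ord.
rewrite !card_prod card_ord cs -mulnA -expnD leq_mul2l leq_pexp2l ?orbT //; lia.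
Qed.

(** The three factors [n + 1] are for [w] and for the short period [(a, b)]. *)
Lemma symmetry_bound l : 0 < l -> count has_symmetry (rooted_pairs l) <=
  n.+1 ^ 3 * ((k * n).+1 * 2 ^ n).
Proof.
move=> l0; have lz : Z.lt 0 (zn l) by lia.
have kz : Z.le 0 (zn k) by lia.
rewrite /rooted_pairs count_flatten -map_comp sumnE big_map.
have -> : iota 0 n.+1 = index_iota 0 n.+1 by rewrite /index_iota subn0.
rewrite big_mkord.
pose K := (k * n).+1 * 2 ^ n.
have sumK (F : 'I_n.+1 -> nat) c : (forall i, F i <= c) -> \sum_(i < n.+1) F i <= n.+1 * c.
  move=> HF; rewrite -[X in _ <= X * _](card_ord n.+1) -sum_nat_const.
  by apply: leq_sum => i _.
rewrite !expnS expn0 muln1 -!mulnA -/K; apply: (sumK) => w.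
rewrite /= count_map.
pose q (a b : 'I_n.+1) : pred parent_maps := fun S =>
  [&& 0 < a, 2 * (a + b) <= n & `[< equivariant (zn a) (zn b) S.1 /\ equivariant (zn b) (zn a)
    S.2 >]].
have wn : w <= n by rewrite -ltnS.
apply: leq_trans (_ : _ <= \sum_(a < n.+1) \sum_(b < n.+1) count (q a b) (rooted_list (zn l) (zn
  k) w (n - w))) _.
  apply: count_union => S /(mem_rooted_list lz kz) R /asboolP [d [d0 dw] E].
  have [a [b [a0 b0 ab e1 e2]]] := symmetry_period R d0 dw E.
  have an : a < n.+1 by lia.
  have bn : b < n.+1 by lia.
  exists (Ordinal an), (Ordinal bn); rewrite /q /= a0 /=; apply/andP; split; first by lia.
  by apply/asboolP; split.
apply: (sumK) => a; apply: (sumK) => b.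
case: (boolP ((0 < a) && (2 * (a + b) <= n))) => [/andP [a0 abn]|no].
  rewrite (eq_count (a2 := fun S : parent_maps =>
    `[< equivariant (zn a) (zn b) S.1 /\ equivariant (zn b) (zn a) S.2 >])).
    exact: periodic_count.
  by move=> S; rewrite /q a0 abn.
rewrite (eq_count (a2 := pred0)) ?count_pred0 // => S; rewrite /q andbA.
by rewrite (negbTE no).
Qed.

(** [r l] is the number of strips with [l] trunk columns. *)
Theorem strip_coef_bounds : exists r : nat -> nat,
  [/\ forall l, 0 < l -> rooted_number l k n <= l * r l,
      forall l, 0 < l -> l * r l <= rooted_number l k n + l * (n.+1 ^ 3 * ((k * n).+1 * 2 ^ n)) &
      strip_coef k n = \sum_(1 <= l < n.+1) r l].
Proof.
exists (fun l => size (undup (map strip_of_pair (rooted_pairs l)))); split.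
- move=> l l0; rewrite -size_rooted_pairs; apply: size_le_fibers => p Hp.
  by have [] := strip_fiber l0 Hp.
- move=> l l0; rewrite -size_rooted_pairs.
  apply: leq_trans (_ : _ <= size (rooted_pairs l) + l * count has_symmetry (rooted_pairs l)) _.
    by apply: fibers_le_size => p Hp; have [_] := strip_fiber l0 Hp.
  by rewrite leq_add2l leq_mul2l symmetry_bound ?orbT.
- exact: strip_coefE.
Qed.

End StripCount.

(** * Binomial sums and asymptotics *)

Section BinomialSums.
Local Open Scope nat_scope.

Definition every_other (M m : nat) : nat :=
  \sum_(1 <= l < m.+1) (if l + l <= m then 'C(M, m - (l + l)) else 0).

Lemma every_otherS M m : every_other M m.+2 = 'C(M, m) + every_other M m.
Proof.
rewrite /every_other big_nat_recl //; congr (_ + _); first by rewrite /= !subSS subn0.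
rewrite [LHS]big_nat_recr // [LHS]/=.
have -> : (m.+2 + m.+2 <= m.+2) = false by lia.
rewrite addn0.
by apply: eq_bigr => l _; rewrite addSn addnS !ltnS !subSS.
Qed.

(** Pascal's rule replaces every other coefficient of a row by consecutive
    coefficients of the preceding row. *)
Lemma every_other_sum M m : every_other M.+1 m.+1 = \sum_(j < m) 'C(M, j).
Proof.
suff : every_other M.+1 m.+1 = \sum_(j < m) 'C(M, j) /\
       every_other M.+1 m.+2 = \sum_(j < m.+1) 'C(M, j) by case.
elim: m => [|m [IH1 IH2]].
  split; first by rewrite /every_other big_nat1 /= big_ord0.
  by rewrite every_otherS big_ord1 /every_other big_geq // !bin0.
split=> //; rewrite every_otherS IH1 !big_ord_recr /= binS; lia.
Qed.

Lemma half_row n : 0 < n -> 2 * \sum_(j < n) 'C((2 * n).-1, j) = 2 ^ (2 * n).-1.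
Proof.
move=> n0; set N := (2 * n).-1.
have E : N.+1 = n + n by rewrite /N; lia.
have -> : 2 ^ N = \sum_(j < n + n) 'C(N, j).
  rewrite -E -[2]/(1 + 1) expnDn; apply: eq_bigr => j _.
  by rewrite !exp1n !muln1.
rewrite big_split_ord /= mul2n -addnn; congr (_ + _).
rewrite (reindex_inj rev_ord_inj) /=; apply: eq_bigr => j _.
rewrite -bin_sub; last by rewrite /N; have := ltn_ord j; lia.
by congr ('C(_, _)); rewrite /N; have := ltn_ord j; lia.
Qed.

(** By induction, since [(2n + 1)(2n + 3)] is at most [4 (n + 1)^2]. *)
Lemma central_bin_bound n : 'C(2 * n, n) ^ 2 * (2 * n).+1 <= 16 ^ n.
Proof.
elim: n => [|n IH] //.
have E : n.+1 * 'C(2 * n.+1, n.+1) = 2 * (2 * n).+1 * 'C(2 * n, n).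
  have E1 := mul_bin_diag (2 * n.+1) n.
  have E2 : (2 * n.+1).-1 = (2 * n).+1 by lia.
  rewrite E2 in E1.
  have E3 := mul_bin_diag (2 * n).+1 n.
  have E4 : 'C((2 * n).+1, n.+1) = 'C((2 * n).+1, n).
    rewrite -[RHS]bin_sub; last by lia.
    by congr ('C(_, _)); lia.
  rewrite E4 /= in E3; nia.
have K : 0 < n.+1 ^ 2 by rewrite expn_gt0.
rewrite -(leq_pmul2l K).
have -> : n.+1 ^ 2 * ('C(2 * n.+1, n.+1) ^ 2 * (2 * n.+1).+1) =
   (n.+1 * 'C(2 * n.+1, n.+1)) ^ 2 * (2 * n.+1).+1 by rewrite expnMn mulnA.
rewrite E (expnS 16).
apply: (@leq_trans ((2 ^ 2 * (2 * n).+1 * (2 * n.+1).+1) * ('C(2 * n, n) ^ 2 * (2 * n).+1))).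
  by apply: eq_leq; rewrite !expnMn !expnS !expn0; lia.
apply: (@leq_trans ((2 ^ 2 * (2 * n).+1 * (2 * n.+1).+1) * 16 ^ n)).
  by rewrite leq_mul2l IH orbT.
by rewrite mulnA leq_mul2r; apply/orP; right; rewrite !expnS !expn0; nia.
Qed.

(** [n + 1] is at most [p (q + 1)], hence at most [p 2^q], with [q = n / p]. *)
Lemma poly_le_exp p n : 0 < p -> n.+1 ^ p <= p ^ p * 2 ^ n.
Proof.
move=> p0; have E := divn_eq n p; have R := ltn_mod n p; rewrite p0 in R.
have H : n.+1 <= p * 2 ^ (n %/ p).
  apply: (@leq_trans (p * (n %/ p).+1)); first by nia.
  by rewrite leq_mul2l ltn_expl ?orbT.
apply: leq_trans (_ : _ <= (p * 2 ^ (n %/ p)) ^ p) _; first by rewrite leq_exp2r.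
rewrite expnMn -expnM leq_mul2l leq_pexp2l ?orbT //; lia.
Qed.

End BinomialSums.

Section Asymptotics.
Local Open Scope nat_scope.

Lemma every_other_central n : 0 < n ->
  4 * every_other (2 * n) n + 2 * 'C(2 * n, n) = 4 ^ n.
Proof.
case: n => // n _; have H := half_row (ltn0Sn n).
have E : 2 * n.+1 = (2 * n).+2 by lia.
move: H; rewrite E /= => H.
rewrite every_other_sum big_ord_recr /= in H *.
have -> : 4 ^ n.+1 = 2 * 2 ^ (2 * n).+1 by rewrite -[4]/(2 ^ 2) -expnM -expnS; congr (2 ^ _); lia.
have S : 'C((2 * n).+1, n.+1) = 'C((2 * n).+1, n).
  rewrite -[RHS]bin_sub; last by lia.
  by congr ('C(_, _)); lia.
by rewrite binS S; lia.
Qed.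

Lemma strip_coef_estimate k n : 0 < k -> 0 < n ->
  4 ^ n <= 2 * n * strip_coef k n + 2 * 'C(2 * n, n) /\
  2 * n * strip_coef k n <= 4 ^ n + 2 * n ^ 2 * (n.+1 ^ 3 * ((k * n).+1 * 2 ^ n)).
Proof.
move=> k0 n0; have [r [H1 H2 ->]] := strip_coef_bounds n k0.
set K := _ * (_ * 2 ^ n) in H2 *; rewrite -(every_other_central n0).
set T := fun l => if l + l <= n then 'C(2 * n, n - (l + l)) else 0.
have num l : 0 < l -> n * rooted_number l k n = (l + l) * T l.
  move=> l0; rewrite /T; case: leqP => ln; first exact: rooted_number_closed.
  by rewrite rooted_number_small ?muln0.
have B l : 0 < l -> 2 * T l <= n * r l /\ n * r l <= 2 * T l + n * K.
  move=> l0; have := H1 l l0; have := H2 l l0; have := num l l0.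
  move: (rooted_number l k n) (T l) (r l) => A t x E h2 h1.
  split; rewrite -(leq_pmul2l l0).
    by apply: (@leq_trans (n * A)); [rewrite E; lia | nia].
  by apply: (@leq_trans (n * (A + l * K))); [nia | rewrite mulnDr E; lia].
have lo : 2 * every_other (2 * n) n <= n * \sum_(1 <= l < n.+1) r l.
  rewrite /every_other !big_distrr /= big_nat [leqRHS]big_nat; apply: leq_sum => l /andP [l0 _].
  by have [] := B l l0.
have hi : n * (\sum_(1 <= l < n.+1) r l) <= 2 * every_other (2 * n) n + n * (n * K).
  have -> : n * (n * K) = \sum_(1 <= l < n.+1) n * K by rewrite sum_nat_const_nat subn1.
  rewrite /every_other !big_distrr -big_split /= big_nat [leqRHS]big_nat.
  by apply: leq_sum => l /andP [l0 _]; have [] := B l l0.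
split; first by lia.
by rewrite expnS expn1; move: lo hi; set s := \sum_(_ <= _ < _) _; nia.
Qed.

Local Open Scope ring_scope.

(** [ln n = 2 ln (sqrt n)] and [ln x] is at most [x]. *)
Lemma ln_le_sqrt (R : realType) (n : nat) : (0 < n)%N ->
  (ln (n%:R : R)) ^+ 2 <= 4 * n%:R.
Proof.
move=> n0; have nR : 0 < (n%:R : R) by rewrite ltr0n.
set s := Num.sqrt (n%:R : R).
have s0 : 0 < s by rewrite sqrtr_gt0.
have s1 : 1 <= s by rewrite -sqrtr1 ler_sqrt ?ler1n.
have ss : s ^+ 2 = n%:R by rewrite sqr_sqrtr // ltW.
have l0 : 0 <= ln s by apply: ln_ge0.
have ls : ln s <= s by exact/ltW/ln_sublinear.
rewrite -ss lnXn // mulr2n; nra.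
Qed.

(** The extra factor [n] on the left accounts for [ln n]. *)
Lemma symmetry_negligible k : exists D, forall n,
  (n ^ 2 * (n.+1 ^ 3 * ((k * n).+1 * 2 ^ n)) * n <= D * 4 ^ n)%N.
Proof.
(* The factor of [2 ^ n] on the left has degree 7 in [n]. *)
exists (k.+1 * 7 ^ 7)%N => n.
have P := @poly_le_exp 7 n isT; move: (7 ^ 7)%N P => d P.
apply: (@leq_trans (k.+1 * (n.+1 ^ 7 * 2 ^ n))%N).
  have -> : (n ^ 2 * (n.+1 ^ 3 * ((k * n).+1 * 2 ^ n)) * n =
     (n ^ 3 * (k * n).+1) * (n.+1 ^ 3 * 2 ^ n))%N by rewrite !expnS !expn0; ring.
  have -> : (k.+1 * (n.+1 ^ 7 * 2 ^ n) =
     (n.+1 ^ 3 * (k.+1 * n.+1)) * (n.+1 ^ 3 * 2 ^ n))%N by rewrite !expnS !expn0; ring.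
  apply: leq_mul => //; apply: leq_mul; last by nia.
  by rewrite leq_exp2r.
have -> : (4 ^ n = 2 ^ n * 2 ^ n)%N by rewrite -expnMn.
rewrite -[leqRHS]mulnA; apply: leq_mul => //; rewrite mulnA; exact: leq_mul.
Qed.

(** On the negative side the error is governed by [C(2n, n)], on the positive side
    by the strips with symmetry. *)
Lemma strip_error (R : realType) (k D n : nat) :
  (n ^ 2 * (n.+1 ^ 3 * ((k * n).+1 * 2 ^ n)) * n <= D * 4 ^ n)%N ->
  (0 < k)%N -> (1 < n)%N ->
  `|(strip_coef k n)%:R * (2 * n%:R) / 4 ^+ n - 1| <=
  (4 + 2 * D%:R) * `|(ln (n%:R : R))^-1|.
Proof.
move=> HD k0 n1; have n0 : (0 < n)%N by lia.
have [lo hi] := strip_coef_estimate k0 n0.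
have L0 : 0 < ln (n%:R : R) by apply: ln_gt0; rewrite ltr1n.
have Ln : ln (n%:R : R) <= n%:R by apply/ltW/ln_sublinear; rewrite ltr0n.
have L2 := @ln_le_sqrt R n n0.
set L := ln _ in L0 Ln L2 *.
have p0 : 0 < (4 : R) ^+ n by rewrite exprn_gt0.
rewrite (gtr0_norm (_ : 0 < L^-1)) ?invr_gt0 // ler_pdivlMr //.
have -> : (strip_coef k n)%:R * (2 * n%:R) / 4 ^+ n - 1 =
    ((strip_coef k n)%:R * (2 * n%:R) - (4 : R) ^+ n) / 4 ^+ n.
  by rewrite mulrBl divff ?lt0r_neq0.
rewrite normrM (gtr0_norm (_ : 0 < (4 ^+ n)^-1)) ?invr_gt0 //.
rewrite mulrAC ler_pdivrMr //.
have loR : (4 : R) ^+ n <= (strip_coef k n)%:R * (2 * n%:R) + 2 * ('C(2 * n, n))%:R.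
  by move: lo; rewrite -(ler_nat R) natrX natrD !natrM; lra.
set E := (n ^ 2 * (n.+1 ^ 3 * ((k * n).+1 * 2 ^ n)))%N in hi.
have hiR : (strip_coef k n)%:R * (2 * n%:R) <= (4 : R) ^+ n + 2 * E%:R.
  by move: hi; rewrite -mulnA -/E -(ler_nat R) natrD natrX !natrM; lra.
have EL : (E%:R : R) * L <= D%:R * 4 ^+ n.
  move: HD; rewrite -/E -(ler_nat R) natrM [X in _ <= X]natrM natrX.
  by apply: le_trans; apply: ler_wpM2l.
have CL : ('C(2 * n, n))%:R * L <= 2 * (4 : R) ^+ n.
  have := central_bin_bound n; rewrite -(ler_nat R) natrM !natrX => CB.
  have c0 : 0 <= ('C(2 * n, n))%:R :> R by [].
  rewrite -(@ler_pXn2r _ 2) ?nnegrE //; try by rewrite mulr_ge0 // ltW.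
  rewrite !exprMn -(exprM 4 n 2) (mulnC n 2) (exprM 4 2 n).
  have -> : (4 : R) ^+ 2 = 16 by rewrite expr2; lra.
  move: CB; rewrite (_ : (2 * n).+1 = 2 * n + 1)%N; last by lia.
  rewrite natrD natrM.
  move: L2; set c := _ ^+ 2; set q := 16 ^+ n; set l2 := L ^+ 2 => L2 CB.
  have c00 : 0 <= c by rewrite sqr_ge0.
  have : c * l2 <= c * (4 * n%:R) by apply: ler_wpM2l.
  have nR : 0 <= (n%:R : R) by [].
  by rewrite (_ : 2 ^+ 2 = 4) ?expr2; nra.
set x := _ - 4 ^+ n.
have K0 : 0 <= D%:R * (4 : R) ^+ n by rewrite mulr_ge0 // ltW.
have : - (2 * ('C(2 * n, n))%:R) <= x <= 2 * E%:R by rewrite /x; apply/andP; split; lra.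
move=> /andP [x1 x2].
have L0' := ltW L0.
case: (ger0P x) => xs.
  apply: (@le_trans _ _ (2 * E%:R * L)); first exact: ler_wpM2r.
  by rewrite mulrDl; lra.
apply: (@le_trans _ _ (2 * ('C(2 * n, n))%:R * L)); first by apply: ler_wpM2r => //; lra.
by rewrite mulrDl; lra.
Qed.

End Asymptotics.

Unset Implicit Arguments.
Local Open Scope classical_set_scope.
Local Open Scope ring_scope.

Theorem theorem5p2 (R : realType) (i : nat) (i_gt0 : (0 < i)%N) :
  exists e : nat -> R,
    e =O_\oo (fun n => (ln (n%:R : R))^-1) /\
    \forall n \near \oo,
      (strip_coef i n)%:R = 4 ^+ n / (2 * n%:R) * (1 + e n).
Proof.
have [D HD] := symmetry_negligible i.
exists (fun n => (strip_coef i n)%:R * (2 * n%:R) / 4 ^+ n - 1); split.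
  apply/eqO_exP; exists (4 + 2 * D%:R); first by rewrite ltr_wpDr.
  by exists 2%N => // n /= n1; apply: strip_error.
exists 1%N => // n /= n0.
have nR : (n%:R : R) != 0 by rewrite pnatr_eq0 -lt0n.
have p0 : (4 : R) ^+ n != 0 by rewrite expf_neq0 // pnatr_eq0.
by rewrite addrC subrK; field; rewrite nR p0.
Qed.
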